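(* Let $\boldsymbol{Z}$ be a $(\boldsymbol{\zeta},\boldsymbol{\mu},\boldsymbol{\varphi})$-MSPD and $T\ge0$. Let $p\in\mathbb{N}^*$ and let $(\mathbf{x}_1,\dots,\mathbf{x}_p)\in(\mathbf{X}_T)^p$, $\mathbf{x}_j=(k_j,t_j,\theta_j,y_j)$, satisfy the compatibility condition. Then: (i) $\displaystyle \mathbb{E}[\boldsymbol{Z}_T]=\int_0^T\overline{\boldsymbol{\zeta}}(T-v)\Big(\boldsymbol{\mu}(v)+\int_0^v\overline{\boldsymbol{\Psi}}(v-w)\boldsymbol{\mu}(w)\,dw\Big)dv.$ (ii) $$\mathbb{E}[\boldsymbol{Z}_T\circ\varepsilon^{+,p}_{(\mathbf{x}_1,\dots,\mathbf{x}_p)}]=\mathbb{E}[\boldsymbol{Z}_T]+\sum_{j=1}^p\boldsymbol{\zeta}^{\cdot,k_j}(T-t_j,y_j)+\sum_{j=1}^p\int_{t_j}^T\overline{\boldsymbol{\zeta}}(T-v)\Big(\boldsymbol{\varphi}^{\cdot,k_j}(v-t_j,y_j)+\int_{t_j}^v\overline{\boldsymbol{\Psi}}(v-w)\boldsymbol{\varphi}^{\cdot,k_j}(w-t_j,y_j)\,dw\Big)dv.$$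
   Context: Fix $d\in\mathbb{N}^*=\{1,2,\dots\}$ and probability measures $\boldsymbol{\nu}^1,\dots,\boldsymbol{\nu}^d$ on $\mathbb{R}_+=[0,\infty)$. Let $\mathbf{X}=\{1,\dots,d\}\times\mathbb{R}_+^3$ with its Borel $\sigma$-field, points written $\mathbf{x}=(k,t,\theta,y)$, and $\mathbf{X}_T=\{1,\dots,d\}\times[0,T]\times\mathbb{R}_+^2$. Let $\mathfrak{m}$ be the measure on $\mathbf{X}$ given by $\int f\,d\mathfrak{m}=\sum_{k=1}^d\int_{\mathbb{R}_+^3}f(k,t,\theta,y)\,\boldsymbol{\nu}^k(dy)\,d\theta\,dt$. Let $\Omega$ be the space of configurations $\boldsymbol{\omega}=\sum_{j=1}^n\delta_{\mathbf{x}_j}$, $n\in\mathbb{N}\cup\{+\infty\}$, on $\mathbf{X}$ and $\mathbb{P}$ the probability on $\Omega$ under which the canonical evaluation $\mathbf{N}$ is a Poisson random measure with intensity measure $\mathfrak{m}$; $\mathbb{F}^{\mathbf{N}}$ is its natural filtration in the time coordinate $t$. All functions are tacitly Borel measurable. A $d$-kernel is a map $\boldsymbol{\zeta}:\mathbb{R}_+^2\to\mathcal{M}_{d,d}(\mathbb{R}_+)$ with $\int_{\mathbb{R}_+}\boldsymbol{\zeta}^{i,k}(t,y)\boldsymbol{\nu}^k(dy)<\infty$ for all $t\ge0$, $1\le i,k\le d$; put $\overline{\boldsymbol{\zeta}}(t)=\big(\int\boldsymbol{\zeta}^{i,k}(t,y)\boldsymbol{\nu}^k(dy)\big)_{i,k}$.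 It is non-explosive if $\int_0^\infty\overline{\boldsymbol{\zeta}}(t)dt$ has finite entries and spectral radius $<1$. A self-excitation $d$-kernel $\boldsymbol{\varphi}$ is a non-explosive $d$-kernel with $\boldsymbol{\varphi}^{i,k}(0,y)=0$ for all $i,k,y$; by convention $\boldsymbol{\varphi}(\tau,\cdot)=0$ for $\tau<0$. Put $\overline{\boldsymbol{\varphi}}_1=\overline{\boldsymbol{\varphi}}$, $\overline{\boldsymbol{\varphi}}_n(t)=\int_0^t\overline{\boldsymbol{\varphi}}(t-s)\overline{\boldsymbol{\varphi}}_{n-1}(s)ds$ for $n\ge2$, and $\overline{\boldsymbol{\Psi}}=\sum_{n\ge1}\overline{\boldsymbol{\varphi}}_n$ (convergent in $L^1(\mathbb{R}_+;dt)$). Given a $d$-kernel $\boldsymbol{\zeta}$, a self-excitation $d$-kernel $\boldsymbol{\varphi}$ and functions $\boldsymbol{\mu}^i:\mathbb{R}_+\to\mathbb{R}_+$ $(1\le i\le d)$, a $(\boldsymbol{\zeta},\boldsymbol{\mu},\boldsymbol{\varphi})$-MSPD (multidimensional self-exciting process with dependencies) is the $\mathbb{R}^d$-valued process $\boldsymbol{Z}$ such that for all $i$ and $T\ge0$ $$\boldsymbol{Z}^i_T=\int_{\mathbf{X}_T}\boldsymbol{\zeta}^{i,k}(T-t,y)\mathbf{1}_{\{\theta\le\boldsymbol{\lambda}^k_t\}}\mathbf{N}(dk,dt,d\theta,dy),\qquad \boldsymbol{\lambda}^i_T=\boldsymbol{\mu}^i(T)+\int_{\mathbf{X}_T}\boldsymbol{\varphi}^{i,k}(T-t,y)\mathbf{1}_{\{\theta\le\boldsymbol{\lambda}^k_t\}}\mathbf{N}(dk,dt,d\theta,dy),$$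 with $\boldsymbol{\lambda}$ ($\mathbb{F}^{\mathbf{N}}$-predictable) the intensity. For a functional $F$ on $\Omega$ and distinct points, $F\circ\varepsilon^{+,p}_{(\mathbf{x}_1,\dots,\mathbf{x}_p)}(\boldsymbol{\omega})=F(\boldsymbol{\omega}+\sum_{j=1}^p\delta_{\mathbf{x}_j})$ (for $\mathbb{P}$-a.e. $\boldsymbol{\omega}$). Points are listed in time order, $t_1\le\dots\le t_p$. They satisfy the compatibility condition if $\theta_1\le\boldsymbol{\mu}^{k_1}(t_1)$ and $\theta_m\le\boldsymbol{\mu}^{k_m}(t_m)+\sum_{j=1}^{m-1}\boldsymbol{\varphi}^{k_m,k_j}(t_m-t_j,y_j)$ for $m=2,\dots,p$. For a matrix $\boldsymbol{M}$, $\boldsymbol{M}^{\cdot,k}$ denotes its $k$-th column; vectors such as $\boldsymbol{\mu}$ and $\boldsymbol{Z}_T$ are column vectors. *)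

(* Defs.v *)
From HB Require Import structures.
From mathcomp Require Import all_boot all_order all_algebra.
From mathcomp Require Import all_classical all_reals all_analysis.
From mathcomp Require Import measurable_realfun complex.

Set Implicit Arguments.
Unset Strict Implicit.
Unset Printing Implicit Defensive.

Import Order.TTheory GRing.Theory Num.Theory.
Import numFieldNormedType.Exports.

Local Open Scope classical_set_scope.
Local Open Scope ring_scope.

(* The dimension d >= 1 is written n.+1 throughout. *)

Definition ord_display : measure_display. Proof. by constructor. Qed.

HB.instance Definition _ n := isPointed.Build 'I_n.+1 ord0.

HB.instance Definition _ n := @isMeasurable.Build ord_display 'I_n.+1
  discrete_measurable discrete_measurable0
  discrete_measurableC discrete_measurableU.

(* Points (k, t, theta, y); the state space X = {1..d} x [0,+oo[^3 is the
   subset [Xset] of this type. *)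
Notation pt R n := ('I_n.+1 * R * R * R)%type.

Section Space.
Context {R : realType} {n : nat}.
Implicit Types (x : pt R n) (A : set (pt R n)).

Definition ptype x : 'I_n.+1 := x.1.1.1.
Definition ptime x : R := x.1.1.2.
Definition plevel x : R := x.1.2.
Definition pmark x : R := x.2.

Definition Xset : set (pt R n) :=
  [set x | 0 <= ptime x] `&` [set x | 0 <= plevel x] `&` [set x | 0 <= pmark x].

Definition XT (T : R) : set (pt R n) := Xset `&` [set x | ptime x <= T].

Lemma measurable_ptime : measurable_fun setT ptime.
Proof.
rewrite /ptime; apply: measurableT_comp => //.
by apply: measurableT_comp => //; exact: measurableT_comp.
Qed.

Lemma measurable_plevel : measurable_fun setT plevel.
Proof. by rewrite /plevel; apply: measurableT_comp. Qed.

Lemma measurable_pmark : measurable_fun setT pmark.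
Proof. exact: measurable_snd. Qed.

Lemma measurable_Xset : measurable Xset.
Proof.
have ge0 (f : pt R n -> R) :
    measurable_fun setT f -> measurable [set x | 0 <= f x].
  move=> mf; rewrite (_ : [set x | _] = f @^-1` `[0, +oo[%classic).
    by rewrite -[X in measurable X]setTI; exact: mf.
  by apply/seteqP; split => x /=; rewrite in_itv/= andbT.
apply: measurableI; [apply: measurableI|]; apply: ge0.
- exact: measurable_ptime.
- exact: measurable_plevel.
- exact: measurable_pmark.
Qed.

(* A countable sum of Dirac masses at points of X; repetitions are allowed. *)
Record config := Config {
  cfg_meas :> {measure set (pt R n) -> \bar R} ;
  _ : exists (D : set nat) (u : nat -> pt R n),
    (forall j, D j -> Xset (u j)) /\
    forall A, cfg_meas A = (\esum_(j in D) \d_(u j) A)%E }.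

Lemma config0_subproof : exists (D : set nat) (u : nat -> pt R n),
    (forall j, D j -> Xset (u j)) /\
    forall A, @mzero _ (pt R n) R A = (\esum_(j in D) \d_(u j) A)%E.
Proof.
by exists set0, (fun=> point); split => // A; rewrite esum_set0.
Qed.

HB.instance Definition _ := gen_eqMixin config.
HB.instance Definition _ := gen_choiceMixin config.
HB.instance Definition _ := isPointed.Build config (Config config0_subproof).

(* The events {N(A) \in B}, for A a Borel subset of S. *)
Definition evaluations (S : set (pt R n)) : set_system config :=
  \bigcup_(A in [set A | measurable A /\ A `<=` S])
    preimage_set_system setT (fun w : config => w A)
      (measurable : set_system (\bar R)).

Definition Omega := g_sigma_algebraType (evaluations Xset).

Definition N (w : Omega) : {measure set (pt R n) -> \bar R} :=
  cfg_meas (w : config).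

Definition FN (t : R) : set_system Omega := <<s evaluations (XT t) >>.

Definition predictable_rect : set_system (Omega * R) :=
  [set C | exists2 B, FN 0 B & C = B `*` [set 0]] `|`
  [set C | exists B s t,
     [/\ 0 <= s, s <= t, FN s B & C = B `*` `]s, t]%classic]].

Definition predictable (h : Omega -> R -> R) :=
  measurable_fun
    ([set z | 0 <= z.2] : set (g_sigma_algebraType predictable_rect))
    (fun z => h z.1 z.2).

(* The configuration w + delta_x. The restriction to X makes the operation
   total: it only matters for x outside X, for which nothing is added. *)
Definition add_point_meas x (w : Omega) : {measure set (pt R n) -> \bar R} :=
  measure_add (N w) (mrestr (\d_x) measurable_Xset).

Lemma add_point_measE x (w : Omega) A :
  (add_point_meas x w A = N w A + \d_x (A `&` Xset))%E.
Proof. exact: measure_addE. Qed.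

Lemma add_point_subproof x (w : Omega) :
  exists (D : set nat) (u : nat -> pt R n),
    (forall j, D j -> Xset (u j)) /\
    forall A, add_point_meas x w A = (\esum_(j in D) \d_(u j) A)%E.
Proof.
case: w => w [D [u [Du wE]]].
pose D' : set nat := [set j | if j is j'.+1 then D j' else Xset x].
pose u' j := if j is j'.+1 then u j' else x.
exists D', u'; split; first by case.
move=> A; rewrite add_point_measE /N/= wE.
rewrite [RHS](esumID [set 0%N])// [RHS]addeC; congr (_ + _)%E.
  rewrite (_ : D' `&` _ = [set j.+1 | j in D]).
    by rewrite esum_image// => i j _ _ [].
  apply/seteqP; split => [[|j] [/= Dj]//|_ [j Dj <-]//].
  by move=> _; exists j.
rewrite diracE; have [Xx|Xx] := pselect (Xset x).
  rewrite (_ : D' `&` _ = [set 0%N]).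
    by rewrite esum_set1//= diracE in_setI (mem_set Xx) andbT.
  by apply/seteqP; split => [j []//|j ->].
rewrite (_ : D' `&` _ = set0) ?esum_set0; first by rewrite memNset// => -[].
by apply/seteqP; split => // j [/[swap] ->].
Qed.

Definition add_point x (w : Omega) : Omega := Config (add_point_subproof x w).

Definition eps_plus p (x : 'I_p -> pt R n) (w : Omega) : Omega :=
  foldr add_point w [seq x j | j <- enum 'I_p].

Lemma eps_plusE p (x : 'I_p -> pt R n) (w : Omega) A :
  (forall j, Xset (x j)) ->
  (N (eps_plus x w) A = N w A + \sum_(j < p) \d_(x j) A)%E.
Proof.
move=> Xx; rewrite /eps_plus -[in RHS]big_enum/=.
elim: (enum 'I_p) => [|j s IHs] /=; first by rewrite big_nil adde0.
rewrite big_cons {1}/N/= add_point_measE IHs.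
rewrite -addeA; congr (_ + _)%E; rewrite addeC; congr (_ + _)%E.
by rewrite !diracE in_setI (mem_set (Xx j)) andbT.
Qed.

End Space.
Arguments Xset : clear implicits.
Arguments Omega : clear implicits.

Section Model.
Context {R : realType} {n : nat}.
Local Open Scope ereal_scope.
Local Notation d := n.+1.
Local Notation leb := (@lebesgue_measure R).
Implicit Types (P : probability (Omega R n) R) (nu : 'I_d -> probability R R).
Implicit Types (zeta phi : R -> R -> 'M[R]_d) (mu : R -> 'cV[R]_d).
Implicit Types (Z lam : Omega R n -> R -> 'cV[R]_d).

(* The measure m, on Borel subsets of X. *)
Definition intensity nu (A : set (pt R n)) : \bar R :=
  \sum_(k < d) \int[leb]_(t in `[0%R, +oo[) \int[leb]_(th in `[0%R, +oo[)
    \int[nu k]_(y in `[0%R, +oo[) (\1_A (k, t, th, y))%:E.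

(* [poisson_prob r] is the Poisson law of parameter r (the Dirac mass at 0 if
   r = 0); the library gives it a second, unused, argument, here 0. *)
Definition is_PRM nu P : Prop :=
  [/\ forall A, measurable A -> A `<=` Xset R n -> intensity nu A < +oo ->
        forall j : nat, P [set w | N w A = j%:R%:E] =
                        poisson_prob (fine (intensity nu A)) 0 [set j],
      forall A, measurable A -> A `<=` Xset R n -> intensity nu A = +oo ->
        P [set w | N w A = +oo] = 1
    & forall (q : nat) (A : 'I_q -> set (pt R n)) (B : 'I_q -> set (\bar R)),
        (forall j, measurable (A j) /\ A j `<=` Xset R n) ->
        trivIset setT A -> (forall j, measurable (B j)) ->
        P (\bigcap_j [set w | B j (N w (A j))]) =
        \prod_(j < q) P [set w | B j (N w (A j))] ].

(* Functions on R_+ (resp. R_+^2) are coded by functions on R (resp. R^2)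
   whose values outside R_+ (resp. R_+^2) are irrelevant. *)
Definition is_kernel nu zeta : Prop := forall i k,
  [/\ measurable_fun [set z : R * R | (0 <= z.1)%R /\ (0 <= z.2)%R]
        (fun z => zeta z.1 z.2 i k),
      forall t y, (0 <= t)%R -> (0 <= y)%R -> (0 <= zeta t y i k)%R
    & forall t, (0 <= t)%R ->
        \int[nu k]_(y in `[0%R, +oo[) (zeta t y i k)%:E < +oo ].

Definition kbar nu zeta (i k : 'I_d) (t : R) : \bar R :=
  \int[nu k]_(y in `[0%R, +oo[) (zeta t y i k)%:E.

Definition spectral_radius (M : 'M[R]_d) : R :=
  sup [set Normc.normc z | z in
    [set z : R[i]%C | eigenvalue (map_mx (real_complex R) M) z]].

Definition non_explosive nu zeta : Prop :=
  let K i k := \int[leb]_(t in `[0%R, +oo[) kbar nu zeta i k t in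
  (forall i k, K i k < +oo) /\
  (spectral_radius (\matrix_(i, k) fine (K i k)) < 1)%R.

Definition is_self_excitation nu phi : Prop :=
  [/\ is_kernel nu phi, non_explosive nu phi
    & forall i k y, (0 <= y)%R -> phi 0%R y i k = 0%R].

(* [phibar nu phi m] is the (m+1)-fold convolution power. *)
Fixpoint phibar nu phi (m : nat) (i k : 'I_d) (t : R) : \bar R :=
  if m is m'.+1 then
    \int[leb]_(s in `[0%R, t])
      \sum_(l < d) kbar nu phi i l (t - s)%R * phibar nu phi m' l k s
  else kbar nu phi i k t.

Definition Psibar nu phi (i k : 'I_d) (t : R) : \bar R :=
  \sum_(0 <= m <oo) phibar nu phi m i k t.

Definition is_baseline mu : Prop := forall i,
  measurable_fun (`[0%R, +oo[%classic : set R) (fun t => mu t i ord0) /\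
  forall t, (0 <= t)%R -> (0 <= mu t i ord0)%R.

(* \int_{X_T} zeta^{i,k}(T - t, y) 1_{theta <= lam^k_t} N(dk,dt,dtheta,dy) *)
Definition thinned_int zeta lam (w : Omega R n) (T : R) (i : 'I_d) : \bar R :=
  \int[N w]_(x in XT T)
    (zeta (T - ptime x) (pmark x) i (ptype x) *
     (plevel x <= lam w (ptime x) (ptype x) ord0)%R%:R)%:E.

Definition MSPD_eqs zeta mu phi lam Z (w : Omega R n) : Prop :=
  forall T i, (0 <= T)%R ->
    (Z w T i ord0)%:E = thinned_int zeta lam w T i /\
    (lam w T i ord0)%:E = (mu T i ord0)%:E + thinned_int phi lam w T i.

(* For a fixed x, the law of the shifted configuration N + sum_j delta_{x_j} is
   singular to P, so Z o eps^{+,p}_x is not determined by the P-a.s. class of Z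
   (the a.s. equations only carry over to shifts by almost every x). The
   defining equations, being identities between functionals on Omega, are
   therefore read P-a.s. both at w and at the shift w + sum_j delta_{x_j}. *)
Definition is_MSPD P zeta mu phi p (x : 'I_p -> pt R n) Z : Prop :=
  exists lam : Omega R n -> R -> 'cV[R]_d,
    [/\ forall i, predictable (fun w t => lam w t i ord0),
        forall T i, (0 <= T)%R -> measurable_fun setT (fun w => Z w T i ord0),
        {ae P, forall w, MSPD_eqs zeta mu phi lam Z w}
      & {ae P, forall w, MSPD_eqs zeta mu phi lam Z (eps_plus x w)} ].

Definition compatible mu phi p (x : 'I_p -> pt R n) : Prop :=
  forall m : 'I_p,
    (plevel (x m) <= mu (ptime (x m)) (ptype (x m)) ord0 +
      \sum_(j < p | (j < m)%N)
        phi (ptime (x m) - ptime (x j)) (pmark (x j))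
          (ptype (x m)) (ptype (x j)))%R.

End Model.

(* Main.v *)
Require Import Defs.
From HB Require Import structures.
From mathcomp Require Import all_boot all_order all_algebra.
From mathcomp Require Import all_classical all_reals all_analysis.
From mathcomp Require Import measurable_realfun complex ring lra.

(* A solution [lam] of the intensity equation is only known to be predictable and
   a.s. real-valued, so its integrability has to be proved.

   Mecke's formula E \int F(w, x) N(w)(dx) = \int E F(w + delta_x, x) m(dx),
   together with the fact that a predictable process at time t does not see
   points with time >= t, turns the expectation of a thinned integral into a
   convolution with E[lam]; hence h = E[lam] solves the renewal equation
   h = b + phibar * h, where b is the baseline. Iterating it gives
   h >= b + Psibar * b. For the converse, the same formula applied below the
   level K of the thinned sum shows that \int_0^T phibar(T - s) lam_s ds is a.s.
   finite, and therefore lam^k is a.s. locally integrable whenever some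
   phibar^{i,k} is not a.e. zero. Stopping when the integral of those lam^k
   exceeds K gives an integrable subsolution of the renewal equation, which is
   at most b + Psibar * b because phibar is contracting in the norm of
   L^1(e^{-ct} dt) for large c. Let K tend to infinity.

   On the shifted configuration, the compatibility condition says that every
   added point survives the thinning, so the intensity solves the same equation
   with baseline mu + \sum_j phi(. - t_j, y_j); the mean depends linearly on the
   baseline. *)

Set Implicit Arguments.
Unset Strict Implicit.
Unset Printing Implicit Defensive.

Import Order.TTheory GRing.Theory Num.Theory.
Import numFieldNormedType.Exports.

Local Open Scope classical_set_scope.
Local Open Scope ring_scope.
Local Open Scope ereal_scope.

(** * Auxiliary measure theory *)

(** Mecke's formula is itself derived from the definition of a Poisson random measure. On an event
    that fixes the counts in the cells of a finite partition it reduces, by independence, to l P(N =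
    l) = m P(N = l - 1) for a Poisson variable of mean m; such events generate the sigma-algebra of
    configurations and their unions over count vectors are stable under intersection, so uniqueness
    of measures extends the identity.

    The obstacle throughout is that no mean is known to be finite, so nothing can be subtracted or
    cancelled. All computations are made with nonnegative functions with values in [0, +oo], and the
    two bounds on the mean intensity have separate proofs.

    Kernels and baselines are extended by 0 to negative times, which makes every time integral a
    convolution on the whole line. Formula (i) is obtained as the case of no added point of the mean
    of the shifted process, so a single computation serves both formulas. *)

Section Semidirect.
Context d d' (S : measurableType d) (X : measurableType d') (R : realType).
Variables (P : {measure set S -> \bar R}) (k : R.-sfker S ~> X).

(** The measure P(ds) k(s, dx) on the product space. *)
Definition semidirect (C : set (S * X)) : \bar R :=
  \int[P]_s k s (xsection C s).

Lemma measurable_kernel_xsection (C : set (S * X)) : measurable C ->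
  measurable_fun setT (fun s => k s (xsection C s)).
Proof.
move=> mC; rewrite (_ : (fun s => _) =
    (fun s => \int[k s]_x (\1_C (s, x))%:E)); last first.
  apply/funext => s; rewrite (_ : (fun x => _) = EFin \o \1_(xsection C s)).
    by rewrite integral_indic ?setIT//; exact: measurable_xsection.
  by apply/funext => x /=; rewrite !indicE mem_xsection.
apply: (measurable_fun_integral_sfinite_kernel (fun z => (\1_C z)%:E)) => //.
by apply/measurable_EFinP.
Qed.

Let semidirect0 : semidirect set0 = 0.
Proof. by rewrite /semidirect integral0_eq// => s _; rewrite xsection0. Qed.

Let semidirect_ge0 C : 0 <= semidirect C.
Proof. by apply: integral_ge0 => s _. Qed.

Let semidirect_sigma_additive : semi_sigma_additive semidirect.
Proof.
move=> F mF tF mUF; rewrite /semidirect.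
rewrite [X in _ --> X](_ : _ = \int[P]_s (\sum_(i <oo) k s (xsection (F i) s))).
  apply/cvg_closeP; split.
    by apply: is_cvg_nneseries => n _ _; exact: integral_ge0.
  rewrite closeE// integral_nneseries// => i.
  exact: measurable_kernel_xsection.
apply: eq_integral => s _; rewrite xsection_bigcup.
apply/esym/cvg_lim => //; apply: measure_semi_sigma_additive.
- by move=> i; exact: measurable_xsection.
- exact: trivIset_xsection.
- by apply: bigcupT_measurable => i; exact: measurable_xsection.
Qed.

HB.instance Definition _ := isMeasure.Build _ _ R semidirect
  semidirect0 semidirect_ge0 semidirect_sigma_additive.

Import HBNNSimple.

Lemma measurable_integral_kernel (f : S * X -> \bar R) :
  (forall z, 0 <= f z) -> measurable_fun setT f ->
  measurable_fun setT (fun s => \int[k s]_x f (s, x)).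
Proof. by move=> f0 mf; exact: measurable_fun_integral_sfinite_kernel. Qed.

Let integral_semidirect_nnsfun (f : {nnsfun (S * X)%type >-> R}) :
  \int[semidirect]_z (f z)%:E = \int[P]_s \int[k s]_x (f (s, x))%:E.
Proof.
under [in LHS]eq_integral do rewrite fimfunE -fsumEFin//.
rewrite ge0_integral_fsum//; last 2 first.
  - by move=> r; exact/measurable_EFinP/measurableT_comp.
  - by move=> r z _; rewrite EFinM nnfun_muleindic_ge0.
transitivity (\sum_(r \in range f)
    \int[P]_s (r%:E * k s (xsection (f @^-1` [set r]) s))).
  apply: eq_fsbigr => r /[!inE] -[z _ rE].
  have r0 : (0 <= r)%R by rewrite -rE.
  rewrite (integralZl_indic _ (fun r => f @^-1` [set r]))//; last first.
    by rewrite ltNge r0.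
  rewrite integral_indic// setIT ge0_integralZl//.
  by apply: measurable_kernel_xsection.
rewrite -ge0_integral_fsum//; last 2 first.
- by move=> r; apply: measurable_funeM; apply: measurable_kernel_xsection.
- move=> r s _; have [r0|r0] := leP 0%R r; first by rewrite mule_ge0.
  by rewrite preimage_nnfun0// xsection0 measure0 mule0.
apply: eq_integral => s _.
under [RHS]eq_integral do rewrite fimfunE -fsumEFin//.
rewrite [RHS]ge0_integral_fsum//; last 2 first.
  - move=> r; apply/measurable_EFinP; apply: measurable_funM => //.
    by apply: measurableT_comp => //; exact: measurableT_comp.
  - by move=> r z _; rewrite EFinM nnfun_muleindic_ge0.
apply: eq_fsbigr => r /[!inE] -[z _ rE].
have r0 : (0 <= r)%R by rewrite -rE.
under [RHS]eq_integral do rewrite EFinM.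
rewrite ge0_integralZl//; last first.
  by apply/measurable_EFinP; apply: measurableT_comp => //; exact: measurable_fun_pair2.
congr (_ * _); rewrite (_ : (fun x => _) = EFin \o \1_(xsection (f @^-1` [set r]) s)).
  by rewrite integral_indic ?setIT//; exact: measurable_xsection.
by apply/funext => x /=; rewrite !indicE mem_xsection.
Qed.

(** Extension from simple functions; monotone convergence is used in the inner integral, then in the
    outer one. *)
Lemma integral_semidirect (f : S * X -> \bar R) :
  (forall z, 0 <= f z) -> measurable_fun setT f ->
  \int[semidirect]_z f z = \int[P]_s \int[k s]_x f (s, x).
Proof.
move=> f0 mf.
pose f_ := nnsfun_approx measurableT mf.
transitivity (\int[semidirect]_z (lim ((f_ n z)%:E @[n --> \oo]))).
  by apply/eq_integral => z _; apply/esym/cvg_lim => //=; exact: cvg_nnsfun_approx.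
rewrite monotone_convergence//; last 3 first.
  by move=> n; exact/measurable_EFinP.
  by move=> n z _; rewrite lee_fin.
  by move=> z _ a b ab; rewrite lee_fin; exact/lefP/nd_nnsfun_approx.
rewrite (_ : (fun _ => _) =
    (fun n => \int[P]_s (\int[k s]_x (f_ n (s, x))%:E)))//; last first.
  by apply/funext => n; rewrite integral_semidirect_nnsfun.
have mf_ s n : measurable_fun setT (fun x => (f_ n (s, x))%:E).
  by apply/measurable_EFinP; apply: measurableT_comp.
have nd_ s x a b : (a <= b)%N -> ((f_ a (s, x))%:E <= (f_ b (s, x))%:E).
  by move=> ab; rewrite lee_fin; exact/lefP/nd_nnsfun_approx.
transitivity (\int[P]_s lim ((\int[k s]_x (f_ n (s, x))%:E) @[n --> \oo])).
  rewrite -monotone_convergence//.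
  - move=> n; apply: (measurable_integral_kernel (f := fun z => (f_ n z)%:E)).
      by move=> z; rewrite lee_fin.
    exact/measurable_EFinP.
  - by move=> n s _; apply: integral_ge0 => x _; rewrite lee_fin.
  - move=> s _ a b ab; apply: ge0_le_integral => //.
    + by move=> z _; rewrite lee_fin.
    + by move=> x _; exact: nd_.
apply: eq_integral => s _; rewrite -monotone_convergence//; last 2 first.
  - by move=> n x _; rewrite lee_fin.
  - by move=> x _ a b ab; exact: nd_.
by apply: eq_integral => x _; apply/cvg_lim => //; exact: cvg_nnsfun_approx.
Qed.

End Semidirect.

(** * Integrals stopped at a level *)

Section Cut.
Context d (X : measurableType d) (R : realType).
Variables (mu : {measure set X -> \bar R}) (tau : X -> R) (f : X -> \bar R).
Hypotheses (mtau : measurable_fun setT tau) (mf : measurable_fun setT f).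
Hypothesis f0 : forall x, 0 <= f x.

(** Makes an uncountable increasing union countable, so that monotone convergence applies. The
    sequence is n if [S] is unbounded, the constant sup S if it is attained, and sup S - 1/(n+1)
    otherwise. *)
Lemma downset_cofinal (S : set R) : S !=set0 ->
  (forall s t, S t -> (s <= t)%R -> S s) ->
  exists s : nat -> R, [/\ (forall n, S (s n)), nondecreasing_seq s
    & forall t, S t -> exists n, (t <= s n)%R].
Proof.
move=> S0 Sd; have [ubS|nubS] := pselect (has_ubound S); last first.
  exists (fun n => n%:R); split => [n|m n mn|t St].
  - apply: contrapT => Sn; apply: nubS; exists n%:R => t St.
    by rewrite leNgt; apply/negP => /ltW /(Sd _ _ St).
  - by rewrite ler_nat.
  - exists (Num.truncn t).+1; apply/ltW.
    by have := truncnS_gt t.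
have hsup : has_sup S by [].
have [Ssup|nSsup] := pselect (S (sup S)).
  by exists (fun=> sup S); split => // t St; exists 0%N; exact: sup_upper_bound.
exists (fun n => sup S - n.+1%:R^-1)%R; split => [n|m n mn|t St].
- have [t St lt] : exists2 t, S t & (sup S - n.+1%:R^-1 < t)%R.
    by apply: sup_adherent => //; rewrite invr_gt0.
  by apply: Sd St _; exact: ltW.
- by rewrite lerD2l lerN2 lef_pV2 ?posrE// ler_nat ltnS.
- have tlt : (t < sup S)%R.
    rewrite lt_neqAle (sup_upper_bound hsup) ?andbT//.
    by apply/eqP => tE; apply: nSsup; rewrite -tE.
  have [n nlt] := ltr_add_invr tlt.
  by exists n; rewrite lerBrDr; exact: ltW.
Qed.

Let A (s : R) := [set z | (tau z <= s)%R].

Let mA s : measurable (A s).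
Proof.
rewrite (_ : A s = tau @^-1` `]-oo, s]); last first.
  by apply/seteqP; split => z /=; rewrite in_itv.
by rewrite -[X in measurable X]setTI; exact: mtau.
Qed.

(* The integration domain is the union of the initial sets [A s] whose
   [f]-mass is at most [K]; these are totally ordered by inclusion. *)
Lemma integral_cut_le (K : \bar R) : 0 <= K ->
  \int[mu]_(x in [set x | \int[mu]_(z in [set z | (tau z <= tau x)%R]) f z <= K])
    f x <= K.
Proof.
move=> K0; pose S := [set s | \int[mu]_(z in A s) f z <= K].
rewrite (_ : [set x | _] = tau @^-1` S)//.
have [S0|/set0P S0] := eqVneq S set0.
  by rewrite S0 preimage_set0 integral_set0.
have Sd s t : S t -> (s <= t)%R -> S s.
  move=> St st; apply: le_trans St; apply: ge0_subset_integral => //.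
    exact: measurable_funTS.
  by move=> z /le_trans; exact.
have [s [Ss nds cofs]] := downset_cofinal S0 Sd.
rewrite (_ : tau @^-1` S = \bigcup_n A (s n)); last first.
  apply/seteqP; split => [z /cofs[n zn]|z [n _ zn]]; first by exists n.
  exact: Sd (Ss n) zn.
have cvg : \int[mu]_(x in A (s i)) f x @[i --> \oo] -->
    \int[mu]_(x in \bigcup_i A (s i)) f x.
  apply: ge0_nondecreasing_set_cvg_integral => //.
  - by move=> m n mn; apply/subsetPset => z /le_trans; apply; exact: nds.
  - by move=> i; exact: measurable_funTS.
rewrite -(cvg_lim _ cvg)//; apply: lime_le; first exact: cvgP cvg.
by near=> n; exact: Ss.
Unshelve. all: by end_near. Qed.

End Cut.

(** * Lebesgue measure on the time and level axes *)

Section LebR.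
Context {R : realType}.
Local Notation leb := (@lebesgue_measure R).
(* The library's Lebesgue measure lives on [measurableTypeR R], whose display is
   not the one of [R] as a factor of [pt R n]; [lebR] is the same function seen
   as a measure on [R]. *)
Definition lebR : set R -> \bar R := leb.

Let lebR0 : lebR set0 = 0. Proof. exact: (measure0 leb). Qed.
Let lebR_ge0 A : 0 <= lebR A. Proof. exact: (measure_ge0 leb). Qed.
Let lebR_sa : semi_sigma_additive lebR.
Proof. exact: (@measure_semi_sigma_additive _ _ _ leb). Qed.
HB.instance Definition _ := isMeasure.Build _ _ _ lebR lebR0 lebR_ge0 lebR_sa.
Let lebR_sf : sigma_finite setT lebR.
Proof. exact: (sigma_finiteT leb). Qed.
HB.instance Definition _ := Measure_isSigmaFinite.Build _ _ _ lebR lebR_sf.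

Import HBNNSimple.
(** Integrals are suprema over simple functions below the integrand, and the same simple functions,
    repackaged, serve on both types. *)
Lemma integral_lebR (D : set R) (f : R -> \bar R) :
  \int[leb]_(x in D) f x = \int[lebR]_(x in D) f x.
Proof.
have E (g : R -> \bar R) :
    [set sintegral leb h |
       h in [set h : {nnsfun measurableTypeR R >-> R} | forall x, (h x)%:E <= g x]]
    = [set sintegral lebR h |
       h in [set h : {nnsfun R >-> R} | forall x, (h x)%:E <= g x]].
  apply/seteqP; split => _ [h hg <-].
    pose h' : {nnsfun R >-> R} := HB.pack (h : R -> R)
      (@isMeasurableFun.Build _ _ _ _ (h : R -> R) (@measurable_funP _ _ _ _ setT h))
      (FiniteImage.Build _ _ (h : R -> R) (@fimfunP _ _ h))
      (@isNonNegFun.Build _ _ (h : R -> R) (@fun_ge0 _ _ h)).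
    by exists h'.
  pose h' : {nnsfun measurableTypeR R >-> R} := HB.pack (h : measurableTypeR R -> R)
    (@isMeasurableFun.Build _ _ (measurableTypeR R) R (h : measurableTypeR R -> R)
      (@measurable_funP _ _ _ _ setT h))
    (FiniteImage.Build _ _ (h : measurableTypeR R -> R) (@fimfunP _ _ h))
    (@isNonNegFun.Build _ _ (h : measurableTypeR R -> R) (@fun_ge0 _ _ h)).
  by exists h'.
by rewrite /integral !E.
Qed.

Lemma lebR_cc (a b : R) : lebR `[a, b] = (Num.max 0 (b - a))%:E.
Proof.
transitivity (leb `[a, b]) => //; rewrite lebesgue_measure_itv/= lte_fin.
case: ltP => ab; first by rewrite max_r ?subr_ge0 1?ltW// EFinB.
by rewrite max_l// subr_le0.
Qed.

End LebR.

(** * Sigma-finiteness of products *)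

Section ProductSigmaFinite.
Context d1 d2 (T1 : measurableType d1) (T2 : measurableType d2) (R : realType).
Variable m1 : {sigma_finite_measure set T1 -> \bar R}.
Variable m2 : {sigma_finite_measure set T2 -> \bar R}.

(* A copy of [m1 \x m2], which has no sigma-finite instance in the library. *)
Definition prod_meas : set (T1 * T2) -> \bar R := (m1 \x m2)%E.

HB.instance Definition _ := Measure.on prod_meas.

Let prod_meas_sigma_finite : sigma_finite setT prod_meas.
Proof.
have /sigma_finiteP[F [TF ndF Foo]] := sigma_finiteT m1.
have /sigma_finiteP[G [TG ndG Goo]] := sigma_finiteT m2.
exists (fun n => F n `*` G n).
  apply/esym/seteqP; split => // -[x y] _.
  have [m _ Fx] : (\bigcup_i F i) x by rewrite -TF.
  have [n _ Gy] : (\bigcup_i G i) y by rewrite -TG.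
  exists (maxn m n) => //; split => /=.
    by move: Fx; exact/subsetPset/ndF/leq_maxl.
  by move: Gy; exact/subsetPset/ndG/leq_maxr.
move=> k; have [mF Fk] := Foo k; have [mG Gk] := Goo k.
split; first exact: measurableX.
by rewrite /prod_meas product_measure1E// lte_mul_pinfty// ge0_fin_numE.
Qed.

HB.instance Definition _ :=
  Measure_isSigmaFinite.Build _ _ _ prod_meas prod_meas_sigma_finite.

End ProductSigmaFinite.

Lemma ge0_integral_mrestr d (T : measurableType d) (R : realType)
    (mu : {measure set T -> \bar R}) (D : set T) (mD : measurable D)
    (f : T -> \bar R) : measurable_fun setT f -> (forall x, 0 <= f x) ->
  \int[mrestr mu mD]_x f x = \int[mu]_(x in D) f x.
Proof.
move=> mf f0; rewrite -(setvU D) ge0_integral_setU//; last 3 first.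
- exact: measurableC.
- by rewrite setvU.
- by apply/disj_set2P; rewrite setICl.
rewrite (eq_measure_integral (D := ~` D) mzero); last first.
  move=> A mA; rewrite -disjoints_subset => AD.
  by rewrite /= /mrestr AD measure0.
rewrite integral_measure_zero add0e; apply: eq_measure_integral => A mA AD.
by rewrite /= /mrestr setIidl.
Qed.

(** * The intensity measure and the space of configurations *)

Section PointMeasure.
Context {R : realType} {n : nat}.
Variable nu : 'I_n.+1 -> probability R R.
Local Notation leb := (@lebR R).
Local Notation X := (Xset R n).

Definition emb (k : 'I_n.+1) (z : R * (R * R)) : pt R n :=
  (k, z.1, z.2.1, z.2.2).

Lemma measurable_emb k : measurable_fun setT (emb k).
Proof.
have m12 : measurable_fun setT (fun z : R * (R * R) => z.2.1).
  by apply: (measurableT_comp (f := fst)) => //; exact: measurable_snd.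
have m22 : measurable_fun setT (fun z : R * (R * R) => z.2.2).
  by apply: (measurableT_comp (f := snd)) => //; exact: measurable_snd.
by do 3!apply: measurable_fun_pair => //.
Qed.
Definition space_prod (k : 'I_n.+1) : {measure set (R * (R * R)) -> \bar R} :=
  prod_meas leb (prod_meas leb (nu k)).

Definition pmeas_type (k : 'I_n.+1) : {measure set (pt R n) -> \bar R} :=
  measure_function_pushforward__canonical__measure_function_Measure
    (space_prod k) (measurable_emb k).

(** [intensity] is only a set function; this is a genuine measure that agrees with it on Borel
    subsets of X. [inord] appears because [msum] is indexed by natural numbers. *)
Definition pmeas : set (pt R n) -> \bar R :=
  mrestr (msum (fun i => pmeas_type (inord i)) n.+1) (@measurable_Xset R n).

HB.instance Definition _ := Measure.on pmeas.

Lemma pmeasE A : pmeas A = \sum_(k < n.+1) pmeas_type k (A `&` X).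
Proof.
by rewrite /pmeas /mrestr /msum/=; apply: eq_bigr => i _; rewrite inord_val.
Qed.

Lemma ge0_integral_pmeas_type k (f : pt R n -> \bar R) :
  measurable_fun setT f -> (forall x, 0 <= f x) ->
  \int[pmeas_type k]_x f x =
  \int[leb]_t \int[leb]_th \int[nu k]_y f (k, t, th, y).
Proof.
move=> mf f0; rewrite ge0_integral_pushforward//; last exact: measurable_emb.
have mfe : measurable_fun setT (f \o emb k).
  by apply: measurableT_comp => //; exact: measurable_emb.
rewrite preimage_setT fubini_tonelli1//; last by move=> z; exact: f0.
apply: eq_integral => t _; rewrite /fubini_F.
pose g (z : R * R) := f (k, t, z.1, z.2).
rewrite -(fubini_tonelli1 (m1 := leb) (m2 := nu k) g)//.
  rewrite (_ : g = (fun z => (f \o emb k) (t, z))) //.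
  exact: (measurable_fun_pair2 t mfe).
by move=> z; exact: f0.
Qed.

Lemma ge0_integral_pmeas (f : pt R n -> \bar R) :
  measurable_fun setT f -> (forall x, 0 <= f x) ->
  \int[pmeas]_x f x = \sum_(k < n.+1) \int[leb]_(t in `[0%R, +oo[)
    \int[leb]_(th in `[0%R, +oo[) \int[nu k]_(y in `[0%R, +oo[)
      f (k, t, th, y).
Proof.
move=> mf f0; rewrite /pmeas.
have mfX : measurable_fun setT (f \_ X).
  apply/(measurable_restrictT f (@measurable_Xset R n)).
  exact: measurable_funTS.
have fX0 x : 0 <= (f \_ X) x by rewrite patchE; case: ifP.
transitivity (\int[msum (fun i => pmeas_type (inord i)) n.+1]_x (f \_ X) x).
  have h := ge0_integral_mrestr (msum (fun i => pmeas_type (inord i)) n.+1) (@measurable_Xset R n) mf f0.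
  by apply: (eq_trans h); exact: integral_mkcond.
rewrite ge0_integral_measure_sum//; apply: eq_bigr => k _; rewrite inord_val.
rewrite (ge0_integral_pmeas_type k mfX fX0) [RHS]integral_mkcond; apply: eq_integral => t _.
rewrite [RHS]patchE; case: ifPn => [/set_mem|]; rewrite ?notin_setE /= in_itv/= andbT => t0; last first.
  apply: integral0_eq => th _; apply: integral0_eq => y _.
  by rewrite patchE ifF//; apply/negbTE/negP => /set_mem [[/=]].
rewrite [RHS]integral_mkcond; apply: eq_integral => th _.
rewrite [RHS]patchE; case: ifPn => [/set_mem|]; rewrite ?notin_setE /= in_itv/= andbT => th0; last first.
  apply: integral0_eq => y _.
  by rewrite patchE ifF//; apply/negbTE/negP => /set_mem [[/=]].
rewrite [RHS]integral_mkcond; apply: eq_integral => y _.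
rewrite !patchE; congr (if _ then _ else _); apply/idP/idP; rewrite !inE/= in_itv/= andbT.
  by case.
by move=> y0; split.
Qed.

Lemma pmeas_intensity (A : set (pt R n)) : measurable A -> A `<=` X ->
  intensity nu A = pmeas A.
Proof.
move=> mA AX; rewrite -[A in RHS]setIT -integral_indic// ge0_integral_pmeas.
- rewrite /intensity; apply: eq_bigr => k _; rewrite integral_lebR.
  apply: eq_integral => t _; rewrite integral_lebR.
  by apply: eq_integral => th _; apply: eq_integral => y _.
- exact/measurable_EFinP.
- by move=> x; rewrite lee_fin.
Qed.

(** Bounding the time and the level is enough for finite mass, since the marks have a probability
    law. *)
Definition pbox (a : nat) : set (pt R n) :=
  X `&` [set x | (ptime x <= a%:R)%R /\ (plevel x <= a%:R)%R].

Lemma measurable_le_fun d (S : measurableType d) (f g : S -> R) :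
  measurable_fun setT f -> measurable_fun setT g ->
  measurable [set x | (f x <= g x)%R].
Proof.
move=> mf mg; rewrite (_ : [set x | _] = (fun x => (f x <= g x)%R) @^-1` [set true]).
  by rewrite -[X in measurable X]setTI; exact: measurable_fun_ler.
by apply/seteqP; split.
Qed.

Lemma measurable_pbox a : measurable (pbox a).
Proof.
apply: measurableI; first exact: measurable_Xset.
apply: (measurableI [set x | _] [set x | _]); apply: measurable_le_fun => //.
  exact: measurable_ptime.
exact: measurable_plevel.
Qed.

Lemma pbox_cover : \bigcup_a pbox a = X.
Proof.
apply/seteqP; split => [x [a _ []]//|x Xx].
pose b := (Num.truncn (Num.max (ptime x) (plevel x))).+1.
have /ltW : (Num.max (ptime x) (plevel x) < b%:R)%R by exact: truncnS_gt.
by rewrite ge_max => /andP[? ?]; exists b.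
Qed.

Lemma pmeas_pbox a : pmeas (pbox a) < +oo.
Proof.
rewrite pmeasE; apply: lte_sum_pinfty => k _.
apply: (@le_lt_trans _ _ (space_prod k (`[0%R, a%:R] `*` (`[0%R, a%:R] `*` setT)))).
  rewrite /pmeas_type/= /pushforward; apply: le_measure; rewrite ?inE//.
  - rewrite -[X in measurable X]setTI; apply: measurable_emb => //.
    by apply: measurableI; [exact: measurable_pbox|exact: measurable_Xset].
  - by apply: measurableX => //; apply: measurableX.
  - move=> [t [th y]] [[_ [/= ta tha]] [[t0 th0] y0]].
    by split=> /=; [|split => //=]; rewrite in_itv/=; apply/andP.
rewrite /space_prod [X in X < _]product_measure1E//; last exact: measurableX.
rewrite [X in _ * X]product_measure1E//.
have lebfin : lebR `[0%R, (a%:R : R)] \is a fin_num by rewrite lebR_cc.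
by rewrite [X in _ * (_ * X)](@probability_setT _ _ _ (nu k)) mule1 ltey_eq fin_numM//; exact: lebfin.
Qed.

Let pmeas_sigma_finite : sigma_finite setT pmeas.
Proof.
exists (fun a => pbox a `|` ~` X).
  apply/esym/seteqP; split => // x _; have [|nXx] := pselect (X x).
    by rewrite -[in X in X -> _]pbox_cover => -[a _ xa]; exists a => //; left.
  by exists 0%N => //; right.
move=> a; split.
  by apply: measurableU; [exact: measurable_pbox|apply: measurableC; exact: measurable_Xset].
apply: le_lt_trans (pmeas_pbox a).
rewrite (le_trans (measureU2 _ _ _))//.
- exact: measurable_pbox.
- by apply: measurableC; exact: measurable_Xset.
rewrite [X in _ + X](_ : _ = 0) ?adde0//.
by rewrite [LHS]pmeasE big1// => k _; rewrite setICl measure0.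
Qed.

HB.instance Definition _ :=
  Measure_isSigmaFinite.Build _ _ _ pmeas pmeas_sigma_finite.

Definition shell := seqDU pbox.

Lemma measurable_shell a : measurable (shell a).
Proof. apply: measurableD; first exact: measurable_pbox.
by apply: bigsetU_measurable => i _; exact: measurable_pbox. Qed.

Lemma shell_cover : \bigcup_a shell a = X.
Proof. by rewrite -pbox_cover [RHS]seqDU_bigcup_eq. Qed.

Lemma trivIset_shell : trivIset setT shell.
Proof. exact: trivIset_seqDU. Qed.

Lemma shell_Xset a : shell a `<=` X.
Proof. by rewrite -shell_cover; exact: bigcup_sup. Qed.

Lemma pmeas_shell a : pmeas (shell a) < +oo.
Proof.
apply: le_lt_trans (pmeas_pbox a); apply: le_measure; rewrite ?inE.
- exact: measurable_shell.
- exact: measurable_pbox.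
- exact: subset_seqDU.
Qed.

End PointMeasure.

(** * Measurability on the space of configurations *)

Section Configurations.
Context {R : realType} {n : nat}.
Local Notation X := (Xset R n).
Local Notation Omega := (Omega R n).

Lemma N_Xset (w : Omega) A : N w A = N w (A `&` X).
Proof.
case: w => w [D [u [Du wE]]]; rewrite /N/= !wE; apply: eq_esum => j /Du Xj.
by rewrite !diracE in_setI (mem_set Xj) andbT.
Qed.

(** The mass of [A] counts indices: it is the cardinal of [D] intersected with the preimage of [A]
    under [u], written as a sum of Dirac masses on the integers. *)
Lemma N_nat_or_pinfty (w : Omega) A : N w A = +oo \/ exists l : nat, N w A = l%:R%:E.
Proof.
case: w => w [D [u [Du wE]]]; rewrite /N/= wE.
have -> : \esum_(j in D) \d_(u j) A =
    \esum_(j in D `&` (u @^-1` A)) \d_j (D `&` (u @^-1` A)) :> \bar R.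
  rewrite esum_mkcondr; apply: eq_esum => j Dj; rewrite !diracE in_setI.
  have -> : (j \in u @^-1` A) = (u j \in A) by apply/idP/idP; rewrite !inE.
  by rewrite (mem_set Dj)/=; case: (_ \in _).
have [fin|inf] := pselect (finite_set (D `&` (u @^-1` A))).
  by right; rewrite finite_card_dirac//; eexists.
by left; rewrite infinite_card_dirac.
Qed.

Lemma measurable_N_Xset A : measurable A -> A `<=` X ->
  measurable_fun setT (fun w : Omega => N w A).
Proof.
move=> mA AX _ B mB; rewrite setTI; apply: sub_sigma_algebra.
by exists A => //; exists B => //; rewrite setTI.
Qed.

Lemma measurable_N A : measurable A ->
  measurable_fun setT (fun w : Omega => N w A).
Proof.
move=> mA; under eq_fun do rewrite N_Xset.
apply: measurable_N_Xset; last exact: subIsetr.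
by apply: measurableI => //; exact: measurable_Xset.
Qed.

Lemma measurable_to_Omega d (S : measurableType d) (g : S -> Omega) :
  (forall A, measurable A -> A `<=` X ->
    measurable_fun setT (fun s => N (g s) A)) ->
  measurable_fun setT g.
Proof.
move=> mg.
apply: (@measurability _ _ S Omega setT g (@evaluations R n X) erefl).
move=> _ [_ [A [mA AX] [B mB <-]] <-].
rewrite setTI preimage_setI preimage_setT -[X in measurable X]setTI setTI setTI.
by rewrite -[X in measurable X]setTI; exact: mg.
Qed.

Lemma N_add_point x (w : Omega) A : X x -> N (add_point x w) A = N w A + \d_x A.
Proof.
move=> Xx; rewrite [LHS]add_point_measE; congr (_ + _).
by rewrite !diracE in_setI (mem_set Xx) andbT.
Qed.

Lemma measurable_add_point :
  measurable_fun setT (fun z : pt R n * Omega => add_point z.1 z.2).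
Proof.
apply: measurable_to_Omega => A mA AX.
under eq_fun do rewrite [N _ _]add_point_measE.
apply: emeasurable_funD.
  apply: (measurableT_comp (f := fun w : Omega => N w A)) => //.
  exact: measurable_N.
rewrite (setIidl AX); under eq_fun do rewrite diracE.
apply/measurable_EFinP.
rewrite (_ : (fun x => _) = \1_A \o (@fst (pt R n) Omega)).
  by apply: measurableT_comp.
by apply/funext => z; rewrite /= indicE.
Qed.

(** Sigma-finiteness along a fixed exhaustion; it holds almost surely and is not affected by adding
    a point. *)
Definition Good : set Omega := [set w | forall a, N w (@shell R n a) < +oo].

Lemma Good_add_point x w : X x -> Good (add_point x w) <-> Good w.
Proof.
move=> Xx; split => G a; have := G a; rewrite N_add_point//.
  by apply: le_lt_trans; rewrite leeDl.
by move=> Na; rewrite lte_add_pinfty// diracE ltry.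
Qed.

Lemma measurable_Good : measurable Good.
Proof.
rewrite (_ : Good = \bigcap_a [set w : Omega | N w (@shell R n a) < +oo]).
  apply: bigcapT_measurable => a.
  rewrite -[X in measurable X]setTI; apply: emeasurable_fun_infty_o => //.
  by apply: measurable_N; exact: measurable_shell.
by apply/seteqP; split => w Gw a; [move=> _|]; exact: Gw.
Qed.

End Configurations.

(** * The configuration as a kernel *)

Section CountKernel.
Context {R : realType} {n : nat}.
Context d (S : measurableType d) (g : S -> Omega R n) (mg : measurable_fun setT g).
Local Notation X := (Xset R n).

(** Splitting by the value [l] of the count bounds the mass of each piece uniformly in [s], so each
    piece is a finite kernel and the sum is s-finite. *)
Definition shell_count (a l : nat) (s : S) : {measure set (pt R n) -> \bar R} :=
  if N (g s) (@shell R n a) == l%:R%:E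
  then (mrestr (N (g s)) (@measurable_shell R n a) : {measure set _ -> \bar R})
  else mzero.

Let measurable_Ng A : measurable A -> measurable_fun setT (fun s => N (g s) A).
Proof.
by move=> mA; apply: (measurableT_comp (f := fun w : Omega R n => N w A)) => //;
  exact: measurable_N.
Qed.

Let measurable_shell_count a l (U : set (pt R n)) : measurable U ->
  measurable_fun setT (fun s => shell_count a l s U).
Proof.
move=> mU; rewrite (_ : (fun s => _) = (fun s =>
    if N (g s) (@shell R n a) == l%:R%:E then N (g s) (U `&` @shell R n a) else 0)).
  apply: measurable_fun_ifT => //.
  - apply: measurable_fun_eqe => //; apply: measurable_Ng; exact: measurable_shell.
  - by apply: measurable_Ng; apply: measurableI => //; exact: measurable_shell.
by apply/funext => s; rewrite /shell_count; case: ifPn.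
Qed.

HB.instance Definition _ a l :=
  isKernel.Build _ _ S (pt R n) R (shell_count a l) (measurable_shell_count a l).

Let shell_count_uub a l : measure_fam_uub (shell_count a l).
Proof.
exists l.+1%:R => s; rewrite /shell_count; case: ifPn => [/eqP sl|_].
  have lt : mrestr (N (g s)) (@measurable_shell R n a) setT < l.+1%:R%:E.
    by rewrite /mrestr setTI [X in X < _]sl lte_fin ltr_nat.
  exact: lt.
by rewrite /= /mzero lte_fin.
Qed.

HB.instance Definition _ a l :=
  Kernel_isFinite.Build _ _ S (pt R n) R (shell_count a l) (shell_count_uub a l).

(* Integration against [N (g s)] is only measurable in [s] where [N (g s)] is
   finite on every shell; elsewhere the shells of infinite mass are dropped. *)
Definition count_kernel : R.-sfker S ~> pt R n :=
  kseries (fun a => (kseries (fun l => (shell_count a l : R.-sfker S ~> pt R n))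
    : R.-sfker S ~> pt R n)).

Lemma count_kernelE s A : Good (g s) -> measurable A -> count_kernel s A = N (g s) A.
Proof.
move=> Gs mA; rewrite N_Xset -shell_cover setI_bigcupr.
rewrite measure_bigcup//; last 2 first.
- by move=> a _; apply: measurableI => //; exact: measurable_shell.
- by apply: trivIset_setIl; exact: trivIset_shell.
rewrite /count_kernel/= /mseries.
under [RHS]eq_eseriesl do rewrite in_setT.
apply: eq_eseriesr => a _; rewrite /mseries/=.
have [Noo|[l Nl]] := N_nat_or_pinfty (g s) (@shell R n a).
  by have := Gs a; rewrite Noo.
transitivity (\sum_(0 <= i <oo) shell_count a i s A) => //.
rewrite (nneseriesD1 (n := l))//= eseries0 ?adde0.
  by rewrite /shell_count Nl eqxx.
move=> i _ /= il; rewrite /shell_count Nl eqe eqr_nat.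
by rewrite eq_sym (negbTE il).
Qed.

Lemma integral_count_kernel s (f : pt R n -> \bar R) : Good (g s) ->
  \int[count_kernel s]_x f x = \int[N (g s)]_x f x.
Proof.
by move=> Gs; apply: eq_measure_integral => A mA _; exact: count_kernelE.
Qed.

End CountKernel.

(** * Mecke's formula *)

(** Countable additivity transported to the integers by [pickle]. It is applied to unions indexed by
    a piece of a partition and a count vector. *)
Lemma eq_measure_countable_bigcup d (T : measurableType d) (R : realType)
    (K : countType) (m1 m2 : {measure set T -> \bar R}) (F : K -> set T) :
  (forall k, measurable (F k)) -> trivIset setT F ->
  (forall k, m1 (F k) = m2 (F k)) ->
  m1 (\bigcup_k F k) = m2 (\bigcup_k F k).
Proof.
move=> mF tF eF; pose D := [set pickle k | k in [set: K]].
pose G (j : nat) := if unpickle j is Some k then F k else set0.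
have GE k : G (pickle k) = F k by rewrite /G pickleK.
have -> : \bigcup_k F k = \bigcup_(j in D) G j.
  apply/seteqP; split => [x [k _ Fx]|x [_ [k _ <-]]].
    by exists (pickle k); [exists k|rewrite GE].
  by rewrite GE => Fx; exists k.
rewrite !measure_bigcup//.
- by apply: eq_eseriesr => j /set_mem[k _ <-]; rewrite GE.
- by move=> _ [k _ <-]; rewrite GE.
- move=> _ _ [k _ <-] [l _ <-]; rewrite !GE => kl.
  by rewrite (tF k l).
- by move=> _ [k _ <-]; rewrite GE.
- move=> _ _ [k _ <-] [l _ <-]; rewrite !GE => kl.
  by rewrite (tF k l).
Qed.

(** * Events determined by the counts in a finite partition *)

Section Partitions.
Context {R : realType} {n : nat}.
Local Notation X := (Xset R n).
Local Notation Omega := (Omega R n).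

Definition is_partition (I : finType) (a : I -> set (pt R n)) : Prop :=
  [/\ forall i, measurable (a i), trivIset setT a & \bigcup_i a i = X].

Lemma partition_subX (I : finType) (a : I -> set (pt R n)) i :
  is_partition a -> a i `<=` X.
Proof. by move=> [_ _ <-]; exact: bigcup_sup. Qed.

Lemma N_sum (I : finType) (a : I -> set (pt R n)) (A : set (pt R n)) (w : Omega) :
  is_partition a -> measurable A -> N w A = \sum_i N w (A `&` a i).
Proof.
move=> [ma ta aX] mA; rewrite N_Xset -aX setI_bigcupr.
rewrite measure_fin_bigcup; [|exact: finite_finset|exact: trivIset_setIl|]; last first.
  by move=> i _; exact: measurableI.
rewrite (fsbigE (index_enum I))//; last 2 first.
- exact: index_enum_uniq.
- by move=> i _; rewrite mem_index_enum.
by apply: eq_bigl => i; rewrite in_setT.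
Qed.

Lemma is_partitionI (I J : finType) (a : I -> set (pt R n)) (b : J -> set (pt R n)) :
  is_partition a -> is_partition b ->
  is_partition (fun ij : I * J => a ij.1 `&` b ij.2).
Proof.
move=> [ma ta aX] [mb tb bX]; split.
- by move=> ij; exact: measurableI.
- move=> [i j] [i' j'] _ _ /= [x [[ax bx] [ax' bx']]].
  by congr (_, _); [apply: ta => //; exists x|apply: tb => //; exists x].
- apply/seteqP; split => [x [ij _ [ax _]]|x Xx].
    by rewrite -aX; exists ij.1.
  move: (Xx); rewrite -{1}aX => -[i _ ax].
  by move: Xx; rewrite -bX => -[j _ bx]; exists (i, j).
Qed.

Definition is_partition_bool (A : set (pt R n)) : measurable A -> A `<=` X ->
  is_partition (fun b : bool => if b then A else X `\` A).
Proof.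
move=> mA AX; split.
- by case=> //; apply: measurableD => //; exact: measurable_Xset.
- by move=> [] [] _ _ //= [x []] //= => [Ax []|[] _ nA /nA].
- apply/seteqP; split => [x [[] _ //]|x Xx]; first exact: AX.
    by case.
  by have [Ax|nAx] := pselect (A x); [exists true|exists false].
Qed.

(** [C] may be arbitrary: count vectors take countably many values, so the event is a countable
    union of cells, hence measurable. *)
Definition partition_event (B : set Omega) : Prop :=
  exists (I : finType) (a : I -> set (pt R n)) (C : set (I -> \bar R)),
    is_partition a /\ B = [set w | C (fun i => N w (a i))].

(** Both events are read on the common refinement of the two partitions, from which the counts of
    either one are recovered by summation. *)
Lemma setI_closed_partition_event : setI_closed partition_event.
Proof.
move=> _ _ [I [a [C [pa ->]]]] [J [b [D [pb ->]]]].
exists (I * J)%type, (fun ij => a ij.1 `&` b ij.2).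
exists [set v | C (fun i => \sum_j v (i, j)) /\ D (fun j => \sum_i v (i, j))].
split; first exact: is_partitionI.
have [ma _ _] := pa; have [mb _ _] := pb.
apply/seteqP; split => w /=.
  move=> [Cw Dw]; split.
    by rewrite (_ : (fun i => _) = (fun i => N w (a i)))//;
      apply/funext => i; rewrite (N_sum w pb (ma i)).
  rewrite (_ : (fun i => _) = (fun i => N w (b i)))//.
  apply/funext => i; rewrite (N_sum w pa (mb i)).
  by apply: eq_bigr => j _; rewrite setIC.
move=> [Cw Dw]; split.
  by rewrite (_ : (fun i => N w (a i)) = (fun i => \sum_j N w (a i `&` b j)))//;
    apply/funext => i; rewrite (N_sum w pb (ma i)).
rewrite (_ : (fun i => N w (b i)) = (fun j => \sum_i N w (a i `&` b j)))//.
apply/funext => i; rewrite (N_sum w pa (mb i)).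
by apply: eq_bigr => j _; rewrite setIC.
Qed.

(** Coding the possible counts by a countable type lets count vectors index a countable union of
    cells. *)
Definition ext_nat (v : option nat) : \bar R := if v is Some l then l%:R%:E else +oo.

Lemma ext_nat_inj : injective ext_nat.
Proof.
by move=> [l|] [l'|] //= [] /eqP; rewrite eqr_nat => /eqP ->.
Qed.

Lemma ext_nat_ge0 v : 0 <= ext_nat v.
Proof. by case: v => [l|] /=; rewrite ?lee_fin ?leey. Qed.

Lemma N_ext_nat (w : Omega) A : exists v, N w A = ext_nat v.
Proof.
by have [->|[l ->]] := N_nat_or_pinfty w A; [exists None|exists (Some l)].
Qed.

Definition cell (I : finType) (a : I -> set (pt R n)) (v : I -> option nat) : set Omega :=
  [set w | forall i, N w (a i) = ext_nat (v i)].

Lemma measurable_cell (I : finType) (a : I -> set (pt R n)) v :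
  (forall i, measurable (a i)) -> measurable (cell a v).
Proof.
move=> ma; rewrite (_ : cell a v =
    \bigcap_(i in [set: I]) [set w | N w (a i) = ext_nat (v i)]).
  apply: fin_bigcap_measurable => // i _.
  rewrite -[X in measurable X]setTI; have := measurable_N (ma i).
  by move=> /(_ measurableT [set ext_nat (v i)]); apply.
by apply/seteqP; split => w h i; [move=> _|]; exact: h.
Qed.

Definition cell_in (I : finType) (a : I -> set (pt R n)) (C : set (I -> \bar R))
    (v : {ffun I -> option nat}) : set Omega :=
  [set w | C (fun i => ext_nat (v i)) /\ cell a v w].

Lemma partition_event_cells (I : finType) (a : I -> set (pt R n)) (C : set (I -> \bar R)) :
  [set w : Omega | C (fun i => N w (a i))] = \bigcup_v cell_in a C v.
Proof.
apply/seteqP; split => [w /= Cw|w [v _ [Cv wv]]].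
  have [v vE] := choice (fun i => N_ext_nat w (a i)).
  exists [ffun i => v i] => //; split => /=.
    by under eq_fun do rewrite ffunE -vE.
  by move=> i; rewrite ffunE.
by rewrite /= (_ : (fun i => _) = (fun i => ext_nat (v i)))//; apply/funext => i; rewrite wv.
Qed.

Lemma measurable_cell_in (I : finType) (a : I -> set (pt R n)) C v :
  (forall i, measurable (a i)) -> measurable (cell_in a C v).
Proof.
move=> ma; have [Cv|nCv] := pselect (C (fun i => ext_nat (v i))).
  rewrite (_ : cell_in a C v = cell a v); first exact: measurable_cell.
  by apply/seteqP; split => w // -[].
by rewrite (_ : cell_in a C v = set0)//; apply/seteqP; split => w // -[].
Qed.

Lemma trivIset_cell (I : finType) (a : I -> set (pt R n)) :
  trivIset setT (fun v : {ffun I -> option nat} => cell a v).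
Proof.
move=> v v' _ _ [w [wv wv']]; apply/ffunP => i; apply: ext_nat_inj.
by rewrite -wv wv'.
Qed.

Lemma measurable_partition_event B : partition_event B -> measurable B.
Proof.
move=> [I [a [C [[ma _ _] ->]]]]; rewrite partition_event_cells.
apply: countable_bigcupT_measurable => // v.
exact: measurable_cell_in.
Qed.

(** A generating event on the count of [A] is a partition event for [A] and its complement in X. *)
Lemma measurable_OmegaE : @measurable _ Omega = <<s partition_event >>.
Proof.
apply/seteqP; split.
  apply: smallest_sub; first exact: smallest_sigma_algebra.
  move=> _ [A [mA AX] [B mB <-]]; apply: sub_sigma_algebra.
  exists bool, (fun b : bool => if b then A else X `\` A).
  by exists [set v | B (v true)]; split; [exact: is_partition_bool|rewrite setTI].
apply: smallest_sub; first exact: sigma_algebra_measurable.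
exact: measurable_partition_event.
Qed.

End Partitions.

(** * From Poisson counts to Mecke's formula *)

Section Mecke.
Context {R : realType} {n : nat}.
Variables (nu : 'I_n.+1 -> probability R R) (P : probability (Omega R n) R).
Hypothesis P_PRM : is_PRM nu P.
Local Notation X := (Xset R n).
Local Notation Omega := (Omega R n).
Local Notation pm := (pmeas nu).

Lemma PRM_indep (I : finType) (a : I -> set (pt R n)) (B : I -> set (\bar R)) :
  is_partition a -> (forall i, measurable (B i)) ->
  P [set w | forall i, B i (N w (a i))] = \prod_i P [set w | B i (N w (a i))].
Proof.
move=> pa mB; have [_ _ indep] := P_PRM.
have := indep #|I| (fun j => a (enum_val j)) (fun j => B (enum_val j)).
have [ma ta aX] := pa; move=> /(_ _ _ _)/wrap[| |//|] //.
- by move=> j; split => //; exact: partition_subX.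
- by move=> j k _ _ /= jk; apply: enum_val_inj; exact: ta.
rewrite (_ : \bigcap_j _ = [set w | forall i, B i (N w (a i))]); last first.
  apply/seteqP; split => w /= h i; last by move=> _; exact: h.
  by have := h (enum_rank i) Logic.I; rewrite /= enum_rankK.
move=> ->; rewrite [RHS](reindex (@enum_val I I))//.
exact: onW_bij (@enum_val_bij I).
Qed.

Lemma PRM_poisson (A : set (pt R n)) (l : nat) : measurable A -> A `<=` X ->
  pm A < +oo ->
  P [set w | N w A = l%:R%:E] = poisson_prob (fine (pm A)) 0 [set l].
Proof.
move=> mA AX Aoo; have [pois _ _] := P_PRM.
by rewrite -(pmeas_intensity nu) ?pois ?pmeas_intensity.
Qed.

(** The Poisson weights of the finite counts already sum to 1. *)
Lemma PRM_lty (A : set (pt R n)) : measurable A -> A `<=` X -> pm A < +oo ->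
  P [set w | N w A = +oo] = 0.
Proof.
move=> mA AX Aoo.
have mN := measurable_N mA.
have mNv v : measurable [set w : Omega | N w A = v].
  rewrite -[X in measurable X]setTI; have := mN measurableT [set v].
  by apply.
have -> : [set w : Omega | N w A = +oo] = ~` \bigcup_l [set w | N w A = l%:R%:E].
  apply/seteqP; split => w /=; first by move=> wA [l _ /=]; rewrite wA.
  move=> h; have [//|[l wA]] := N_nat_or_pinfty w A.
  by exfalso; apply: h; exists l.
rewrite probability_setC; last exact: bigcupT_measurable.
rewrite measure_bigcup//; last by move=> l l' _ _ [w [/= ->]] [] /eqP; rewrite eqr_nat => /eqP.
under eq_eseriesl do rewrite in_setT.
rewrite (eq_eseriesr (g := fun l => poisson_prob (fine (pm A)) 0 [set l])); last first.
  by move=> l _; exact: PRM_poisson.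
rewrite -(@measure_semi_bigcup _ _ _ (poisson_prob (fine (pm A)) 0))//.
  have -> : \bigcup_l [set l] = [set: nat] by apply/seteqP; split => // l _; exists l.
  by rewrite [X in 1 - X](@probability_setT _ _ _ (poisson_prob (fine (pm A)) 0)) subee.
by move=> l l' _ _ [w [/= ->]].
Qed.

Lemma PRM_Good : P (~` @Good R n) = 0.
Proof.
apply: measure_negligible; first by apply: measurableC; exact: measurable_Good.
apply: negligibleS (negligible_bigcup (F := fun a => [set w : Omega |
   N w (@shell R n a) = +oo]) _).
  move=> w /existsNP[a]/negP; rewrite -leNgt leye_eq => /eqP wa.
  by exists a.
move=> a; exists [set w : Omega | N w (@shell R n a) = +oo]; split => //.
  rewrite -[X in measurable X]setTI.
  by have := measurable_N (@measurable_shell R n a) => /(_ measurableT [set +oo]); apply.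
apply: PRM_lty; [exact: measurable_shell|exact: shell_Xset|exact: pmeas_shell].
Qed.

Lemma ae_Good : {ae P, forall w, Good w}.
Proof.
by exists (~` @Good R n); split; [apply: measurableC; exact: measurable_Good|exact: PRM_Good|].
Qed.

(** This is l e^(-m) m^l / l! = m e^(-m) m^(l-1) / (l-1)!, that is, Mecke's formula for a single
    set. Both sides vanish when [v] is not a positive integer; at [v = +oo] the left one does by the
    convention +oo * 0 = 0. *)
Lemma PRM_size_biased (A : set (pt R n)) (v : \bar R) :
  measurable A -> A `<=` X -> pm A < +oo ->
  v * P [set w | N w A = v] = pm A * P [set w | N w A + 1 = v].
Proof.
move=> mA AX Aoo; case: v => [r| |].
- have [[l ->]|nr] := pselect (exists l : nat, r = l%:R).
  + case: l => [|l].
      rewrite mul0e [X in _ * X](_ : _ = 0) ?mule0//.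
      rewrite (_ : [set w | _] = set0) ?measure0//; apply/seteqP; split => // w /=.
      have [->|[k ->]] := N_nat_or_pinfty w A => // -[] /eqP.
      by rewrite natr1 pnatr_eq0.
    rewrite (_ : [set w : Omega | N w A + 1 = l.+1%:R%:E] =
        [set w | N w A = l%:R%:E]); last first.
      apply/seteqP; split => w /=.
        have [->|[k ->]] := N_nat_or_pinfty w A => // -[] /eqP.
        by rewrite natr1 eqr_nat eqSS => /eqP ->.
      by move=> ->; rewrite -EFinD natr1.
    rewrite !PRM_poisson//.
    have [m mE] : exists m, pm A = m%:E.
      by exists (fine (pm A)); rewrite fineK// ge0_fin_numE.
    have m_ge0 : (0 <= m)%R by rewrite -lee_fin -mE.
    (* For mean 0 the law is the Dirac mass at 0, which does not charge [l.+1]. *)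
    rewrite mE/= /poisson_prob; case: ifPn => [m0|]; last first.
      rewrite -leNgt => m0.
      have -> : m = 0%R by apply/eqP; rewrite eq_le m0.
      by rewrite mul0e diracE memNset ?mule0.
    rewrite !esum_set1 ?lee_fin ?poisson_pmf_ge0// -!EFinM /poisson_pmf m0.
    congr EFin; rewrite factS natrM invfM exprS.
    have : (l.+1%:R : R) != 0%R by rewrite pnatr_eq0.
    have : (l`!%:R : R) != 0%R by rewrite pnatr_eq0 gtn_eqF// fact_gt0.
    by move: (l.+1%:R : R) (l`!%:R : R) => u f f0 u0; field; rewrite f0 u0.
  + rewrite (_ : [set w : Omega | N w A = r%:E] = set0); last first.
      apply/seteqP; split => // w /=.
      have [->|[k ->]] := N_nat_or_pinfty w A => // -[] kr.
      by apply: nr; exists k.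
    rewrite (_ : [set w : Omega | N w A + 1 = r%:E] = set0); last first.
      apply/seteqP; split => // w /=.
      have [->|[k ->]] := N_nat_or_pinfty w A => // -[] kr.
      by apply: nr; exists k.+1; rewrite -kr natr1.
    by rewrite !measure0 !mule0.
- rewrite PRM_lty// (_ : [set w : Omega | N w A + 1 = +oo] = [set w | N w A = +oo]).
    by rewrite PRM_lty// !mule0.
  apply/seteqP; split => w /=; last by move=> ->.
  by have [->|[k ->]] := N_nat_or_pinfty w A.
- rewrite (_ : [set w : Omega | N w A = -oo] = set0); last first.
    by apply/seteqP; split => // w /=; have [->|[k ->]] := N_nat_or_pinfty w A.
  rewrite (_ : [set w : Omega | N w A + 1 = -oo] = set0); last first.
    by apply/seteqP; split => // w /=; have [->|[k ->]] := N_nat_or_pinfty w A.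
  by rewrite !measure0 !mule0.
Qed.

(** By independence both sides factor over the pieces: the factor of [i0] is the size-biased
    identity and the others coincide. *)
Lemma PRM_cell (I : finType) (a : I -> set (pt R n)) (i0 : I) (v : I -> \bar R) :
  is_partition a -> pm (a i0) < +oo ->
  v i0 * P [set w | forall i, N w (a i) = v i] =
  pm (a i0) * P [set w | forall i, N w (a i) + (i == i0)%:R%:E = v i].
Proof.
move=> pa oo0; have [ma _ _] := pa.
rewrite (PRM_indep (B := fun i => [set v i]) pa); last by move=> i; exact: emeasurable_set1.
rewrite [X in _ = _ * X](PRM_indep (B := fun i => [set u | u + (i == i0)%:R%:E = v i]) pa); last first.
  move=> i; rewrite -[X in measurable X]setTI.
  have : measurable_fun setT (fun u : \bar R => u + (i == i0)%:R%:E).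
    exact: emeasurable_funD.
  by move=> /(_ measurableT [set v i]); apply; exact: emeasurable_set1.
rewrite (bigD1 i0)//= [in RHS](bigD1 i0)//= eqxx !muleA; congr (_ * _).
  exact: PRM_size_biased (ma i0) (partition_subX pa) oo0.
apply: eq_bigr => i /negbTE ->; congr (P _); apply/seteqP; split => w /=; by rewrite adde0.
Qed.

Definition shift_pair (z : pt R n * Omega) : Omega * pt R n :=
  (add_point z.1 z.2, z.1).

Lemma measurable_shift_pair : measurable_fun setT shift_pair.
Proof. by apply: measurable_fun_pair => //; exact: measurable_add_point. Qed.

(** The right-hand side of Mecke's formula as a measure: the image of m(dx) P(dw) under (x, w) -> (w
    + delta_x, x). *)
Definition Palm : {measure set (Omega * pt R n) -> \bar R} :=
  measure_function_pushforward__canonical__measure_function_Measure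
    (prod_meas pm P) measurable_shift_pair.

(** Stands for [N w], with which it agrees on measurable sets for [w] in [Good], hence almost
    surely. *)
Definition ckern : R.-sfker Omega ~> pt R n :=
  count_kernel (@measurable_id _ Omega setT).

(** The left-hand side of Mecke's formula as a measure: P(dw) N(w)(dx). *)
Definition Campbell : {measure set (Omega * pt R n) -> \bar R} :=
  semidirect P ckern.

(** Adding a point of [a i0] raises the count of that piece by 1 and leaves the others unchanged, so
    the preimage under [shift_pair] is again a product and [PRM_cell] applies. *)
Lemma Campbell_cell (I : finType) (a : I -> set (pt R n)) (i0 : I) (v : I -> option nat) :
  is_partition a -> pm (a i0) < +oo ->
  Campbell (cell a v `*` a i0) = Palm (cell a v `*` a i0).
Proof.
move=> pa oo0; have [ma ta _] := pa.
have mc := measurable_cell v ma.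
transitivity (ext_nat (v i0) * P (cell a v)).
  rewrite -integral_cst// [RHS]integral_mkcond /Campbell/= /semidirect.
  apply: ge0_ae_eq_integral => //.
  - apply: measurable_kernel_xsection; exact: measurableX.
  - by apply/(measurable_restrictT _ mc).
  - by move=> w _; rewrite patchE; case: ifP => // _; exact: ext_nat_ge0.
  - apply: filterS ae_Good => w Gw _; rewrite patchE.
    case: ifPn => wc; last by rewrite notin_xsectionX//; exact: measure0.
    by rewrite in_xsectionX// count_kernelE//; move: wc; rewrite inE => /(_ i0).
rewrite (PRM_cell (fun i => ext_nat (v i)) pa oo0).
rewrite /Palm/= /pushforward.
rewrite (_ : shift_pair @^-1` _ = a i0 `*`
    [set w | forall i, N w (a i) + ((i == i0)%:R)%:E = ext_nat (v i)]).
  rewrite [RHS]product_measure1E//.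
  rewrite (_ : [set w | _] = \bigcap_(i in [set: I])
     [set w | N w (a i) + ((i == i0)%:R)%:E = ext_nat (v i)]).
    apply: fin_bigcap_measurable => // i _; rewrite -[X in measurable X]setTI.
    have : measurable_fun setT (fun w : Omega => N w (a i) + (i == i0)%:R%:E).
      by apply: emeasurable_funD => //; exact: measurable_N.
    by move=> /(_ measurableT [set ext_nat (v i)]); apply; exact: emeasurable_set1.
  by apply/seteqP; split => w h i; [move=> _|]; exact: h.
have dE x i : a i0 x -> \d_x (a i) = ((i == i0)%:R)%:E :> \bar R.
  move=> ax; rewrite diracE; have -> // : (x \in a i) = (i == i0).
  apply/idP/eqP => [/set_mem ai|->]; last exact: mem_set.
  by apply: ta => //; exists x.
apply/seteqP; split => [[x w] [/= cw ax]|[x w] [/= ax cw]].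
  have Xx := partition_subX pa ax.
  by split => //= i; rewrite -(dE x i ax) -(N_add_point w _ Xx) cw.
have Xx := partition_subX pa ax.
by split => //= i; rewrite (N_add_point w _ Xx) (dE x i ax) cw.
Qed.

(** Refining the partition of [B] by [A] makes the rectangle a countable disjoint union of products
    of a cell with a piece contained in [A]. *)
Lemma Campbell_rect B A : partition_event B -> measurable A -> A `<=` X ->
  pm A < +oo -> Campbell (B `*` A) = Palm (B `*` A).
Proof.
move=> [I [a [C [pa ->]]]] mA AX Aoo; have [ma ta aX] := pa.
pose a' (ib : I * bool) := a ib.1 `&` (if ib.2 then A else X `\` A).
pose C' := [set v : I * bool -> \bar R | C (fun i => \sum_b v (i, b))].
have pA := is_partition_bool mA AX.
have pa' : is_partition a' := is_partitionI pa pA.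
have [ma' ta' _] := pa'.
rewrite (_ : [set w | _] `*` A = \bigcup_(iv : I * {ffun I * bool -> option nat})
    (cell_in a' C' iv.2 `*` a' (iv.1, true))).
  apply: eq_measure_countable_bigcup.
  - move=> [i v]; apply: measurableX; last exact: ma'.
    exact: measurable_cell_in.
  - move=> [i v] [j v'] _ _ /= [[w x] [[[_ wv] ax] [[_ wv'] ax']]].
    congr (_, _).
      by apply: ta => //; exists x; split; [case: ax|case: ax'].
    by apply: (trivIset_cell (a := a')) => //; exists w.
  - move=> [i v]; have [Cv|nCv] := pselect (C' (fun i => ext_nat (v i))).
      rewrite (_ : cell_in a' C' (i, v).2 = cell a' v); last first.
        by apply/seteqP; split => w // -[].
      apply: (@Campbell_cell _ a' (i, true) v pa').
      by apply: le_lt_trans Aoo; apply: le_measure; rewrite ?inE// => x [].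
    rewrite (_ : cell_in a' C' (i, v).2 = set0); last first.
      by apply/seteqP; split => w // -[].
    by rewrite set0X !measure0.
have CE : [set w : Omega | C (fun i => N w (a i))] =
    [set w | C' (fun ib => N w (a' ib))].
  apply/seteqP; split => w; rewrite /C'/=;
  by rewrite (_ : (fun i => N w (a i)) = (fun i => \sum_b N w (a' (i, b))))//;
    apply/funext => i; rewrite (N_sum w pA (ma i)).
rewrite CE partition_event_cells; apply/seteqP; split => [[w x] [[v _ wv] Ax]|[w x] [[i v] _ /= [wv [ax Ax]]]].
  have : X x by exact: AX.
  by rewrite -aX => -[i _ ax]; exists (i, v) => //; split => //; split.
by split => //=; exists v.
Qed.

Lemma CampbellE B A : measurable B -> measurable A ->
  Campbell (B `*` A) = \int[P]_(w in B) N w A.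
Proof.
move=> mB mA; rewrite [RHS]integral_mkcond /Campbell/= /semidirect.
apply: ge0_ae_eq_integral => //.
- apply: measurable_kernel_xsection; exact: measurableX.
- apply/(measurable_restrictT _ mB); apply: measurable_funTS; exact: measurable_N.
- by move=> w _; rewrite patchE; case: ifP.
- apply: filterS ae_Good => w Gw _; rewrite patchE.
  case: ifPn => wB; last by rewrite notin_xsectionX//; exact: measure0.
  by rewrite in_xsectionX// count_kernelE.
Qed.

(** The part of [A] outside X is null for both measures: no configuration charges it, and [pmeas] is
    restricted to X. *)
Lemma Campbell_rectT B A : partition_event B -> measurable A ->
  pm A < +oo -> Campbell (B `*` A) = Palm (B `*` A).
Proof.
move=> pB mA Aoo; have mB := measurable_partition_event pB.
have mX := @measurable_Xset R n.
have mAX : measurable (A `&` X) by exact: measurableI.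
have mAD : measurable (A `\` X) by exact: measurableD.
have AXoo : pm (A `&` X) < +oo.
  by apply: le_lt_trans Aoo; apply: le_measure; rewrite ?inE.
have -> : B `*` A = (B `*` (A `&` X)) `|` (B `*` (A `\` X)).
  apply/seteqP; split => [[w x] [/= Bw Ax]|[w x] [[/= Bw []]|[/= Bw []]]//].
  by have [Xx|nXx] := pselect (X x); [left|right].
have dj : (B `*` (A `&` X)) `&` (B `*` (A `\` X)) = set0.
  by apply/seteqP; split => // -[w x] [[_ [_ Xx]] [_ [_ nXx]]].
rewrite !measureU//; do 4?[exact: measurableX].
congr (_ + _); first exact: (Campbell_rect pB mAX (@subIsetr _ _ _) AXoo).
transitivity (\int[P]_(w in B) N w (A `\` X)); first exact: CampbellE.
transitivity (0 : \bar R).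
  apply: integral0_eq => w _.
  by rewrite N_Xset setDE -setIA setICl setI0 measure0.
apply/esym/(@subset_measure0 _ _ _ (prod_meas pm P) _ ((A `\` X) `*` setT)).
- rewrite -[X in measurable X]setTI; apply: measurable_shift_pair => //.
  exact: measurableX.
- exact: measurableX.
- by move=> [x w] [/= _ Ax].
- rewrite [LHS]product_measure1E// [X in X * _](_ : _ = 0) ?mul0e//.
  by rewrite [LHS]pmeasE big1// => k _; rewrite setDE -setIA setICl setI0 measure0.
Qed.

(** Uniqueness of measures on the pi-system of rectangles whose first side is a partition event and
    whose second side has finite intensity; the work is to see that they generate the product
    sigma-algebra. *)
Theorem Campbell_Palm C : measurable C -> Campbell C = Palm C.
Proof.
pose fin_sets := [set A : set (pt R n) | measurable A /\ pm A < +oo].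
pose G : set (set (Omega * pt R n)) :=
  [set B `*` A | B in partition_event & A in fin_sets].
have [F FT Foo] := sigma_finiteT pm.
have peT : partition_event [set: Omega].
  exists bool, (fun b : bool => if b then X else X `\` X), setT.
  by split => //; apply: is_partition_bool => //; exact: measurable_Xset.
have mC A : fin_sets A -> measurable A by case.
apply: (@measure_unique _ _ _ G (fun i => setT `*` F i)).
- apply/seteqP; split; last first.
    apply: smallest_sub; first exact: sigma_algebra_measurable.
    move=> _ [B pB [A [mA _] <-]]; apply: measurableX => //.
    exact: measurable_partition_event.
  rewrite measurable_prod_measurableType.
  apply: smallest_sub; first exact: smallest_sigma_algebra.
  move=> _ [B mB [A mA <-]].
  (* A cylinder is cut by the exhaustion [F], since the second side of a rectangle in [G] has finite
     mass. *)
  have mfst : @measurable_fun _ _ (g_sigma_algebraType G) Omega setT fst.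
    apply: (@measurability _ _ (g_sigma_algebraType G) Omega setT fst
      (@partition_event R n) (@measurable_OmegaE R n)).
    move=> _ [B' pB' <-]; rewrite setTI.
    rewrite (_ : fst @^-1` B' = \bigcup_i (B' `*` F i)).
      apply: bigcupT_measurable => i; apply: sub_sigma_algebra.
      by exists B' => //; exists (F i).
    apply/seteqP; split => [[w x] /= B'w|[w x] [i _ [] //]].
    by have : setT x by []; rewrite FT => -[i _ Fx]; exists i.
  have msnd : @measurable_fun _ _ (g_sigma_algebraType G) (pt R n) setT snd.
    move=> _ A' mA'; rewrite setTI.
    rewrite (_ : snd @^-1` A' = \bigcup_i (setT `*` (A' `&` F i))).
      apply: bigcupT_measurable => i; apply: sub_sigma_algebra.
      have [mF Fi] := Foo i.
      exists setT; first exact: peT.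
      exists (A' `&` F i); last by [].
      split; first exact: measurableI.
      apply: le_lt_trans Fi; apply: le_measure; rewrite ?inE; last exact: subIsetr.
        exact: measurableI.
      exact: mF.
    apply/seteqP; split => [[w x] /= A'x|[w x] [i _ [_ []] //]].
    by have : setT x by []; rewrite FT => -[i _ Fx]; exists i.
  rewrite (_ : B `*` A = (fst @^-1` B) `&` (snd @^-1` A)).
    apply: (@measurableI _ (g_sigma_algebraType G)).
      by rewrite -[X in measurable X]setTI; exact: mfst.
    by rewrite -[X in measurable X]setTI; exact: msnd.
  by apply/seteqP; split.
- move=> _ _ [B pB [A [mA Aoo] <-]] [B' pB' [A' [mA' A'oo] <-]].
  exists (B `&` B'); first exact: setI_closed_partition_event.
  exists (A `&` A'); last by rewrite setXI.
  split; first exact: measurableI.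
  apply: le_lt_trans Aoo; apply: le_measure; rewrite ?inE; last exact: subIsetl.
    exact: measurableI.
  exact: mA.
- by move=> i; exists setT => //; exists (F i).
- by rewrite -setX_bigcupr -FT setXTT.
- by move=> _ [B pB [A [mA Aoo] <-]]; exact: Campbell_rectT.
- move=> i; have [mF Fi] := Foo i; rewrite [X in X < _]Campbell_rectT//.
  rewrite [X in X < _](_ : _ = prod_meas pm P (F i `*` setT)).
    by rewrite [X in X < _]product_measure1E// [X in _ * X]probability_setT mule1.
  by congr (prod_meas pm P _); apply/seteqP; split => -[x w] [].
Qed.

Theorem Mecke (F : Omega * pt R n -> \bar R) :
  measurable_fun setT F -> (forall z, 0 <= F z) ->
  \int[P]_w \int[ckern w]_x F (w, x) =
  \int[pm]_x \int[P]_w F (add_point x w, x).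
Proof.
move=> mF F0; rewrite -integral_semidirect//.
transitivity (\int[Palm]_z F z).
  by apply: eq_measure_integral => C mC _; exact: Campbell_Palm.
rewrite ge0_integral_pushforward//; last exact: measurable_shift_pair.
rewrite preimage_setT fubini_tonelli1//; last by move=> z; exact: F0.
by apply: measurableT_comp => //; exact: measurable_shift_pair.
Qed.

End Mecke.

(** * Convolution and renewal inequalities *)

Lemma ge0_nneseriesZl (R : realType) (k : \bar R) (u : nat -> \bar R) :
  0 <= k -> (forall i, 0 <= u i) ->
  \sum_(0 <= i <oo) (k * u i) = k * \sum_(0 <= i <oo) u i.
Proof.
move=> k0 u0; rewrite -!ge0_integral_count//; last by move=> i; rewrite mule_ge0.
by rewrite ge0_integralZl.
Qed.

Section Convolution.
Context {R : realType}.
Local Notation leb := (@lebR R).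
Implicit Types f g h : R -> \bar R.

Lemma measurable_addl (a : R) : measurable_fun setT (fun s : R => (s + a)%R).
Proof. by apply: measurable_funD. Qed.

(** The image measure gives every half-open interval its length, which characterizes Lebesgue
    measure. *)
Lemma lebR_shift (a : R) (A : set R) : measurable A ->
  leb ((fun s => (s + a)%R) @^-1` A) = leb A.
Proof.
move=> mA.
apply/esym.
pose mu' : {measure set (measurableTypeR R) -> \bar R} :=
 measure_function_pushforward__canonical__measure_function_Measure
  (@lebesgue_measure R : {measure set (measurableTypeR R) -> \bar R}) (measurable_addl a : @measurable_fun _ _ (measurableTypeR R) (measurableTypeR R) setT (fun s : R => (s + a)%R)).
apply: (lebesgue_measure_unique (mu := mu')) => // _ [[b c]] _ <-.
rewrite /mu'/= /pushforward.
rewrite (_ : _ @^-1` _ = `](b - a)%R, (c - a)%R]%classic); last first.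
  by apply/seteqP; split => s /=; rewrite !in_itv/= ltrBlDr lerBrDr.
rewrite !lebesgue_measure_itv/= !lte_fin ltrD2r; case: ifP => // _.
by rewrite -!EFinB; congr EFin; rewrite opprB addrA subrK.
Qed.

Lemma ge0_integral_shift f a : measurable_fun setT f -> (forall t, 0 <= f t) ->
  \int[leb]_s f (s + a)%R = \int[leb]_s f s.
Proof.
move=> mf f0.
rewrite -[LHS](ge0_integral_pushforward (measurable_addl a) leb measurableT mf)//.
apply: eq_measure_integral; first exact: measurable_addl.
by move=> m A mA _; exact: (lebR_shift a mA).
Qed.

(** The integral is over the whole line; it reduces to one over [0, t] for functions that vanish at
    negative times. *)
Definition conv f g : R -> \bar R := fun t => \int[leb]_s (f (t - s)%R * g s).

Lemma conv_ge0 f g t : (forall t, 0 <= f t) -> (forall t, 0 <= g t) -> 0 <= conv f g t.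
Proof. by move=> f0 g0; apply: integral_ge0 => s _; rewrite mule_ge0. Qed.

Let measurable_sub2 (d : measure_display) (T : measurableType d) (u v : T -> R) f :
  measurable_fun setT f -> measurable_fun setT u -> measurable_fun setT v ->
  measurable_fun setT (fun z => f (u z - v z)%R).
Proof.
move=> mf mu mv; apply: (measurableT_comp mf).
exact: measurable_funB.
Qed.

Lemma measurable_conv f g : measurable_fun setT f -> measurable_fun setT g ->
  (forall t, 0 <= f t) -> (forall t, 0 <= g t) -> measurable_fun setT (conv f g).
Proof.
move=> mf mg f0 g0.
apply: (measurable_fun_fubini_tonelli_F (m2 := leb)
  (fun z : R * R => f (z.1 - z.2)%R * g z.2)) => //.
- apply: emeasurable_funM; first exact: measurable_sub2.
  exact: (measurableT_comp mg).
- by move=> z; rewrite mule_ge0.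
Qed.

(** Tonelli, then a translation by w in the inner integral. *)
Lemma convA f g h t : measurable_fun setT f -> measurable_fun setT g ->
  measurable_fun setT h ->
  (forall t, 0 <= f t) -> (forall t, 0 <= g t) -> (forall t, 0 <= h t) ->
  conv f (conv g h) t = conv (conv f g) h t.
Proof.
move=> mf mg mh f0 g0 h0; rewrite /conv.
have mgs s : measurable_fun setT (fun w : R => g (s - w)%R * h w).
  by apply: emeasurable_funM => //; exact: measurable_sub2.
transitivity (\int[leb]_s \int[leb]_w (f (t - s)%R * (g (s - w)%R * h w))).
  apply: eq_integral => s _; rewrite ge0_integralZl//.
  by move=> w _; rewrite mule_ge0.
rewrite (fubini_tonelli (m1 := leb) (m2 := leb)
   (fun z : R * R => f (t - z.1)%R * (g (z.1 - z.2)%R * h z.2)))//=; last 2 first.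
- apply: emeasurable_funM; first exact: measurable_sub2.
  apply: emeasurable_funM; first exact: measurable_sub2.
  exact: (measurableT_comp mh).
- by move=> z; rewrite !mule_ge0.
apply: eq_integral => w _.
under eq_integral do rewrite muleA.
rewrite ge0_integralZr//; last 2 first.
- by apply: emeasurable_funM; exact: measurable_sub2.
- by move=> s _; rewrite mule_ge0.
congr (_ * _).
rewrite -[LHS](@ge0_integral_shift (fun s => f (t - s)%R * g (s - w)%R) w).
- by apply: eq_integral => s _; rewrite addrK opprD addrA addrAC.
- by apply: emeasurable_funM; exact: measurable_sub2.
- by move=> s; rewrite mule_ge0.
Qed.

Lemma integral_conv f g : measurable_fun setT f -> measurable_fun setT g ->
  (forall t, 0 <= f t) -> (forall t, 0 <= g t) ->
  \int[leb]_t conv f g t = (\int[leb]_t f t) * (\int[leb]_t g t).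
Proof.
move=> mf mg f0 g0; rewrite /conv.
rewrite (fubini_tonelli (m1 := leb) (m2 := leb)
   (fun z : R * R => f (z.1 - z.2)%R * g z.2))//=; last 2 first.
- apply: emeasurable_funM; first exact: measurable_sub2.
  exact: (measurableT_comp mg).
- by move=> z; rewrite mule_ge0.
under eq_integral.
  move=> s _; rewrite ge0_integralZr//; last exact: measurable_sub2.
  rewrite (ge0_integral_shift (- s))//.
  over.
rewrite ge0_integralZl// integral_ge0//.
Qed.

Lemma le_conv f g h : measurable_fun setT f -> measurable_fun setT g ->
  measurable_fun setT h -> (forall t, 0 <= f t) -> (forall t, 0 <= g t) ->
  (forall t, g t <= h t) -> forall t, conv f g t <= conv f h t.
Proof.
move=> mf mg mh f0 g0 gh t; apply: ge0_le_integral => //.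
- by move=> s _; rewrite mule_ge0.
- by apply: emeasurable_funM => //; exact: measurable_sub2.
- by apply: emeasurable_funM => //; exact: measurable_sub2.
- by move=> s _; rewrite lee_wpmul2l.
Qed.

Lemma convDr f g h t : measurable_fun setT f -> measurable_fun setT g ->
  measurable_fun setT h -> (forall t, 0 <= f t) -> (forall t, 0 <= g t) ->
  (forall t, 0 <= h t) -> conv f (g \+ h) t = conv f g t + conv f h t.
Proof.
move=> mf mg mh f0 g0 h0; rewrite /conv -ge0_integralD//.
- by apply: eq_integral => s _; rewrite ge0_muleDr.
- by move=> s _; rewrite mule_ge0.
- by apply: emeasurable_funM => //; exact: measurable_sub2.
- by move=> s _; rewrite mule_ge0.
- by apply: emeasurable_funM => //; exact: measurable_sub2.
Qed.

Lemma conv_sumr (I : Type) (r : seq I) f (g : I -> R -> \bar R) t :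
  measurable_fun setT f -> (forall i, measurable_fun setT (g i)) ->
  (forall t, 0 <= f t) -> (forall i t, 0 <= g i t) ->
  conv f (fun s => \sum_(i <- r) g i s) t = \sum_(i <- r) conv f (g i) t.
Proof.
move=> mf mg f0 g0; rewrite /conv -ge0_integral_sum//.
- by apply: eq_integral => s _; rewrite ge0_sume_distrr.
- by move=> i; apply: emeasurable_funM => //; exact: measurable_sub2.
- by move=> i s _; rewrite mule_ge0.
Qed.

Lemma conv_suml (I : Type) (r : seq I) (f : I -> R -> \bar R) g t :
  (forall i, measurable_fun setT (f i)) -> measurable_fun setT g ->
  (forall i t, 0 <= f i t) -> (forall t, 0 <= g t) ->
  conv (fun s => \sum_(i <- r) f i s) g t = \sum_(i <- r) conv (f i) g t.
Proof.
move=> mf mg f0 g0; rewrite /conv -ge0_integral_sum//.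
- by apply: eq_integral => s _; rewrite ge0_sume_distrl.
- by move=> i; apply: emeasurable_funM => //; exact: measurable_sub2.
- by move=> i s _; rewrite mule_ge0.
Qed.

Lemma conv_nneseriesl (f : nat -> R -> \bar R) g t :
  (forall i, measurable_fun setT (f i)) -> measurable_fun setT g ->
  (forall i t, 0 <= f i t) -> (forall t, 0 <= g t) ->
  conv (fun s => \sum_(0 <= i <oo) f i s) g t = \sum_(0 <= i <oo) conv (f i) g t.
Proof.
move=> mf mg f0 g0; rewrite /conv -integral_nneseries//.
- by apply: eq_integral => s _; rewrite muleC -ge0_nneseriesZl//; under eq_eseriesr do rewrite muleC.
- by move=> i; apply: emeasurable_funM => //; exact: measurable_sub2.
- by move=> i s _; rewrite mule_ge0.
Qed.

Lemma conv_nneseriesr f (g : nat -> R -> \bar R) t :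
  measurable_fun setT f -> (forall i, measurable_fun setT (g i)) ->
  (forall t, 0 <= f t) -> (forall i t, 0 <= g i t) ->
  conv f (fun s => \sum_(0 <= i <oo) g i s) t = \sum_(0 <= i <oo) conv f (g i) t.
Proof.
move=> mf mg f0 g0; rewrite /conv -integral_nneseries//.
- by apply: eq_integral => s _; rewrite -ge0_nneseriesZl.
- by move=> i; apply: emeasurable_funM => //; exact: measurable_sub2.
- by move=> i s _; rewrite mule_ge0.
Qed.

(** Since e^(-bt) = e^(-b(t-s)) e^(-bs), an exponential weight distributes over a convolution; this
    is why such weights are used for the contraction. *)
Lemma conv_weight (b : R) f g t :
  (forall t, 0 <= f t) -> (forall t, 0 <= g t) ->
  measurable_fun setT f -> measurable_fun setT g ->
  conv (fun s => (expR (- (b * s)))%:E * f s) (fun s => (expR (- (b * s)))%:E * g s) t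
  = (expR (- (b * t)))%:E * conv f g t.
Proof.
move=> f0 g0 mf mg; rewrite /conv -ge0_integralZl//; last 2 first.
- by apply: emeasurable_funM => //; exact: measurable_sub2.
- by move=> s _; rewrite mule_ge0.
apply: eq_integral => s _; rewrite muleACA -EFinM -expRD.
by congr ((expR _)%:E * _); lra.
Qed.

End Convolution.

(** * Exponential weights *)

Section WeightedIntegral.
Context {R : realType}.
Local Notation leb := (@lebR R).

Definition wt (c : nat) (t : R) : \bar R := (expR (- (c%:R * t)))%:E.

Lemma measurable_wt c : measurable_fun setT (wt c).
Proof.
apply/measurable_EFinP; apply: measurableT_comp => //.
by apply: measurableT_comp => //; exact: measurable_funM.
Qed.

Lemma wt_ge0 c t : 0 <= wt c t. Proof. by rewrite lee_fin expR_ge0. Qed.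

Variable f : R -> \bar R.
Hypotheses (mf : measurable_fun setT f) (f0 : forall t, 0 <= f t).
Hypothesis f_neg : forall t, (t < 0 :> R)%R -> f t = 0.

Lemma wt_le c t : wt c t * f t <= f t.
Proof.
have [t0|t0] := ltP t 0%R; first by rewrite f_neg// mule0.
rewrite -[leRHS]mul1e lee_wpmul2r// lee_fin -expR0 ler_expR.
by rewrite oppr_le0 mulr_ge0.
Qed.

(** Dominated convergence by [f]: the weight tends to 0 at every t > 0, [f] vanishes for t < 0, and
    the time 0 is null. *)
Lemma weighted_integral_cvg0 : \int[leb]_t f t < +oo ->
  \int[leb]_t (wt c t * f t) @[c --> \oo] --> 0.
Proof.
move=> f_int.
have intf : leb.-integrable setT f.
  apply/integrableP; split => //.
  by under eq_integral do rewrite gee0_abs//.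
have := @dominated_convergence _ _ _ leb setT measurableT
  (fun c t => wt c t * f t) (cst 0) f.
rewrite integral0; case => //.
- by move=> c; apply: emeasurable_funM => //; exact: measurable_wt.
- have [//|Nt [mNt Nt0 subNt]] := integrable_ae _ intf.
  exists (Nt `|` [set 0%R]); split.
  + exact: measurableU.
  + by apply: null_set_setU => //; exact: lebesgue_measure_set1.
  + move=> t /=; apply: contra_notP => /not_orP[nNt /eqP t0] _.
    have [tneg|tpos] := ltP t 0%R.
      by apply: cvg_near_cst; apply: nearW => c; rewrite f_neg// mule0.
    have ffin : f t \is a fin_num.
      by apply: contrapT => nK; apply: nNt; apply: subNt => /=; apply/not_implyP.
    rewrite -(mul0e (f t)).
    apply: cvgeM => //; first by rewrite mule_def_fin.
      have geo : (fun c => expR (- t) ^+ c)%R @ \oo --> (0%R : R).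
        apply: cvg_expr; rewrite ger0_norm ?expR_ge0//.
        by rewrite expR_lt1 oppr_lt0 lt_neqAle eq_sym t0.
      apply: cvg_EFin; first exact: nearW.
      rewrite (_ : _ \o _ = (fun c => expR (- t) ^+ c)%R)//.
      by apply/funext => c; rewrite /= -expRM_natl mulrN.
    exact: cvg_cst.
- exists set0; split => // t; apply: contra_notP => _ c _.
  by rewrite gee0_abs ?mule_ge0 ?wt_ge0//; exact: wt_le.
Qed.

End WeightedIntegral.

(** * Systems of renewal inequalities *)

Section Renewal.
Context {R : realType} {I : finType}.
Local Notation leb := (@lebR R).
Variable K : I -> I -> R -> \bar R.
Hypotheses (mK : forall i k, measurable_fun setT (K i k)).
Hypotheses (K0 : forall i k t, 0 <= K i k t).
Implicit Types q : I -> R -> \bar R.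

Definition mconv (L : I -> I -> R -> \bar R) q (i : I) (t : R) : \bar R :=
  \sum_k conv (L i k) (q k) t.

(** As for [phibar], index [m] is the (m+1)-fold convolution power. *)
Fixpoint Kpow (m : nat) : I -> I -> R -> \bar R :=
  if m is m'.+1 then fun i k t => \sum_l conv (K i l) (Kpow m' l k) t else K.

Definition Kpsi (i k : I) (t : R) : \bar R := \sum_(0 <= m <oo) Kpow m i k t.

Lemma Kpow_ge0 m i k t : 0 <= Kpow m i k t.
Proof.
elim: m i k t => [|m IHm] i k t /=; first exact: K0.
by apply: sume_ge0 => l _; apply: conv_ge0.
Qed.

Lemma measurable_Kpow m i k : measurable_fun setT (Kpow m i k).
Proof.
elim: m i k => [|m IHm] i k /=; first exact: mK.
apply: emeasurable_sum => l; apply: measurable_conv => //.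
by move=> t; exact: Kpow_ge0.
Qed.

Lemma Kpsi_ge0 i k t : 0 <= Kpsi i k t.
Proof. by apply: nneseries_ge0 => m _ _; exact: Kpow_ge0. Qed.

Lemma measurable_Kpsi i k : measurable_fun setT (Kpsi i k).
Proof.
apply: ge0_emeasurable_sum => [m t _ _|m _]; first exact: Kpow_ge0.
exact: measurable_Kpow.
Qed.

Lemma mconv_ge0 L q i t : (forall i k t, 0 <= L i k t) ->
  (forall k t, 0 <= q k t) -> 0 <= mconv L q i t.
Proof. by move=> L0 q0; apply: sume_ge0 => k _; exact: conv_ge0. Qed.

Lemma measurable_mconv L q i : (forall i k, measurable_fun setT (L i k)) ->
  (forall k, measurable_fun setT (q k)) -> (forall i k t, 0 <= L i k t) ->
  (forall k t, 0 <= q k t) -> measurable_fun setT (mconv L q i).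
Proof.
move=> mL mq L0 q0; apply: emeasurable_sum => k; exact: measurable_conv.
Qed.

Lemma le_mconv q q' i t : (forall k, measurable_fun setT (q k)) ->
  (forall k, measurable_fun setT (q' k)) -> (forall k t, 0 <= q k t) ->
  (forall k t, q k t <= q' k t) -> mconv K q i t <= mconv K q' i t.
Proof. by move=> mq mq' q0 qq'; apply: lee_sum => k _; exact: le_conv. Qed.

Lemma mconvD q q' i t : (forall k, measurable_fun setT (q k)) ->
  (forall k, measurable_fun setT (q' k)) -> (forall k t, 0 <= q k t) ->
  (forall k t, 0 <= q' k t) ->
  mconv K (fun k => q k \+ q' k) i t = mconv K q i t + mconv K q' i t.
Proof.
move=> mq mq' q0 q'0; rewrite /mconv -big_split/=.
by apply: eq_bigr => k _; rewrite convDr.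
Qed.

Lemma mconv_Kpow m q i t : (forall k, measurable_fun setT (q k)) ->
  (forall k t, 0 <= q k t) ->
  mconv K (mconv (Kpow m) q) i t = mconv (Kpow m.+1) q i t.
Proof.
move=> mq q0; rewrite /mconv.
transitivity (\sum_l \sum_k conv (conv (K i l) (Kpow m l k)) (q k) t).
  apply: eq_bigr => l _; rewrite conv_sumr//.
  - apply: eq_bigr => k _; apply: convA => //; first exact: measurable_Kpow.
    exact: Kpow_ge0.
  - by move=> k; apply: measurable_conv => //; [exact: measurable_Kpow|exact: Kpow_ge0].
  - by move=> k s; apply: conv_ge0 => // u; exact: Kpow_ge0.
rewrite exchange_big/=; apply: eq_bigr => k _.
rewrite conv_suml//.
- by move=> l; apply: measurable_conv => //; [exact: measurable_Kpow|exact: Kpow_ge0].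
- by move=> l s; apply: conv_ge0 => // u; exact: Kpow_ge0.
Qed.

Lemma mconv_Kpsi q i t : (forall k, measurable_fun setT (q k)) ->
  (forall k t, 0 <= q k t) ->
  mconv Kpsi q i t = \sum_(0 <= m <oo) mconv (Kpow m) q i t.
Proof.
move=> mq q0; rewrite /mconv.
rewrite nneseries_sum//; last first.
  by move=> k m _; apply: conv_ge0 => //; exact: Kpow_ge0.
apply: eq_bigr => k _; rewrite /Kpsi conv_nneseriesl//.
  by move=> m; exact: measurable_Kpow.
by move=> m s; exact: Kpow_ge0.
Qed.

Variable b : I -> R -> \bar R.
Hypotheses (mb : forall k, measurable_fun setT (b k)) (b0 : forall k t, 0 <= b k t).

(** Partial sums of the Neumann series, without the zeroth term [b]. *)
Let S M i t := \sum_(0 <= m < M) mconv (Kpow m) b i t.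

Let mS M i : measurable_fun setT (S M i).
Proof.
apply: emeasurable_sum => m; apply: measurable_mconv => //.
  exact: measurable_Kpow.
exact: Kpow_ge0.
Qed.

Let S0 M i t : 0 <= S M i t.
Proof. by apply: sume_ge0 => m _; apply: mconv_ge0 => //; exact: Kpow_ge0. Qed.

Let mconvS M i t : mconv K (fun k => b k \+ S M k) i t = S M.+1 i t.
Proof.
rewrite mconvD// /S big_nat_recl//; congr (_ + _).
transitivity (\sum_k \sum_(0 <= m < M) conv (K i k) (mconv (Kpow m) b k) t).
  apply: eq_bigr => k _; apply: conv_sumr => //.
    move=> m; apply: measurable_mconv => //; first exact: measurable_Kpow.
    exact: Kpow_ge0.
  by move=> m s; apply: mconv_ge0 => //; exact: Kpow_ge0.
by rewrite exchange_big/=; apply: eq_bigr => m _; rewrite -mconv_Kpow.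
Qed.

(** If h dominates b + S M, one more use of the inequality gives b + S (M+1); then M tends to
    infinity. Where h is infinite the claim is trivial, and elsewhere b is finite and may be moved
    to the other side. *)
Lemma renewal_ge (h : I -> R -> \bar R) :
  (forall k, measurable_fun setT (h k)) -> (forall k t, 0 <= h k t) ->
  (forall i t, b i t + mconv K h i t <= h i t) ->
  forall i t, b i t + mconv Kpsi b i t <= h i t.
Proof.
move=> mh h0 hle i t.
have step M : forall i t, b i t + S M i t <= h i t.
  elim: M => [|M IHM] {}i {}t.
    rewrite /S big_geq// adde0; apply: le_trans (hle i t).
    by rewrite leeDl// mconv_ge0.
  apply: le_trans (hle i t); rewrite leeD2l// -mconvS; apply: le_mconv => //.
  - by move=> k; exact: emeasurable_funD.
  - by move=> k s; rewrite adde_ge0.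
rewrite mconv_Kpsi//.
have [->|hoo] := eqVneq (h i t) +oo; first exact: leey.
have hfin : h i t \is a fin_num by rewrite ge0_fin_numE// lt_neqAle hoo leey.
have bfin : b i t \is a fin_num.
  rewrite ge0_fin_numE//; apply: le_lt_trans (_ : h i t < +oo); last by rewrite -ge0_fin_numE.
  by apply: le_trans (hle i t); rewrite leeDl// mconv_ge0.
rewrite -leeBrDl//; apply: lime_le.
  by apply: is_cvg_nneseries => m _ _; apply: mconv_ge0 => //; exact: Kpow_ge0.
by apply: nearW => M; rewrite leeBrDl//; exact: step.
Qed.

(** Convolving the Neumann series with [K] shifts its index by one. As this holds at every t, it
    later turns an almost everywhere bound into a pointwise one. *)
Lemma renewal_fixed i t :
  mconv K (fun k => b k \+ mconv Kpsi b k) i t = mconv Kpsi b i t.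
Proof.
have m_ge0 m k s : 0 <= mconv (Kpow m) b k s.
  by apply: mconv_ge0 => //; exact: Kpow_ge0.
have mm m k : measurable_fun setT (mconv (Kpow m) b k).
  apply: measurable_mconv => //; first exact: measurable_Kpow.
  exact: Kpow_ge0.
rewrite mconvD//; last 2 first.
- move=> k; apply: measurable_mconv => //; first exact: measurable_Kpsi.
  exact: Kpsi_ge0.
- by move=> k s; apply: mconv_ge0 => //; exact: Kpsi_ge0.
rewrite mconv_Kpsi// nneseries_recl//; congr (_ + _).
transitivity (\sum_k conv (K i k) (fun s => \sum_(0 <= m <oo) mconv (Kpow m) b k s) t).
  apply: eq_bigr => k _; congr (conv _ _ _); apply/funext => s.
  exact: mconv_Kpsi.
transitivity (\sum_k \sum_(0 <= m <oo) conv (K i k) (mconv (Kpow m) b k) t).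
  by apply: eq_bigr => k _; rewrite conv_nneseriesr.
rewrite -nneseries_sum; last by move=> k m _; exact: conv_ge0.
rewrite -[RHS]nneseries_addn//; apply: eq_eseriesr => m _.
by rewrite addn1 -mconv_Kpow.
Qed.

Hypothesis K_neg : forall i k t, (t < 0 :> R)%R -> K i k t = 0.
Hypothesis K_int : forall i k, \int[leb]_t K i k t < +oo.

(** After M iterations the remainder is the M-fold convolution of [q] by [K], whose weighted norm is
    at most 2^(-M) times that of [q]. Hence the excess of [q] over the bound has zero weighted
    integral, which is why the conclusion is only almost everywhere. *)
Lemma renewal_le q : (forall k, measurable_fun setT (q k)) ->
  (forall k t, 0 <= q k t) -> (forall k t, (t < 0 :> R)%R -> q k t = 0) ->
  (forall k, \int[leb]_t q k t < +oo) ->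
  (forall i t, q i t <= b i t + mconv K q i t) ->
  forall i, {ae leb, forall t, q i t <= b i t + mconv Kpsi b i t}.
Proof.
move=> mq q0 q_neg q_int qle i.
(* The sum of all entries controls the whole matrix, so that a single exponent c makes it a
   contraction of ratio 1/2. *)
pose Ks t := \sum_i \sum_k K i k t.
have mKs : measurable_fun setT Ks.
  by apply: emeasurable_sum => j; exact: emeasurable_sum.
have Ks0 t : 0 <= Ks t by apply: sume_ge0 => j _; exact: sume_ge0.
have Ks_neg t : (t < 0)%R -> Ks t = 0.
  by move=> t0; rewrite /Ks big1// => j _; rewrite big1// => k _; exact: K_neg.
have Ks_int : \int[leb]_t Ks t < +oo.
  rewrite ge0_integral_sum//; last 2 first.
  - by move=> j; exact: emeasurable_sum.
  - by move=> j t _; exact: sume_ge0.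
  apply: lte_sum_pinfty => j _; rewrite ge0_integral_sum//.
  by apply: lte_sum_pinfty => k _.
have [c cle] : exists c, \int[leb]_t (wt c t * Ks t) <= (2^-1)%:E.
  have := weighted_integral_cvg0 mKs Ks0 Ks_neg Ks_int.
  move=> /fine_cvgP[fin /cvgrPdist_le /(_ 2^-1%R)].
  rewrite invr_gt0 => /(_ (ltr0n _ _)) small.
  near \oo => c; exists c.
  have h1 : \int[leb]_t (wt c t * Ks t) \is a fin_num by near: c.
  rewrite -[leLHS]fineK// lee_fin.
  have h2 : (`|0 - fine (\int[leb]_t (wt c t * Ks t))| <= 2^-1)%R by near: c.
  by apply: le_trans h2; rewrite sub0r normrN ler_norm.
have mw := @measurable_wt R c; have w0 := @wt_ge0 R c.
pose r M := iter M (mconv K) q.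
have r0 M k t : 0 <= r M k t.
  by elim: M k t => [|M IHM] k t //=; exact: mconv_ge0.
have mr M k : measurable_fun setT (r M k).
  by elim: M k => [|M IHM] k //=; apply: measurable_mconv => //; exact: r0.
have qr M : forall k t, q k t <= b k t + S M k t + r M k t.
  elim: M => [|M IHM] k t; first by rewrite /S big_geq// adde0 leeDr.
  apply: le_trans (qle k t) _; rewrite -addeA leeD2l//.
  apply: (@le_trans _ _ (mconv K (fun k => (b k \+ S M k) \+ r M k) k t)).
    apply: le_mconv => // j; apply: emeasurable_funD => //; exact: emeasurable_funD.
  rewrite (mconvD (q := fun k => b k \+ S M k))//.
  - by rewrite mconvS.
  - by move=> j; exact: emeasurable_funD.
  - by move=> j s; rewrite adde_ge0.
pose nr M := \sum_k \int[leb]_t (wt c t * r M k t).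
have nr0 M : 0 <= nr M.
  by apply: sume_ge0 => k _; apply: integral_ge0 => t _; rewrite mule_ge0.
have mwr M k : measurable_fun setT (fun t => wt c t * r M k t).
  exact: emeasurable_funM.
have mwK j k : measurable_fun setT (fun t => wt c t * K j k t).
  exact: emeasurable_funM.
(* The weight distributes over the convolution, and the integral of a convolution is the product of
   the integrals. *)
have nrS M : nr M.+1 <= (2^-1)%:E * nr M.
  apply: (@le_trans _ _ ((\int[leb]_t (wt c t * Ks t)) * nr M)); last exact: lee_wpmul2r.
  have -> : \int[leb]_t (wt c t * Ks t) = \sum_j \sum_k \int[leb]_t (wt c t * K j k t).
    under eq_integral.
      move=> t _; rewrite /Ks ge0_sume_distrr; last by move=> j _; exact: sume_ge0.
      under eq_bigr do rewrite ge0_sume_distrr//.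
      over.
    rewrite ge0_integral_sum//; last 2 first.
    - by move=> j; exact: emeasurable_sum.
    - by move=> j t _; apply: sume_ge0 => k _; rewrite mule_ge0.
    apply: eq_bigr => j _; rewrite ge0_integral_sum// => k t _.
    by rewrite mule_ge0.
  rewrite ge0_sume_distrl; last first.
    move=> j _; apply: sume_ge0 => k _; apply: integral_ge0 => t _.
    by rewrite mule_ge0.
  apply: lee_sum => j _; rewrite ge0_sume_distrl; last first.
    by move=> k _; apply: integral_ge0 => t _; rewrite mule_ge0.
  rewrite /r iterS -/(r M) /mconv.
  under eq_integral.
    move=> t _; rewrite ge0_sume_distrr; last by move=> k _; exact: conv_ge0.
    over.
  rewrite ge0_integral_sum//; last 2 first.
  - by move=> k; apply: emeasurable_funM => //; exact: measurable_conv.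
  - by move=> k t _; rewrite mule_ge0// conv_ge0.
  apply: lee_sum => k _; under eq_integral do rewrite -conv_weight//.
  rewrite integral_conv//; last 2 first.
  - by move=> t; rewrite mule_ge0.
  - by move=> t; rewrite mule_ge0.
  rewrite lee_wpmul2l//; first by apply: integral_ge0 => t _; rewrite mule_ge0.
  rewrite /nr (bigD1 k)//= leeDl// sume_ge0// => l _.
  by apply: integral_ge0 => t _; rewrite mule_ge0.
have nr_fin : nr 0%N < +oo.
  apply: lte_sum_pinfty => k _; apply: le_lt_trans (q_int k).
  by apply: ge0_le_integral => // t _; [rewrite mule_ge0|apply: wt_le => // u; exact: q_neg].
have nrM M : nr M <= (2^-1 ^+ M)%:E * nr 0%N.
  elim: M => [|M IHM]; first by rewrite expr0 mul1e.
  by apply: le_trans (nrS M) _; rewrite exprS EFinM -muleA lee_wpmul2l.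
pose g t := b i t + mconv Kpsi b i t.
have mg : measurable_fun setT g.
  apply: emeasurable_funD => //; apply: measurable_mconv => //.
  - exact: measurable_Kpsi.
  - exact: Kpsi_ge0.
have Sg M t : b i t + S M i t <= g t.
  rewrite leeD2l// mconv_Kpsi//; apply: nneseries_lim_ge => m _ _.
  by apply: mconv_ge0 => //; exact: Kpow_ge0.
(* The weighted excess of [q] over the bound; where [g] is infinite the difference is -oo and [D] is
   0. *)
pose D t := wt c t * maxe (q i t - g t) 0.
have D0 t : 0 <= D t by rewrite mule_ge0// le_max lexx orbT.
have mD : measurable_fun setT D.
  by apply: emeasurable_funM => //; apply: measurable_maxe => //; exact: emeasurable_funB.
have Dr M : \int[leb]_t D t <= nr M.
  apply: (@le_trans _ _ (\int[leb]_t (wt c t * r M i t))).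
    apply: ge0_le_integral => // t _; apply: lee_wpmul2l => //.
    rewrite ge_max r0 andbT.
    have := qr M i t; case: (g t) (Sg M t) => [x| |] Sx qt.
    - by rewrite leeBlDl//; apply: le_trans qt _; rewrite leeD2r.
    - by rewrite addeNy leNye.
    - by move: Sx; rewrite leeNy_eq; move/eqP => bS; have := adde_ge0 (b0 i t) (S0 M i t); rewrite bS.
  rewrite /nr (bigD1 i)//= leeDl// sume_ge0// => l _.
  by apply: integral_ge0 => t _; rewrite mule_ge0.
have D_int0 : \int[leb]_t `|D t| = 0.
  under eq_integral do rewrite gee0_abs//.
  apply/eqP; rewrite eq_le integral_ge0// andbT.
  have cv : (2^-1 ^+ M)%:E * nr 0%N @[M --> \oo] --> 0.
    rewrite -(mul0e (nr 0%N)); apply: cvgeM; last exact: cvg_cst.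
      by rewrite mule_def_fin// ge0_fin_numE.
    apply: cvg_EFin; first exact: nearW.
    by apply: cvg_expr; rewrite ger0_norm ?invr_ge0// invf_lt1// ltr1n.
  rewrite -(cvg_lim _ cv)//; apply: lime_ge; first exact: cvgP cv.
  by apply: nearW => M; exact: le_trans (Dr M) (nrM M).
have /ae_eq_integral_abs := D_int0.
move=> /(_ measurableT mD); apply: filterS => t /(_ Logic.I); rewrite /D/= => /eqP.
rewrite mule_eq0 eqe gt_eqF ?expR_gt0//= => /eqP qg.
have : q i t - g t <= 0 by rewrite -qg le_max lexx.
have : 0 <= g t.
  by rewrite adde_ge0//; apply: mconv_ge0 => //; exact: Kpsi_ge0.
rewrite -/(g t); case: (g t) => [x| |] // _; last by move=> _; exact: leey.
by rewrite leeBlDr// add0e.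
Unshelve. all: by end_near. Qed.

End Renewal.

(** * Predictable processes and Poisson integrals *)

Lemma measurable_dispatch d d' (S : measurableType d) (U : measurableType d') (n : nat)
    (p : S -> 'I_n.+1) (f : 'I_n.+1 -> S -> U) :
  measurable_fun setT p -> (forall k, measurable_fun setT (f k)) ->
  measurable_fun setT (fun s => f (p s) s).
Proof.
move=> mp mf _ B mB; rewrite setTI.
rewrite (_ : _ @^-1` B = \bigcup_(k in [set: 'I_n.+1])
    ((p @^-1` [set k]) `&` (f k @^-1` B))).
  apply: fin_bigcup_measurable; first exact: finite_finset.
  move=> k _; apply: measurableI.
    by rewrite -[X in measurable X]setTI; exact: mp.
  by rewrite -[X in measurable X]setTI; exact: mf.
by apply/seteqP; split => [s Bs|s [k _ [/= <-]]//]; exists (p s).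
Qed.

Lemma measurable_lee_cst d (S : measurableType d) (R : realType) (f : S -> \bar R)
  (K : \bar R) : measurable_fun setT f -> measurable [set s | f s <= K].
Proof.
by move=> mf; rewrite -[X in measurable X]setTI; exact: emeasurable_fun_infty_c.
Qed.

(** * Predictability and the strict past *)

Section Predictable.
Context {R : realType} {n : nat}.
Local Notation X := (Xset R n).
Local Notation Omega := (Omega R n).

Lemma measurable_ptype : measurable_fun setT (@ptype R n).
Proof.
rewrite /ptype; apply: measurableT_comp => //.
by apply: measurableT_comp => //; exact: measurableT_comp.
Qed.

(** The past is strict, so that a point added at time [tau] does not alter it. *)
Definition same_past (tau : R) (w1 w2 : Omega) : Prop :=
  forall s A, (0 <= s)%R -> (s < tau)%R -> measurable A -> A `<=` XT s -> N w1 A = N w2 A.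

Lemma FN_measurable t (B : set Omega) : FN t B -> measurable B.
Proof.
apply: (@smallest_sub _ (sigma_algebra setT)).
  exact: sigma_algebra_measurable.
move=> _ [A [mA AXt] [C mC <-]]; apply: sub_sigma_algebra.
by exists A; [split => // x /AXt []|exists C].
Qed.

(** The events that do not separate [w1] from [w2] form a sigma-algebra, and it contains the
    generators of [FN s]. *)
Lemma FN_same_past tau s (w1 w2 : Omega) (B : set Omega) : (0 <= s)%R -> (s < tau)%R ->
  same_past tau w1 w2 -> FN s B -> B w1 <-> B w2.
Proof.
move=> s0 stau w12; suff : FN s `<=` [set B : set Omega | B w1 <-> B w2] by apply.
apply: smallest_sub.
  split => //=.
  - by move=> A Aw; split => -[_ nA]; split => // /Aw.
  - by move=> F Fw; split => -[j _ /Fw]; exists j.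
move=> _ [A [mA AXs] [C mC <-]].
by have wA := w12 s A s0 stau mA AXs; rewrite setTI /preimage/= -/(N w1) wA.
Qed.

(** [measurable_fun] on a domain presupposes that the domain is measurable; this discharges that
    premise in [predictable]. *)
Lemma predictable_measurable_ge0 :
  measurable ([set z : Omega * R | (0 <= z.2)%R]
    : set (g_sigma_algebraType (@predictable_rect R n))).
Proof.
rewrite (_ : [set z | _] = (setT `*` [set 0%R]) `|`
    \bigcup_(m : nat) (setT `*` `]0%R, m%:R]%classic)).
  apply: measurableU.
    apply: sub_sigma_algebra; left; exists setT => //.
    have : sigma_algebra setT (@FN R n 0) by exact: smallest_sigma_algebra.
    by move=> [F0 FC _]; rewrite -(setD0 setT); exact: FC.
  apply: bigcupT_measurable => m; apply: sub_sigma_algebra; right.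
  exists setT, 0%R, m%:R; split => //.
  have : sigma_algebra setT (@FN R n 0) by exact: smallest_sigma_algebra.
  by move=> [F0 FC _]; rewrite -(setD0 setT); exact: FC.
apply/seteqP; split => [[w u] /= u0|[w u] [[_ /= ->]//|[m _ [_ /=]]]].
  move: u0; rewrite le_eqVlt => /orP[/eqP <-|u0]; first by left.
  right; exists (Num.truncn u).+1 => //; split => //=.
  by rewrite in_itv/= u0/= ltW// truncnS_gt.
by rewrite in_itv/= => /andP[/ltW].
Qed.

(** A generating rectangle over []s, t']] meets time [t] only if s < t <= tau, so its base in [FN s]
    cannot separate the two configurations. For the base in [FN 0] this uses [0 < tau]. *)
Lemma predictable_same_past (h : Omega -> R -> R) : predictable h ->
  forall tau w1 w2, same_past tau w1 w2 -> (0 < tau)%R ->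
  forall t, (0 <= t)%R -> (t <= tau)%R -> h w1 t = h w2 t.
Proof.
move=> ph tau w1 w2 w12 tau0 t t0 ttau.
pose D := [set C : set (Omega * R) | C (w1, t) <-> C (w2, t)].
have D_sub : <<s @predictable_rect R n >> `<=` D.
  apply: smallest_sub.
    split => //=.
    - by move=> A Aw; split => -[_ nA]; split => // /Aw.
    - by move=> F Fw; split => -[j _ /Fw]; exists j.
  move=> _ [[B FB ->]|[B [s [t' [s0 st' FB ->]]]]]; rewrite /D/=.
    split => -[Bw /= tE]; split => //; move: Bw.
      by rewrite (FN_same_past (lexx 0%R) tau0 w12 FB).
    by rewrite (FN_same_past (lexx 0%R) tau0 w12 FB).
  split => -[/= Bw tst]; split => //; move: Bw;
  rewrite (FN_same_past (tau := tau) s0 _ w12 FB)//;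
  by move: tst; rewrite in_itv/= => /andP[st _]; exact: lt_le_trans ttau.
(* The preimage of the singleton [h w1 t] contains (w1, t), hence also (w2, t). *)
have mC := ph predictable_measurable_ge0 [set h w1 t] (measurable_set1 _).
have := D_sub _ mC; rewrite /D/=; case=> + _.
by case=> // _ <-.
Qed.

Lemma predictable_measurable (h : Omega -> R -> R) : predictable h ->
  measurable_fun [set z : Omega * R | (0 <= z.2)%R] (fun z => h z.1 z.2).
Proof.
move=> ph mD B mB.
have sub : <<s @predictable_rect R n >> `<=` (@measurable _ (Omega * R)%type).
  apply: smallest_sub; first exact: sigma_algebra_measurable.
  move=> _ [[C FC ->]|[C [s [t [s0 st FC ->]]]]]; apply: measurableX => //;
  exact: FN_measurable FC.
exact: sub (ph predictable_measurable_ge0 B mB).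
Qed.

Lemma same_past_add_point x w : same_past (ptime x) (add_point x w) w.
Proof.
move=> s A s0 sx mA AX; rewrite [LHS]add_point_measE diracE memNset ?adde0//.
by move=> [/AX[_ /=]]; rewrite leNgt sx.
Qed.

Lemma N_eps_plus p (x : 'I_p -> pt R n) w A : (forall j, X (x j)) ->
  N (eps_plus x w) A = N w A + \sum_(j < p) \d_(x j) A.
Proof. by move=> Xx; rewrite eps_plusE. Qed.

Lemma same_past_eps_plus p (x : 'I_p -> pt R n) tau w1 w2 : (forall j, X (x j)) ->
  same_past tau w1 w2 -> same_past tau (eps_plus x w1) (eps_plus x w2).
Proof.
move=> Xx w12 s A s0 stau mA AX.
by rewrite !N_eps_plus// (w12 s A).
Qed.

Lemma measurable_eps_plus p (x : 'I_p -> pt R n) : (forall j, X (x j)) ->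
  measurable_fun setT (eps_plus x : Omega -> Omega).
Proof.
move=> Xx; apply: measurable_to_Omega => A mA AX.
under eq_fun do rewrite N_eps_plus//.
by apply: emeasurable_funD => //; exact: measurable_N.
Qed.

End Predictable.

(** * Mecke's formula for predictable integrands *)

Section PoissonIntegrals.
Context {R : realType} {n : nat}.
Variables (nu : 'I_n.+1 -> probability R R) (P : probability (Omega R n) R).
Hypothesis P_PRM : is_PRM nu P.
Local Notation X := (Xset R n).
Local Notation Omega := (Omega R n).
Local Notation pm := (pmeas nu).
Local Notation leb := (@lebR R).
Local Notation ckern := (@ckern R n).

(** The instant 0 is Lebesgue-null. A strictly positive time is what [predictable_same_past] asks of
    an added point. *)
Lemma pmeas_ae_pos : {ae pm, forall x, X x /\ (0 < ptime x)%R}.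
Proof.
pose Z := [set x : pt R n | ptime x = 0%R].
have mZ : measurable Z.
  rewrite -[X in measurable X]setTI.
  by have := @measurable_ptime R n measurableT [set 0%R] (measurable_set1 _).
have Z0 : pm Z = 0.
  rewrite -[Z]setIT -integral_indic// ge0_integral_pmeas//; last exact/measurable_EFinP.
  apply: big1 => k _.
  rewrite [LHS]integral_mkcond (_ : _ \_ _ = (fun t =>
    (\int[leb]_(th in `[0%R, +oo[) \int[nu k]_(y in `[0%R, +oo[)
       (\1_Z (k, t, th, y))%:E) * (\1_[set 0%R : R] t)%:E)).
    pose c0 := \int[leb]_(th in `[0%R, +oo[) \int[nu k]_(y in `[0%R, +oo[)
      (\1_Z (k, 0%R, th, y) : R)%:E.
    rewrite (eq_integral (fun t : R => c0 * (\1_[set 0%R : R] t)%:E)); last first.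
      move=> t _; rewrite !indicE; have [->//|t0] := eqVneq t 0%R.
      by rewrite memNset ?mule0//; exact/eqP.
    rewrite ge0_integralZl//.
    - rewrite integral_indic// setIT.
      by rewrite [X in _ * X](_ : _ = 0) ?mule0//; exact: lebesgue_measure_set1.
    - exact/measurable_EFinP.
    - by apply: integral_ge0 => th _; apply: integral_ge0 => y _; rewrite lee_fin.
  apply/funext => t; rewrite patchE indicE; case: ifPn => [_|].
    have [->|t0] := eqVneq t 0%R; first by rewrite mem_set// mule1.
    rewrite memNset ?mule0; last exact/eqP.
    apply: integral0_eq => th _; apply: integral0_eq => y _.
    by rewrite indicE memNset//; exact/eqP.
  rewrite notin_setE /= in_itv/= andbT => /negP t0.
  rewrite memNset; first by rewrite mule0.
  by move=> /= t0'; move: t0; rewrite t0' lexx.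
have aX : {ae pm, forall x, X x}.
  exists (~` X); split; first by apply: measurableC; exact: measurable_Xset.
    by rewrite [LHS]pmeasE big1// => k _; rewrite setICl measure0.
  by [].
have aZ : {ae pm, forall x, ~ Z x}.
  by exists Z; split; [exact: mZ|exact: Z0|move=> x /= /contrapT].
apply: filterS2 aX aZ => x Xx Zx; split; first exact: Xx.
rewrite lt_neqAle eq_sym; apply/andP; split; first exact/eqP.
by case: Xx => -[].
Qed.

Lemma integral_pmeasC (F : pt R n * Omega -> \bar R) :
  measurable_fun setT F -> (forall z, 0 <= F z) ->
  \int[P]_w \int[pm]_x F (x, w) = \int[pm]_x \int[P]_w F (x, w).
Proof.
by move=> mF F0; apply/esym; exact: (fubini_tonelli (m1 := pm) (m2 := P) F mF F0).
Qed.

Lemma Mecke_shift (F F' : Omega * pt R n -> \bar R) :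
  measurable_fun setT F -> (forall z, 0 <= F z) ->
  measurable_fun setT F' -> (forall z, 0 <= F' z) ->
  (forall w x, X x -> (0 < ptime x)%R -> F (add_point x w, x) = F' (w, x)) ->
  \int[P]_w \int[ckern w]_x F (w, x) = \int[P]_w \int[pm]_x F' (w, x).
Proof.
move=> mF F0 mF' F'0 FF'.
rewrite (Mecke P_PRM)//.
have mS : measurable_fun setT (fun z : pt R n * Omega => F (add_point z.1 z.2, z.1)).
  exact: (measurableT_comp mF (@measurable_shift_pair R n)).
have mF's : measurable_fun setT (fun z : pt R n * Omega => F' (z.2, z.1)).
  by apply: (measurableT_comp mF'); exact: measurable_swap.
transitivity (\int[pm]_x \int[P]_w F' (w, x)).
  apply: ge0_ae_eq_integral => //.
  - exact: (measurable_fun_fubini_tonelli_F (m2 := P) _ mS).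
  - exact: (measurable_fun_fubini_tonelli_F (m2 := P) _ mF's).
  - by move=> x _; exact: integral_ge0.
  - by move=> x _; exact: integral_ge0.
  - apply: filterS pmeas_ae_pos => x [Xx x0] _.
    by apply: eq_integral => w _; exact: FF'.
exact: (fubini_tonelli (m1 := pm) (m2 := P) _ mF's).
Qed.

Lemma measurable_ckern_param d (S : measurableType d) (g : S -> Omega)
    (F : S * pt R n -> \bar R) : measurable_fun setT g ->
  measurable_fun setT F -> (forall z, 0 <= F z) ->
  measurable_fun setT (fun s => \int[ckern (g s)]_x F (s, x)).
Proof.
move=> mg mF F0.
rewrite (_ : (fun s => _) = (fun s => \int[count_kernel mg s]_x F (s, x))).
  exact: (measurable_integral_kernel (count_kernel mg)).
by apply/funext => s; apply: eq_measure_integral.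
Qed.

Lemma measurable_integral_pmeas d (S : measurableType d) (F : S * pt R n -> \bar R) :
  measurable_fun setT F -> (forall z, 0 <= F z) ->
  measurable_fun setT (fun s => \int[pm]_x F (s, x)).
Proof. by move=> mF F0; exact: (measurable_fun_fubini_tonelli_F (m2 := pm)). Qed.

Lemma ge0_integral_ckern_add x w (F : pt R n -> \bar R) : X x -> Good w ->
  measurable_fun setT F -> (forall z, 0 <= F z) ->
  \int[ckern (add_point x w)]_z F z = \int[ckern w]_z F z + F x.
Proof.
move=> Xx Gw mF F0; rewrite !integral_count_kernel//; last exact/Good_add_point.
rewrite (eq_measure_integral (measure_add (N w) (\d_x : {measure set (pt R n) -> \bar R}))).
  by rewrite ge0_integral_measure_add// integral_dirac// diracT mul1e.
by move=> A mA _; rewrite N_add_point//; exact/esym/measure_addE.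
Qed.

Section FiniteCompensator.
Variable g : Omega * pt R n -> \bar R.
Hypotheses (mg : measurable_fun setT g) (g0 : forall z, 0 <= g z).
Hypothesis g1 : forall z, g z <= 1.
Hypothesis g_past : forall w x z, X x -> X z -> (0 < ptime x)%R ->
  (ptime z <= ptime x)%R -> g (add_point x w, z) = g (w, z).

Let G (s : R) (w : Omega) : \bar R := \int[ckern w]_(z in [set z | (ptime z <= s)%R]) g (w, z).

Let mbefore s : measurable [set z : pt R n | (ptime z <= s)%R].
Proof. by apply: measurable_le_fun => //; exact: measurable_ptime. Qed.

Let mgw w : measurable_fun setT (fun z => g (w, z)).
Proof. exact: (measurable_fun_pair2 w mg). Qed.

(* Mecke's formula for [g] cut at the first time its running integral exceeds
   [K + 1]: adding the point x changes that integral by at most 1, so the cut is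
   inactive wherever the total integral is at most [K]. *)
Lemma ae_finite_compensator :
  {ae P, forall w, \int[ckern w]_z g (w, z) < +oo} ->
  {ae P, forall w, \int[pm]_z g (w, z) < +oo}.
Proof.
move=> Gfin.
pose Gam (w : Omega) : \bar R := \int[ckern w]_z g (w, z).
pose A (w : Omega) : \bar R := \int[pm]_z g (w, z).
have A0 w : 0 <= A w by exact: integral_ge0.
have mA : measurable_fun setT A by exact: measurable_integral_pmeas.
have mGam : measurable_fun setT Gam.
  by apply: (measurable_ckern_param (g := id)) => //; exact: measurable_id.
have Gam0 w : 0 <= Gam w by exact: integral_ge0.
pose Gx (z : Omega * pt R n) : \bar R := G (ptime z.2) z.1.
have mGx : measurable_fun setT Gx.
  pose F (u : (Omega * pt R n) * pt R n) := g (u.1.1, u.2) *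
    (\1_[set u : (Omega * pt R n) * pt R n | (ptime u.2 <= ptime u.1.2)%R] u)%:E.
  rewrite (_ : Gx = fun z => \int[ckern z.1]_x F (z, x)).
    apply: measurable_ckern_param => //.
    - apply: emeasurable_funM.
        apply: (measurableT_comp mg).
        apply: measurable_fun_pair => //.
        by apply: (measurableT_comp (f := fst)) => //; exact: measurable_fst.
      apply/measurable_EFinP/measurable_indic; apply: measurable_le_fun.
        apply: (measurableT_comp (@measurable_ptime R n)) => //.
      apply: (measurableT_comp (@measurable_ptime R n)) => //.
      by apply: (measurableT_comp (f := snd)) => //; exact: measurable_fst.
    - by move=> u; rewrite mule_ge0// lee_fin.
  apply/funext => z; rewrite /Gx /G integral_mkcond; apply: eq_integral => x _.
  rewrite patchE /F indicE/=; have [xz|xz] := boolP (x \in _).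
    by rewrite mem_set ?mule1//; move: xz; rewrite inE.
  by rewrite memNset ?mule0//; move: xz; rewrite notin_setE.
pose cut K := [set z | Gx z <= K].
have mcut K : measurable (cut K) by exact: (measurable_lee_cst K mGx).
pose small (K : nat) := [set w | Gam w <= K%:R%:E].
have msmall K : measurable (small K) by exact: (measurable_lee_cst K%:R%:E mGam).
have bound (K : nat) : \int[P]_w (A w * (\1_(small K) w)%:E) <= K.+1%:R%:E.
  pose F (z : Omega * pt R n) := g z * (\1_(cut K.+1%:R%:E) z)%:E.
  have mF : measurable_fun setT F.
    by apply: emeasurable_funM => //; apply/measurable_EFinP/measurable_indic.
  have F0 z : 0 <= F z by rewrite mule_ge0// lee_fin.
  apply: (@le_trans _ _ (\int[P]_w \int[ckern w]_x F (w, x))); last first.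
    apply: (@le_trans _ _ (\int[P]_w K.+1%:R%:E)).
      apply: ge0_le_integral.
      - exact: measurableT.
      - by move=> w _; exact: integral_ge0.
      - by apply: (measurable_ckern_param (g := id)) => //; exact: measurable_id.
      - exact: measurable_cst.
      - move=> w _.
        apply: le_trans (integral_cut_le (ckern w) (@measurable_ptime R n)
          (mgw w) (fun z => g0 (w, z)) (K := K.+1%:R%:E) _); last by rewrite lee_fin.
        rewrite [leRHS]integral_mkcond le_eqVlt; apply/orP; left; apply/eqP.
        apply: eq_integral => x _; rewrite patchE /F indicE/=.
        have [xz|xz] := boolP (x \in _).
          by rewrite mem_set ?mule1//; move: xz; rewrite inE.
        by rewrite memNset ?mule0//; move: xz; rewrite notin_setE.
    rewrite integral_cst// [X in _ * X]probability_setT mule1//.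
  rewrite (Mecke P_PRM)//.
  pose F' (z : pt R n * Omega) := g (z.2, z.1) * (\1_(small K) z.2)%:E.
  have mF' : measurable_fun setT F'.
    apply: emeasurable_funM.
      by apply: (measurableT_comp mg); exact: measurable_swap.
    by apply/measurable_EFinP; apply: measurableT_comp.
  have F'0 z : 0 <= F' z by rewrite mule_ge0// lee_fin.
  rewrite (_ : \int[P]_w _ = \int[P]_w \int[pm]_x F' (x, w)); last first.
    apply: eq_integral => w _; rewrite /F'/= ge0_integralZr//.
  rewrite (integral_pmeasC mF' F'0).
  apply: ae_ge0_le_integral; first exact: measurableT.
  - by move=> x _; exact: integral_ge0.
  - exact: (measurable_fun_fubini_tonelli_F (m2 := P) _ mF').
  - by move=> x _; exact: integral_ge0.
  - have mS : measurable_fun setT (fun z : pt R n * Omega => F (add_point z.1 z.2, z.1)).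
      exact: (measurableT_comp mF (@measurable_shift_pair R n)).
    exact: (measurable_fun_fubini_tonelli_F (m2 := P) _ mS).
  apply: filterS pmeas_ae_pos => x [Xx x0] _.
  have mSx : measurable_fun setT (fun w => F (add_point x w, x)).
    have := measurableT_comp mF (@measurable_shift_pair R n).
    exact: measurable_fun_pair2.
  apply: ae_ge0_le_integral; first exact: measurableT.
  - by move=> w _; exact: F'0.
  - exact: (measurable_fun_pair2 x mF').
  - by move=> w _; exact: F0.
  - exact: mSx.
  apply: filterS (ae_Good P_PRM) => w Gw _.
  rewrite /F' /F/= g_past// lee_wpmul2l// lee_fin !indicE.
  have [|] := boolP (w \in _); last by rewrite ler_nat.
  rewrite inE/= => GK; rewrite mem_set//= /cut/= /Gx/= /G integral_mkcond.
  rewrite ge0_integral_ckern_add//; last 2 first.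
  - apply/(measurable_restrictT _ (mbefore _)); exact: measurable_funTS.
  - by move=> z; rewrite patchE; case: ifP.
  rewrite -natr1 EFinD leeD//.
    apply: le_trans GK; apply: ae_ge0_le_integral; first exact: measurableT.
    - by move=> z _; rewrite patchE; case: ifP.
    - apply/(measurable_restrictT _ (mbefore _)); exact: measurable_funTS.
    - by move=> z _; exact: g0.
    - exact: mgw.
    (* [g_past] speaks of points of X only, so the complement must be discarded as null. *)
    have XC : (ckern w) (~` X) = 0.
      rewrite count_kernelE//; last by apply: measurableC; exact: measurable_Xset.
      by rewrite N_Xset setICl measure0.
    exists (~` X); split => //; first by apply: measurableC; exact: measurable_Xset.
    move=> z /=; apply: contra_notP => /contrapT Xz _.
    by rewrite patchE; case: ifPn => //; rewrite inE/= => zx; rewrite g_past.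
  by rewrite patchE; case: ifP => // _; exact: le_trans (g1 _).
have fin K : {ae P, forall w, Gam w <= K%:R%:E -> A w < +oo}.
  have mI : measurable_fun setT (fun w => A w * (\1_(small K) w)%:E).
    by apply: emeasurable_funM => //; apply/measurable_EFinP/measurable_indic.
  have : P.-integrable setT (fun w => A w * (\1_(small K) w)%:E).
    apply/integrableP; split => //; apply: le_lt_trans (_ : _ <= K.+1%:R%:E) (ltry _).
    under eq_integral do rewrite gee0_abs ?mule_ge0 ?lee_fin//.
    exact: bound.
  move=> /(integrable_ae measurableT); apply: filterS => w /(_ Logic.I) + GK.
  by rewrite indicE mem_set// mule1 ge0_fin_numE.
have finT : {ae P, forall w, forall K : nat, Gam w <= K%:R%:E -> A w < +oo}.
  exact/ae_foralln.
apply: filterS2 Gfin finT => w Gw h.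
apply: (h (Num.truncn (fine (Gam w))).+1).
rewrite -[leLHS]fineK ?ge0_fin_numE// lee_fin.
exact/ltW/truncnS_gt.
Qed.

End FiniteCompensator.

End PoissonIntegrals.

Lemma ge0_integral_eq0_ae d (T : measurableType d) (R : realType)
    (mu : {measure set T -> \bar R}) (f : T -> \bar R) :
  measurable_fun setT f -> (forall x, 0 <= f x) -> \int[mu]_x f x = 0 ->
  {ae mu, forall x, f x = 0}.
Proof.
move=> mf f0 If0; have : \int[mu]_x `|f x| = 0.
  by under eq_integral do rewrite gee0_abs//.
by move=> /(ae_eq_integral_abs _ measurableT mf); apply: filterS => x; exact.
Qed.

(** * Local integrability from a finite convolution *)

Section LocalIntegrability.
Context {R : realType}.
Local Notation leb := (@lebR R).
Variables f l : R -> \bar R.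
Hypotheses (mf : measurable_fun setT f) (ml : measurable_fun setT l).
Hypotheses (f0 : forall t, 0 <= f t) (l0 : forall t, 0 <= l t).
Hypotheses (f1 : forall t, f t <= 1).
Hypotheses (f_neg : forall t, (t < 0 :> R)%R -> f t = 0)
  (l_neg : forall t, (t < 0 :> R)%R -> l t = 0).

(** A probability density, chosen because e (t + s) = e^(-s) e t for s, t >= 0, so that translating
    it costs only a constant factor. *)
Let e (t : R) : \bar R := (exponential_pdf 1%R t)%:E.

Let me : measurable_fun setT e.
Proof. by apply/measurable_EFinP; exact: measurable_exponential_pdf. Qed.

Let e0 t : 0 <= e t.
Proof. by rewrite lee_fin exponential_pdf_ge0. Qed.

Let int_e : \int[leb]_t e t = 1.
Proof. by rewrite -integral_lebR; exact: integral_exponential_pdf. Qed.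

Let eD (s t : R) : (0 <= s)%R -> e (t + s)%R * f t = (expR (- s))%:E * (wt 1 t * f t).
Proof.
move=> s0; have [t0|t0] := ltP t 0%R; first by rewrite f_neg// !mule0.
rewrite /e exponential_pdfE ?addr_ge0//= mul1r.
rewrite muleA /wt -EFinM -expRD; congr ((expR _)%:E * _).
lra.
Qed.

Let C := conv f l.

Let mC : measurable_fun setT C. Proof. exact: measurable_conv. Qed.

Let large (K : nat) := [set t | K%:R%:E < C t].

Let mlarge K : measurable (large K).
Proof.
rewrite (_ : large K = ~` [set t | C t <= K%:R%:E]).
  by apply: measurableC; exact: measurable_lee_cst.
by apply/seteqP; split => t; rewrite /large/= ltNge => /negP.
Qed.

Let tail (K : nat) t := e t * (\1_(large K) t)%:E.

Let mtail K : measurable_fun setT (tail K).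
Proof.
by apply: emeasurable_funM; [exact: me|exact/measurable_EFinP/measurable_indic].
Qed.

Let tail_cvg : {ae leb, forall t, C t < +oo} ->
  \int[leb]_t tail K t @[K --> \oo] --> 0.
Proof.
move=> Cfin.
have := @dominated_convergence _ _ _ leb setT measurableT tail (cst 0) e.
rewrite integral0; case => //.
- apply: filterS Cfin => t Ct _; apply: cvg_near_cst.
  have : (C t) \is a fin_num by rewrite ge0_fin_numE// conv_ge0.
  move=> Cf; exists (Num.truncn (fine (C t))).+1 => // K /= tK.
  rewrite /tail indicE memNset ?mule0// /large/= -[C t]fineK// lte_fin.
  apply/negP; rewrite -leNgt; apply/ltW/(lt_le_trans (truncnS_gt _)).
  by rewrite ler_nat.
- apply/integrableP; split => //.
  by under eq_integral do rewrite gee0_abs//; rewrite int_e ltry.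
- apply: aeW => t K _; rewrite gee0_abs; last by rewrite mule_ge0// lee_fin.
  rewrite /tail -EFinM lee_fin ler_piMr//; exact: exponential_pdf_ge0.
Qed.

(* If [C = conv f l] is at most [K] outside a set of small mass for the law
   [e^(-t) dt], integrating [C] over the complement of that set bounds a positive
   multiple of the integral of [l] over [0, t0]. *)
Lemma conv_locally_finite : 0 < \int[leb]_t f t ->
  {ae leb, forall t, C t < +oo} ->
  forall t0 : R, \int[leb]_(s in [set s | (s <= t0)%R]) l s < +oo.
Proof.
move=> fpos Cfin t0.
have mwf : measurable_fun setT (fun s => wt 1 s * f s).
  by apply: emeasurable_funM => //; exact: measurable_wt.
have wf0 s : 0 <= wt 1 s * f s by rewrite mule_ge0// wt_ge0.
pose c := \int[leb]_s (wt 1 s * f s).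
have c_gt0 : 0 < c.
  rewrite lt_neqAle integral_ge0// andbT; apply/eqP => /esym c0.
  have wf_ae := ge0_integral_eq0_ae mwf wf0 c0.
   move: fpos; rewrite (ae_eq_integral (cst 0))//.
    by rewrite integral0 ltxx.
  apply: filterS wf_ae => s /eqP + _; rewrite mule_eq0 => /orP[|/eqP//].
  by rewrite eqe gt_eqF// expR_gt0.
have c_fin : c < +oo.
  apply: le_lt_trans (ltry 1%R); rewrite -int_e; apply: ge0_le_integral => //.
  move=> s _; have [s0|s0] := ltP s 0%R; first by rewrite f_neg// mule0.
  have := eD s (lexx 0%R); rewrite oppr0 expR0 mul1e addr0 => <-.
  by rewrite -[leRHS]mule1 lee_wpmul2l.
(* The integral of e t * f (t - s) in t equals e^(-s) c, which is at least [r] for 0 <= s <= t0.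
   Removing the set where [C] exceeds [K] costs at most r / 2, because f <= 1. *)
pose r := (expR (- t0) * fine c)%R.
have r_gt0 : (0 < r)%R by rewrite mulr_gt0 ?expR_gt0// fine_gt0// c_gt0.
have [K tailK] : exists K, \int[leb]_t tail K t < (r / 2)%:E.
  have /fine_cvgP[tail_fin /cvgrPdist_lt /(_ (r / 2)%R)] := tail_cvg Cfin.
  rewrite divr_gt0// => /(_ isT) tail_small; near \oo => K; exists K.
  have Kfin : \int[leb]_t tail K t \is a fin_num by near: K.
  rewrite -[ltLHS]fineK// lte_fin; apply: le_lt_trans (ler_norm _) _.
  by rewrite -normrN -sub0r; near: K.
pose v t := e t * (\1_(~` large K) t)%:E.
have mv : measurable_fun setT v.
  by apply: emeasurable_funM => //; apply/measurable_EFinP/measurable_indic/measurableC.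
have v0 t : 0 <= v t by rewrite mule_ge0// lee_fin.
have tail0 t : 0 <= tail K t by rewrite mule_ge0// lee_fin.
have eE t : e t = v t + tail K t.
  rewrite /v /tail -ge0_muleDr ?lee_fin// -EFinD !indicE in_setC.
  by case: (_ \in _); rewrite ?addr0 ?add0r mule1.
have msub s : measurable_fun setT (fun t : R => f (t - s)%R).
  by apply: measurableT_comp => //; exact: measurable_addl.
have low s : (0 <= s)%R -> (s <= t0)%R -> (r / 2)%:E <= \int[leb]_t (v t * f (t - s)%R).
  move=> s0 st0.
  have : r%:E <= \int[leb]_t (e t * f (t - s)%R).
    rewrite -(ge0_integral_shift s); last 2 first.
    - by apply: emeasurable_funM.
    - by move=> t; rewrite mule_ge0.
    under eq_integral do rewrite addrK eD//.
    rewrite ge0_integralZl// ?lee_fin ?expR_ge0// -/c -[c]fineK; last by rewrite ge0_fin_numE// ltW.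
    rewrite -EFinM lee_fin; apply: ler_wpM2r; first by rewrite fine_ge0// ltW.
    by rewrite ler_expR lerN2.
  under eq_integral do rewrite eE ge0_muleDl//.
  rewrite ge0_integralD//; last 4 first.
  - by move=> t _; rewrite mule_ge0.
  - exact: emeasurable_funM.
  - by move=> t _; rewrite mule_ge0.
  - exact: emeasurable_funM.
  move=> h; have : r%:E <= \int[leb]_t (v t * f (t - s)%R) + (r / 2)%:E.
    apply: le_trans h _; rewrite leeD2l//; apply: le_trans (ltW tailK).
    apply: ge0_le_integral => //.
    - by move=> t _; rewrite mule_ge0.
    - exact: emeasurable_funM.
    - by move=> t _; rewrite -[leRHS]mule1 lee_wpmul2l.
  by rewrite -leeBlDr// -EFinB; apply: le_trans; rewrite lee_fin; lra.
have mle : measurable [set s | (s <= t0)%R] by exact: measurable_le_fun.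
have mF : measurable_fun setT (fun z : R * R => v z.2 * (f (z.2 - z.1)%R * l z.1)).
  apply: emeasurable_funM; first exact: (measurableT_comp mv).
  apply: emeasurable_funM; last exact: (measurableT_comp ml).
  by apply: (measurableT_comp mf); exact: measurable_funB.
have F0 (z : R * R) : 0 <= v z.2 * (f (z.2 - z.1)%R * l z.1) by rewrite !mule_ge0.
(* By [low] and Tonelli the left side is at most the integral of v t * C t, and [C] is at most [K]
   where [v] does not vanish. *)
have key : (r / 2)%:E * \int[leb]_(s in [set s | (s <= t0)%R]) l s <= K%:R%:E.
  rewrite integral_mkcond -ge0_integralZl//; last 3 first.
  - exact/(measurable_restrictT _ mle)/measurable_funTS.
  - by move=> s _; rewrite patchE; case: ifP.
  - by rewrite lee_fin; lra.
  apply: (@le_trans _ _ (\int[leb]_s \int[leb]_t (v t * (f (t - s)%R * l s)))).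
    apply: ge0_le_integral => //.
    - move=> s _; rewrite mule_ge0//; first by rewrite lee_fin; lra.
      by rewrite patchE; case: ifP.
    - apply: emeasurable_funM => //.
      exact/(measurable_restrictT _ mle)/measurable_funTS.
    - exact: (measurable_fun_fubini_tonelli_F (m2 := leb) _ mF).
    - move=> s _; rewrite patchE; case: ifPn => [|_]; last first.
        by rewrite mule0; apply: integral_ge0 => t _; rewrite !mule_ge0.
      rewrite inE/= => st0; have [s0|s0] := ltP s 0%R.
        by rewrite l_neg// mule0; apply: integral_ge0 => t _; rewrite !mule_ge0.
      under eq_integral do rewrite muleA.
      rewrite ge0_integralZr//; last 2 first.
      + exact: emeasurable_funM.
      + by move=> t _; rewrite mule_ge0.
      by rewrite lee_wpmul2r// low.
  rewrite (fubini_tonelli (m1 := leb) (m2 := leb) (fun z => v z.2 * (f (z.2 - z.1)%R * l z.1))).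
  apply: (@le_trans _ _ (\int[leb]_t (K%:R%:E * e t))).
    apply: ge0_le_integral => //.
    - by move=> t _; apply: integral_ge0 => s _; rewrite !mule_ge0.
    - exact: (measurable_fun_fubini_tonelli_G (m1 := leb) _ mF).
    - exact: emeasurable_funM.
    - move=> t _; rewrite /= ge0_integralZl//; last 2 first.
      + apply: emeasurable_funM => //; apply: (measurableT_comp mf).
        by apply: measurable_funB.
      + by move=> s _; rewrite mule_ge0.
      rewrite -/(conv f l t) -/(C t) /v indicE.
      have [|_] := boolP (t \in _); last by rewrite mule0 mul0e mule_ge0// lee_fin.
      rewrite inE /= => /negP; rewrite -leNgt => CK.
      by rewrite mule1 muleC lee_wpmul2r.
  by rewrite ge0_integralZl// int_e mule1.
  - exact: mF.
  - exact: F0.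
rewrite ltNge leye_eq; apply/negP => /eqP lE; move: key.
by rewrite lE gt0_muley ?lte_fin ?divr_gt0// leye_eq.
Unshelve. all: by end_near. Qed.

End LocalIntegrability.

Section Reflection.
Context {R : realType}.
Local Notation leb := (@lebR R).

Let measurable_opp : measurable_fun setT (fun s : R => - s)%R.
Proof. exact: measurable_funN. Qed.

Lemma lebR_opp (A : set R) : measurable A -> leb ((fun s => - s)%R @^-1` A) = leb A.
Proof.
move=> mA; apply/esym.
pose mu' : {measure set (measurableTypeR R) -> \bar R} :=
 measure_function_pushforward__canonical__measure_function_Measure
  (@lebesgue_measure R : {measure set (measurableTypeR R) -> \bar R})
  (measurable_opp : @measurable_fun _ _ (measurableTypeR R) (measurableTypeR R)
     setT (fun s : R => - s)%R).
apply: (lebesgue_measure_unique (mu := mu')) => // _ [[b c]] _ <-.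
rewrite /mu'/= /pushforward.
rewrite (_ : _ @^-1` _ = `[(- c)%R, (- b)%R[%classic); last first.
  by apply/seteqP; split => s /=; rewrite !in_itv/= ltrNr lerNl andbC.
rewrite !lebesgue_measure_itv/= !lte_fin ltrN2; case: ifP => // _.
by rewrite -!EFinB opprK addrC.
Qed.

Lemma ge0_integral_opp (f : R -> \bar R) : measurable_fun setT f -> (forall t, 0 <= f t) ->
  \int[leb]_s f (- s)%R = \int[leb]_s f s.
Proof.
move=> mf f0.
rewrite -[LHS](ge0_integral_pushforward measurable_opp leb measurableT mf)//.
apply: (@eq_measure_integral _ _ _ setT leb
  (measure_function_pushforward__canonical__measure_function_Measure leb
    measurable_opp)) => A mA _.
exact: (lebR_opp mA).
Qed.

(** By reflection and translation, f (t - s) vanishes for almost every s. *)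
Lemma conv_eq0 (f g : R -> \bar R) t :
  measurable_fun setT f -> measurable_fun setT g ->
  (forall t, 0 <= f t) -> (forall t, 0 <= g t) ->
  \int[leb]_s f s = 0 -> conv f g t = 0.
Proof.
move=> mf mg f0 g0 If0.
have mft : measurable_fun setT (fun s : R => f (s + t)%R).
  by apply: measurableT_comp => //; exact: measurable_addl.
have mftN : measurable_fun setT (fun s : R => f (t - s)%R).
  by apply: measurableT_comp => //; exact: measurable_funB.
have I0 : \int[leb]_s f (t - s)%R = 0.
  under eq_integral do rewrite addrC.
  by rewrite (ge0_integral_opp (f := fun s => f (s + t)%R))// ge0_integral_shift.
have := ge0_integral_eq0_ae mftN (fun s => f0 (t - s)%R) I0 => ft0.
rewrite /conv (ae_eq_integral (cst 0)) ?integral0//.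
- exact: emeasurable_funM.
- by apply: filterS ft0 => s fs0 _; rewrite fs0 mul0e.
Qed.

End Reflection.

(** * Thinned integrals and the mean intensity *)

Section Thinning.
Context {R : realType} {n : nat}.
Variables (nu : 'I_n.+1 -> probability R R) (P : probability (Omega R n) R).
Hypothesis P_PRM : is_PRM nu P.
Local Notation X := (Xset R n).
Local Notation Omega := (Omega R n).
Local Notation pm := (pmeas nu).
Local Notation leb := (@lebR R).
Local Notation ckern := (@ckern R n).

Definition past_only (U : Type) (h : Omega * R -> U) := forall x w t,
  X x -> (0 < ptime x)%R -> (t <= ptime x)%R -> h (add_point x w, t) = h (w, t).

Variable L : 'I_n.+1 -> Omega * R -> R.
Hypotheses (mL : forall k, measurable_fun setT (L k)) (L0 : forall k z, (0 <= L k z)%R).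
Hypothesis L_neg : forall k w t, (t < 0)%R -> L k (w, t) = 0%R.
Hypothesis L_past : forall k, past_only (L k).

Definition thin : set (Omega * pt R n) :=
  [set z | (plevel z.2 <= L (ptype z.2) (z.1, ptime z.2))%R].

Lemma measurable_thin : measurable thin.
Proof.
apply: measurable_le_fun.
  exact: (measurableT_comp (@measurable_plevel R n)).
apply: (measurable_dispatch (p := fun z : Omega * pt R n => ptype z.2)
  (f := fun k z => L k (z.1, ptime z.2))).
  exact: (measurableT_comp (@measurable_ptype R n)).
move=> k; apply: (measurableT_comp (mL k)); apply: measurable_fun_pair => //.
exact: (measurableT_comp (@measurable_ptime R n)).
Qed.

Lemma thin_past w x z : X x -> (0 < ptime x)%R -> (ptime z <= ptime x)%R ->
  (\1_thin (add_point x w, z) : R) = \1_thin (w, z).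
Proof.
move=> Xx x0 zx; rewrite !indicE; congr (nat_of_bool _)%:R.
by apply/idP/idP; rewrite !inE /thin/= L_past.
Qed.

Section Mark.
Variable a : 'I_n.+1 -> R -> R -> \bar R.
Hypotheses (ma : forall k, measurable_fun setT (fun z : R * R => a k z.1 z.2))
  (a0 : forall k u y, 0 <= a k u y).
Variable T : R.

Definition mark_mean k u : \bar R := \int[nu k]_(y in `[0%R, +oo[) a k u y.

Lemma mark_mean_ge0 k u : 0 <= mark_mean k u.
Proof. by apply: integral_ge0 => y _. Qed.

Lemma measurable_mark_mean k : measurable_fun setT (mark_mean k).
Proof.
rewrite (_ : mark_mean k = fun u => \int[nu k]_y (a k u y *
    (\1_(`[0%R, +oo[%classic : set R) y)%:E)).
  apply: (measurable_fun_fubini_tonelli_F (m2 := nu k)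
    (fun z => a k z.1 z.2 * (\1_(`[0%R, +oo[%classic : set R) z.2)%:E)).
    apply: emeasurable_funM; first exact: ma.
    by apply/measurable_EFinP/(measurableT_comp (measurable_indic _)).
  by move=> z; rewrite mule_ge0// lee_fin.
apply/funext => u; rewrite /mark_mean integral_mkcond; apply: eq_integral => y _.
by rewrite patchE indicE; case: (_ \in _); rewrite ?mule1 ?mule0.
Qed.

Definition mark_at (x : pt R n) : \bar R := a (ptype x) (T - ptime x)%R (pmark x).

Lemma measurable_mark_at : measurable_fun setT mark_at.
Proof.
apply: (measurable_dispatch (p := @ptype R n)
  (f := fun k x => a k (T - ptime x)%R (pmark x))); first exact: measurable_ptype.
move=> k; apply: (measurableT_comp (g := fun x : pt R n => (T - ptime x, pmark x)%R) (ma k)).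
apply: measurable_fun_pair.
  by apply: measurable_funB => //; exact: measurable_ptime.
exact: measurable_pmark.
Qed.

(** Integrating the level over [0, L] gives the factor L and integrating the mark gives [mark_mean];
    a convolution in time remains. *)
Lemma compensator w (H : R -> \bar R) : measurable_fun setT H -> (forall t, 0 <= H t) ->
  \int[pm]_x (mark_at x * H (ptime x) * (\1_thin (w, x))%:E) =
  \sum_k conv (mark_mean k) (fun t => H t * (L k (w, t))%:E) T.
Proof.
move=> mH H0; rewrite ge0_integral_pmeas; last 2 first.
- apply: emeasurable_funM.
    apply: emeasurable_funM; first exact: measurable_mark_at.
    by apply: (measurableT_comp mH); exact: measurable_ptime.
  apply/measurable_EFinP.
  exact: (measurable_fun_pair2 w (measurable_indic measurable_thin)).
- by move=> x; rewrite !mule_ge0// ?lee_fin// /mark_at a0.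
apply: eq_bigr => k _; rewrite /conv [LHS]integral_mkcond; apply: eq_integral => t _.
rewrite patchE; case: ifPn => [t0|]; last first.
  rewrite notin_setE/= in_itv/= andbT => /negP; rewrite -ltNge => t0.
  by rewrite L_neg// !mule0.
transitivity (\int[leb]_(th in `[0%R, +oo[) (mark_mean k (T - t)%R * H t *
   (\1_([set th : R | (th <= L k (w, t))%R]) th)%:E)).
  apply: eq_integral => th _; rewrite /mark_at/=.
  pose c : R := \1_[set th : R | (th <= L k (w, t))%R] th.
  rewrite (eq_integral (fun y => a k (T - t)%R y * (H t * c%:E))); last first.
    by move=> y _; rewrite -muleA.
  rewrite ge0_integralZr//.
  - by rewrite -muleA.
  - exact: measurable_funTS (measurable_fun_pair2 (T - t)%R (ma k)).
  - by rewrite mule_ge0// lee_fin.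
rewrite ge0_integralZl//; last 2 first.
- by apply/measurable_EFinP/measurable_funTS/measurable_indic/measurable_le_fun.
- by rewrite mule_ge0// mark_mean_ge0.
rewrite -muleA; congr (_ * (_ * _)).
rewrite integral_indic//; last by apply: measurable_le_fun.
rewrite (_ : _ `&` _ = `[0%R, L k (w, t)]%classic); last first.
  apply/seteqP; split => th /=; rewrite !in_itv/= andbT; first by move=> [-> ->].
  by move=> /andP[-> ->].
by rewrite [LHS]lebR_cc subr0 max_r.
Qed.

(** The weight [H] leaves room for a truncation: it will be 1, or the indicator that the accumulated
    intensity is still below a level. *)
Lemma E_thinned (H : Omega * R -> \bar R) : measurable_fun setT H ->
  (forall z, 0 <= H z) -> past_only H ->
  \int[P]_w \int[ckern w]_x (mark_at x * H (w, ptime x) * (\1_thin (w, x))%:E) =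
  \sum_k conv (mark_mean k) (fun t => \int[P]_w (H (w, t) * (L k (w, t))%:E)) T.
Proof.
move=> mH H0 H_past.
pose F (z : Omega * pt R n) := mark_at z.2 * H (z.1, ptime z.2) * (\1_thin z)%:E.
have mF : measurable_fun setT F.
  apply: emeasurable_funM; last by apply/measurable_EFinP; exact: measurable_indic measurable_thin.
  apply: emeasurable_funM; first exact: (measurableT_comp measurable_mark_at).
  apply: (measurableT_comp mH); apply: measurable_fun_pair => //.
  exact: (measurableT_comp (@measurable_ptime R n)).
have F0 z : 0 <= F z by rewrite !mule_ge0// ?lee_fin// /mark_at a0.
rewrite -[LHS]/(\int[P]_w \int[ckern w]_x F (w, x)).
rewrite (Mecke_shift P_PRM mF F0 mF F0); last first.
  by move=> w x Xx x0; rewrite /F/= H_past// thin_past.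
have mHw w : measurable_fun setT (fun t => H (w, t)) by exact: (measurable_fun_pair2 w mH).
pose G k (z : Omega * R) := mark_mean k (T - z.2)%R * (H z * (L k z)%:E).
have mG k : measurable_fun setT (G k).
  apply: emeasurable_funM.
    apply: (measurableT_comp (measurable_mark_mean k)).
    by apply: measurable_funB => //; exact: measurable_snd.
  by apply: emeasurable_funM => //; exact/measurable_EFinP.
have G0 k z : 0 <= G k z by rewrite !mule_ge0 ?mark_mean_ge0// lee_fin.
transitivity (\int[P]_w \sum_k \int[leb]_t G k (w, t)).
  by apply: eq_integral => w _; exact: compensator.
rewrite ge0_integral_sum//; last 2 first.
- move=> k; exact: (measurable_fun_fubini_tonelli_F (m2 := leb) _ (mG k)).
- by move=> k w _; exact: integral_ge0.
apply: eq_bigr => k _.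
rewrite (fubini_tonelli (m1 := P) (m2 := leb) (G k))//.
rewrite /conv; apply: eq_integral => t _; rewrite /G/= ge0_integralZl//.
- apply: emeasurable_funM; first exact: (measurable_fun_pair1 t mH).
  by apply/measurable_EFinP; exact: (measurable_fun_pair1 t (mL k)).
- by move=> w _; rewrite mule_ge0// lee_fin.
- exact: mark_mean_ge0.
Qed.

(** The bound by 1 is the one that [ae_finite_compensator] puts on the effect of a single point. *)
Lemma ae_conv_finite : (forall k u y, a k u y <= 1) ->
  {ae P, forall w, \int[ckern w]_x (mark_at x * (\1_thin (w, x))%:E) < +oo} ->
  {ae P, forall w, forall k, conv (mark_mean k) (fun t => (L k (w, t))%:E) T < +oo}.
Proof.
move=> a1 fin.
pose g (z : Omega * pt R n) := mark_at z.2 * (\1_thin z)%:E.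
have mg : measurable_fun setT g.
  apply: emeasurable_funM; last by apply/measurable_EFinP; exact: measurable_indic measurable_thin.
  exact: (measurableT_comp measurable_mark_at).
have g0 z : 0 <= g z by rewrite !mule_ge0// ?lee_fin// /mark_at a0.
have g1 z : g z <= 1.
  apply: (@le_trans _ _ (mark_at z.2 * 1)); last by rewrite mule1 /mark_at a1.
  apply: lee_wpmul2l; first by rewrite /mark_at a0.
  by rewrite lee_fin indicE; case: (_ \in _).
have g_past w x z : X x -> X z -> (0 < ptime x)%R -> (ptime z <= ptime x)%R ->
    g (add_point x w, z) = g (w, z).
  by move=> Xx _ x0 zx; rewrite /g/= thin_past.
have := ae_finite_compensator P_PRM mg g0 g1 g_past fin.
apply: filterS => w.
have -> : \int[pm]_z g (w, z) = \sum_k conv (mark_mean k) (fun t => (L k (w, t))%:E) T.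
  transitivity (\int[pm]_x (mark_at x * cst 1 (ptime x) * (\1_thin (w, x))%:E)).
    by apply: eq_integral => x _; rewrite mule1.
  rewrite compensator//; apply: eq_bigr => k _.
  by apply: eq_integral => t _; rewrite mul1e.
move=> h k; apply: le_lt_trans h; rewrite (bigD1 k)//= leeDl// sume_ge0// => l _.
by apply: conv_ge0 => t; rewrite ?lee_fin// mark_mean_ge0.
Qed.

End Mark.

End Thinning.

Lemma integral_probability_cstD d (T : measurableType d) (R : realType)
    (P : probability T R) (c : \bar R) (f : T -> \bar R) :
  0 <= c -> measurable_fun setT f -> (forall w, 0 <= f w) ->
  \int[P]_w (c + f w) = c + \int[P]_w f w.
Proof.
move=> c0 mf f0.
rewrite (ge0_integralD P measurableT (f1 := cst c))//.
by rewrite integral_cst// [X in _ * X]probability_setT mule1.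
Qed.

(** * The renewal equation of the mean intensity *)

Section MeanIntensity.
Context {R : realType} {n : nat}.
Variables (nu : 'I_n.+1 -> probability R R) (P : probability (Omega R n) R).
Hypothesis P_PRM : is_PRM nu P.
Local Notation X := (Xset R n).
Local Notation Omega := (Omega R n).
Local Notation pm := (pmeas nu).
Local Notation leb := (@lebR R).
Local Notation ckern := (@ckern R n).

(** Tonelli for the indicator of the set where [C] is infinite exchanges the quantifiers over w and
    t. *)
Lemma ae_ae_finite (C : Omega * R -> \bar R) : measurable_fun setT C ->
  (forall t, {ae P, forall w, C (w, t) < +oo}) ->
  {ae P, forall w, {ae leb, forall t, C (w, t) < +oo}}.
Proof.
move=> mC Cfin; pose D := [set z | C z = +oo].
have mD : measurable D.
  by rewrite -[X in measurable X]setTI; exact: mC measurableT _ (emeasurable_set1 _).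
have mI : measurable_fun setT (fun z : Omega * R => (\1_D z : R)%:E).
  exact/measurable_EFinP/measurable_indic.
have I1 z : 0 <= (\1_D z : R)%:E by rewrite lee_fin.
have I0 : \int[P]_w \int[leb]_t (\1_D (w, t) : R)%:E = 0.
  rewrite (fubini_tonelli (m1 := P) (m2 := leb) _ mI I1).
  apply: integral0_eq => t _.
  rewrite (ae_eq_integral (cst 0)) ?integral0//.
    exact: (measurable_fun_pair1 t mI).
  apply: filterS (Cfin t) => w Cw _.
  by rewrite indicE memNset//= => CE; move: Cw; rewrite CE ltxx.
have := ge0_integral_eq0_ae
  (measurable_fun_fubini_tonelli_F (m2 := leb) _ mI I1)
  (fun w => integral_ge0 _ (fun t _ => I1 (w, t))) I0.
apply: filterS => w Iw.
have := ge0_integral_eq0_ae (measurable_fun_pair2 w mI) (fun t => I1 (w, t)) Iw.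
apply: filterS => t /eqP; rewrite eqe indicE pnatr_eq0 eqb0 => /negP.
rewrite inE /D/= => Ct; rewrite ltey; exact/eqP.
Qed.

Variable L : 'I_n.+1 -> Omega * R -> R.
Hypotheses (mL : forall k, measurable_fun setT (L k)) (L0 : forall k z, (0 <= L k z)%R).
Hypothesis L_neg : forall k w t, (t < 0)%R -> L k (w, t) = 0%R.
Hypothesis L_past : forall k, past_only (L k).

Variable a : 'I_n.+1 -> 'I_n.+1 -> R -> R -> \bar R.
Hypotheses (ma : forall i k, measurable_fun setT (fun z : R * R => a i k z.1 z.2))
  (a0 : forall i k u y, 0 <= a i k u y)
  (a_neg : forall i k u y, (u < 0)%R -> a i k u y = 0).

Variable b : 'I_n.+1 -> R -> \bar R.
Hypotheses (mb : forall i, measurable_fun setT (b i)) (b0 : forall i t, 0 <= b i t)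
  (b_neg : forall i t, (t < 0)%R -> b i t = 0).

Let kb i k := mark_mean nu (a i) k.

Hypothesis kb_int : forall i k, \int[leb]_t kb i k t < +oo.
Hypothesis L_eq : forall i t, (0 <= t)%R -> {ae P, forall w,
  (L i (w, t))%:E =
  b i t + \int[ckern w]_x (mark_at (a i) t x * (\1_(thin L) (w, x))%:E)}.

Let mkb i k : measurable_fun setT (kb i k).
Proof. exact: measurable_mark_mean. Qed.

Let kb0 i k t : 0 <= kb i k t.
Proof. exact: mark_mean_ge0. Qed.

Let kb_neg i k t : (t < 0)%R -> kb i k t = 0.
Proof. by move=> t0; apply: integral0_eq => y _; exact: a_neg. Qed.

(** Truncation makes the kernel bounded, as [ae_conv_finite] requires, without changing where it
    vanishes. *)
Let a1 i k u y := mine (a i k u y) 1.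

Let ma1 i k : measurable_fun setT (fun z : R * R => a1 i k z.1 z.2).
Proof. by apply: measurable_mine => //; exact: ma. Qed.

Let a10 i k u y : 0 <= a1 i k u y.
Proof. by rewrite le_min a0/=. Qed.

Let fb i k := mark_mean nu (a1 i) k.

Let mfb i k : measurable_fun setT (fb i k).
Proof. exact: measurable_mark_mean. Qed.

Let fb0 i k t : 0 <= fb i k t.
Proof. exact: mark_mean_ge0. Qed.

Let fb_neg i k t : (t < 0)%R -> fb i k t = 0.
Proof. by move=> t0; apply: integral0_eq => y _; rewrite /a1 a_neg//; apply/min_idPl. Qed.

Let fb1 i k t : fb i k t <= 1.
Proof.
apply: (@le_trans _ _ (\int[nu k]_(y in `[0%R, +oo[) cst 1 y)).
  apply: ge0_le_integral => //.
  - exact: measurable_funTS (measurable_fun_pair2 t (ma1 i k)).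
  - by move=> y _; rewrite /a1 ge_min lexx orbT.
by rewrite integral_cst// mul1e probability_le1.
Qed.

Let kb_eq0 i k : \int[leb]_t fb i k t = 0 -> \int[leb]_t kb i k t = 0.
Proof.
move=> I0; rewrite (ae_eq_integral (cst 0)) ?integral0//.
apply: filterS (ge0_integral_eq0_ae (mfb i k) (fb0 i k) I0) => t ft0 _.
pose c y : \bar R := (\1_(`[0%R, +oo[%classic : set R) y)%:E.
have mc : measurable_fun setT c by exact/measurable_EFinP/measurable_indic.
have E (u : R -> \bar R) :
    \int[nu k]_(y in `[0%R, +oo[) u y = \int[nu k]_y (u y * c y).
  rewrite integral_mkcond; apply: eq_integral => y _.
  by rewrite patchE /c indicE; case: (_ \in _); rewrite ?mule1 ?mule0.
move: ft0; rewrite /fb /kb /mark_mean !E => ft0.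
have m1 := measurable_fun_pair2 t (ma1 i k).
have := ge0_integral_eq0_ae (emeasurable_funM m1 mc) _ ft0.
case/(_ _)/wrap => [y|]; first by rewrite mule_ge0// lee_fin.
move=> ac; rewrite (ae_eq_integral (cst 0)) ?integral0//.
  by apply: emeasurable_funM => //; exact: (measurable_fun_pair2 t (ma i k)).
apply: filterS ac => y /eqP; rewrite mule_eq0 => /orP[|/eqP -> _]; last by rewrite mule0.
rewrite /a1; case: (leP (a i k t y) 1) => _ /eqP; first by move=> -> _; rewrite mul0e.
by move=> /eqP; rewrite eqe oner_eq0.
Qed.

(* Outside [J] the mean kernels [kb _ k] vanish a.e., so the [k]-th intensity need
   not be locally integrable, but it does not act on the others either. *)
Let J k := [exists i, 0 < \int[leb]_t fb i k t].

Let kb_notJ i k : ~~ J k -> \int[leb]_t kb i k t = 0.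
Proof.
rewrite negb_exists => /forallP /(_ i); rewrite -leNgt => f_le0.
by apply: kb_eq0; apply/eqP; rewrite eq_le f_le0 integral_ge0.
Qed.

Let mthinw w : measurable_fun setT (fun x => (\1_(thin L) (w, x) : R)%:E).
Proof.
apply/measurable_EFinP.
exact: measurable_fun_pair2 w (measurable_indic (measurable_thin mL)).
Qed.

(** At a fixed t the equation bounds the thinned sum by the finite number [L i (w, t)], so the
    convolution of [fb i k] with [L k] is a.s. finite at t. Exchanging quantifiers makes it finite
    at almost every t, as [conv_locally_finite] requires. *)
Let ae_locint : {ae P, forall w, forall k, J k -> forall t0,
  \int[leb]_(s in [set s | (s <= t0)%R]) (L k (w, s))%:E < +oo}.
Proof.
apply: filter_forall => k; have [Jk|nJk] := boolP (J k); last exact: aeW.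
move/existsP: Jk => [i fpos].
have mEL w : measurable_fun setT (fun t => (L k (w, t))%:E).
  by apply/measurable_EFinP; exact: (measurable_fun_pair2 w (mL k)).
pose C (z : Omega * R) := conv (fb i k) (fun t => (L k (z.1, t))%:E) z.2.
have mC : measurable_fun setT C.
  apply: (measurable_fun_fubini_tonelli_F (m2 := leb)
    (fun z : (Omega * R) * R => fb i k (z.1.2 - z.2)%R * (L k (z.1.1, z.2))%:E)).
    apply: emeasurable_funM.
      apply: (measurableT_comp (mfb i k)); apply: measurable_funB => //.
      by apply: (measurableT_comp (f := snd)) => //; exact: measurable_fst.
    apply/measurable_EFinP/(measurableT_comp (mL k)); apply: measurable_fun_pair => //.
    by apply: (measurableT_comp (f := fst)) => //; exact: measurable_fst.
  by move=> z; rewrite mule_ge0// lee_fin.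
have Cfin t : {ae P, forall w, C (w, t) < +oo}.
  have [t0|t0] := ltP t 0%R.
    apply: aeW => w; rewrite /C /conv integral0_eq// => s _.
    have [s0|s0] := ltP s 0%R; first by rewrite L_neg// mule0.
    by rewrite /= fb_neg ?mul0e//; lra.
  have := ae_conv_finite P_PRM mL L0 L_neg L_past (ma1 i) (a10 i) (T := t).
  case/(_ _ _)/wrap => [k' u y||].
  - by rewrite /a1 ge_min lexx orbT.
  - apply: filterS (L_eq i t0) => w Lw.
    apply: le_lt_trans (ltry (L i (w, t))); rewrite Lw.
    apply: (@le_trans _ _ (\int[ckern w]_x (mark_at (a i) t x * (\1_(thin L) (w, x))%:E))).
      apply: ge0_le_integral; first exact: measurableT.
      - by move=> x _; rewrite mule_ge0 ?lee_fin// /mark_at a10.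
      - by apply: emeasurable_funM; [exact: measurable_mark_at|exact: mthinw].
      - by apply: emeasurable_funM; [exact: measurable_mark_at|exact: mthinw].
      - move=> x _; rewrite lee_wpmul2r ?lee_fin// /mark_at /a1.
        by rewrite ge_min lexx.
    by rewrite leeDr.
  - by apply: filterS => w /(_ k).
apply: filterS (ae_ae_finite mC Cfin) => w Cw _ t0.
apply: (conv_locally_finite (f := fb i k)) => //.
- by move=> t; rewrite lee_fin.
- by move=> t; exact: fb_neg.
- by move=> t ?; rewrite L_neg.
Qed.

Let f (z : Omega * R) : \bar R := \sum_(k | J k) (L k z)%:E.

Let mf : measurable_fun setT f.
Proof.
rewrite /f; under eq_fun do rewrite big_mkcond.
apply: emeasurable_sum => k; case: (J k) => //; exact/measurable_EFinP.
Qed.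

Let f0 z : 0 <= f z.
Proof. by apply: sume_ge0 => k _; rewrite lee_fin. Qed.

(** The localizing clock. Only coordinates in [J] enter it, those known to be locally integrable. *)
Let Lam (z : Omega * R) : \bar R := \int[leb]_(s in [set s | (s <= z.2)%R]) f (z.1, s).

Let mLam : measurable_fun setT Lam.
Proof.
pose F (u : (Omega * R) * R) := f (u.1.1, u.2) *
  (\1_[set u : (Omega * R) * R | (u.2 <= u.1.2)%R] u)%:E.
rewrite (_ : Lam = fun z => \int[leb]_s F (z, s)).
  apply: (measurable_fun_fubini_tonelli_F (m2 := leb) F).
    apply: emeasurable_funM.
      apply: (measurableT_comp mf); apply: measurable_fun_pair => //.
      by apply: (measurableT_comp (f := fst)) => //; exact: measurable_fst.
    apply/measurable_EFinP/measurable_indic/measurable_le_fun => //.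
    by apply: (measurableT_comp (f := snd)) => //; exact: measurable_fst.
  by move=> u; rewrite mule_ge0// lee_fin.
apply/funext => z; rewrite /Lam integral_mkcond; apply: eq_integral => s _.
rewrite patchE /F indicE/=; have [sz|sz] := boolP (s \in _).
  by rewrite mem_set ?mule1//; move: sz; rewrite inE.
by rewrite memNset ?mule0//; move: sz; rewrite notin_setE.
Qed.

Let le_Lam w s t : (s <= t)%R -> Lam (w, s) <= Lam (w, t).
Proof.
move=> st; apply: ge0_subset_integral => //.
- exact: measurable_le_fun.
- exact: measurable_le_fun.
- exact: measurable_funTS (measurable_fun_pair2 w mf).
- by move=> u /= us; exact: le_trans st.
Qed.

Let cut (K : nat) : set (Omega * R) := [set z | Lam z <= K%:R%:E].
Let H K (z : Omega * R) : \bar R := (\1_(cut K) z)%:E.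

Let mH K : measurable_fun setT (H K).
Proof. by apply/measurable_EFinP/measurable_indic; exact: measurable_lee_cst. Qed.

Let H0 K z : 0 <= H K z. Proof. by rewrite lee_fin. Qed.

Let H_past K : past_only (H K).
Proof.
move=> x w t Xx x0 tx; rewrite /H !indicE; congr ((nat_of_bool _)%:R)%:E.
suff E : Lam (add_point x w, t) = Lam (w, t).
  by apply/idP/idP; rewrite !inE /cut/= E.
apply: eq_integral => s; rewrite inE/= => st; apply: eq_bigr => k _.
by rewrite L_past//; exact: le_trans tx.
Qed.

Let le_H K w s t : (s <= t)%R -> H K (w, t) <= H K (w, s).
Proof.
move=> st; rewrite lee_fin !indicE; have [|_] := boolP ((w, t) \in _); last by rewrite ler_nat.
rewrite inE/= => tK; rewrite mem_set//; exact: le_trans (le_Lam w st) tK.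
Qed.

Let h K k t := \int[P]_w (H K (w, t) * (L k (w, t))%:E).

Let mHL K k : measurable_fun setT (fun z : Omega * R => H K z * (L k z)%:E).
Proof. by apply: emeasurable_funM => //; exact/measurable_EFinP. Qed.

Let HL0 K k z : 0 <= H K z * (L k z)%:E.
Proof. by rewrite mule_ge0// lee_fin. Qed.

Let mh K k : measurable_fun setT (h K k).
Proof. exact: (measurable_fun_fubini_tonelli_G (m1 := P) _ (mHL K k)). Qed.

Let h0 K k t : 0 <= h K k t. Proof. exact: integral_ge0. Qed.

Let h_neg K k t : (t < 0)%R -> h K k t = 0.
Proof. by move=> t0; apply: integral0_eq => w _; rewrite L_neg// mule0. Qed.

(** The clock does not control [h K k] for k outside [J]; replacing it by 0 gives integrability and
    does not change the convolution with [kb]. *)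
Let q K k t : \bar R := if J k then h K k t else 0.

Let mq K k : measurable_fun setT (q K k).
Proof. by rewrite /q; case: (J k). Qed.

Let q0 K k t : 0 <= q K k t. Proof. by rewrite /q; case: ifP. Qed.

(** Up to the cut the accumulated intensity is at most [K], by [integral_cut_le]; then take
    expectations. *)
Let q_int K k : \int[leb]_t q K k t < +oo.
Proof.
rewrite /q; have [Jk|_] := boolP (J k); last by rewrite integral0.
apply: le_lt_trans (ltry K%:R%R).
rewrite /h -(fubini_tonelli (m1 := P) (m2 := leb) _ (mHL K k) (HL0 K k)).
apply: (@le_trans _ _ (\int[P]_w cst K%:R%:E w)); last first.
  by rewrite integral_cst// [X in _ * X]probability_setT mule1.
apply: ge0_le_integral.
- exact: measurableT.
- by move=> w _; exact: integral_ge0.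
- exact: (measurable_fun_fubini_tonelli_F (m2 := leb) _ (mHL K k)).
- exact: measurable_cst.
move=> w _.
have mfw : measurable_fun setT (fun t => f (w, t)) by exact: (measurable_fun_pair2 w mf).
apply: le_trans (integral_cut_le leb (tau := id) (@measurable_id _ _ _) mfw
  (fun t => f0 (w, t)) (K := K%:R%:E) _); last by rewrite lee_fin.
rewrite [leRHS]integral_mkcond; apply: ge0_le_integral => //.
- exact: (measurable_fun_pair2 w (mHL K k)).
- have mc := measurable_lee_cst K%:R%:E (measurable_fun_pair2 w mLam).
  apply/(measurable_restrictT _ mc); exact: measurable_funTS.
move=> t _; rewrite patchE /H indicE; have [tK|tK] := boolP ((w, t) \in _); last first.
  by rewrite mul0e; case: ifP.
rewrite mul1e ifT; first by rewrite /f (bigD1 k)//= leeDl// sume_ge0// => l _; rewrite lee_fin.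
by move: tK; rewrite !inE.
Qed.

(** [H K] is nonincreasing in time, so in the sum over the points before t its value at t may be
    replaced by its value at each point; [E_thinned] then applies. *)
Let h_le K i t : h K i t <= b i t + mconv kb (h K) i t.
Proof.
have [t0|t0] := ltP t 0%R.
  by rewrite h_neg// adde_ge0// mconv_ge0.
pose F w x := mark_at (a i) t x * H K (w, ptime x) * (\1_(thin L) (w, x))%:E.
have mF : measurable_fun setT (fun z : Omega * pt R n => F z.1 z.2).
  apply: emeasurable_funM; last first.
    by apply/measurable_EFinP; exact: (measurable_indic (measurable_thin mL)).
  apply: emeasurable_funM; first exact: (measurableT_comp (measurable_mark_at (ma i) t)).
  apply: (measurableT_comp (mH K)); apply: measurable_fun_pair => //.
  exact: (measurableT_comp (@measurable_ptime R n)).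
have F0 w x : 0 <= F w x by rewrite !mule_ge0// ?lee_fin// /mark_at a0.
have mI : measurable_fun setT (fun w => \int[ckern w]_x F w x).
  by apply: (measurable_ckern_param (g := id) (F := fun z => F z.1 z.2)) => //;
    exact: measurable_id.
rewrite /mconv -(E_thinned P_PRM mL L0 L_neg L_past (ma i) (a0 i) t (mH K) (H0 K) (@H_past K)).
rewrite -(integral_probability_cstD P (b0 i t) mI); last first.
  by move=> w; exact: integral_ge0.
apply: ae_ge0_le_integral => //.
- exact: (measurable_fun_pair1 t (mHL K i)).
- by move=> w _; rewrite adde_ge0//; exact: integral_ge0.
- exact: emeasurable_funD.
apply: filterS (L_eq i t0) => w -> _.
have mM : measurable_fun setT (fun x => mark_at (a i) t x * (\1_(thin L) (w, x))%:E).
  by apply: emeasurable_funM; [exact: measurable_mark_at|exact: mthinw].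
have M0 x : 0 <= mark_at (a i) t x * (\1_(thin L) (w, x))%:E.
  by rewrite mule_ge0 ?lee_fin// /mark_at a0.
rewrite ge0_muleDr//; last exact: integral_ge0.
apply: leeD.
  rewrite -[leRHS]mul1e; apply: lee_wpmul2r; first exact: b0.
  by rewrite lee_fin indicE; case: (_ \in _).
rewrite -ge0_integralZl//.
apply: ge0_le_integral => //.
- by move=> x _; rewrite mule_ge0.
- exact: emeasurable_funM.
- exact: (measurable_fun_pair2 w mF).
move=> x _; rewrite /F muleAC muleC.
have [xt|tx] := leP (ptime x) t; first by rewrite lee_wpmul2l// le_H.
by rewrite /mark_at a_neg ?mul0e//; lra.
Qed.

Let h_le_q K i t : h K i t <= b i t + mconv kb (q K) i t.
Proof.
suff -> : mconv kb (q K) i t = mconv kb (h K) i t by exact: h_le.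
apply: eq_bigr => k _; rewrite /q; have [//|nJ] := boolP (J k).
by rewrite !conv_eq0//; exact: kb_notJ.
Qed.

(** [renewal_le] bounds [q] only almost everywhere; inserting this bound under the convolution in
    [h_le_q] and using [renewal_fixed] gives every t. *)
Let h_bound K i t : h K i t <= b i t + mconv (Kpsi kb) b i t.
Proof.
have q_le k s : q K k s <= b k s + mconv kb (q K) k s.
  rewrite {1}/q; case: (J k); first exact: h_le_q.
  by rewrite adde_ge0// mconv_ge0.
have := renewal_le mkb kb0 mb b0 kb_neg kb_int (mq K) (q0 K) _ (q_int K) q_le.
case/(_ _)/wrap => [k s s0|q_ae]; first by rewrite /q h_neg// if_same.
apply: le_trans (h_le_q K i t) _; rewrite leeD2l//.
rewrite -(renewal_fixed mkb kb0 mb b0).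
apply: lee_sum => k _; apply: ae_ge0_le_integral => //.
- by move=> s _; rewrite mule_ge0.
- apply: emeasurable_funM => //; apply: (measurableT_comp (mkb i k)).
  exact: measurable_funB.
- by move=> s _; rewrite mule_ge0// adde_ge0// mconv_ge0// => *; exact: Kpsi_ge0.
- apply: emeasurable_funM; first by apply: (measurableT_comp (mkb i k)); exact: measurable_funB.
  apply: emeasurable_funD => //; apply: measurable_mconv => // *;
    by [exact: measurable_Kpsi|exact: Kpsi_ge0].
by apply: filterS (q_ae k) => s qs _; rewrite lee_wpmul2l.
Qed.

Let ae_Lam t : {ae P, forall w, Lam (w, t) < +oo}.
Proof.
apply: filterS ae_locint => w Lw; rewrite /Lam /f.
under eq_integral do rewrite big_mkcond/=.
rewrite ge0_integral_sum.
- apply: lte_sum_pinfty => k _; have [Jk|_] := boolP (J k); first exact: Lw.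
  by rewrite integral0.
- exact: measurable_le_fun.
- move=> k; case: (J k) => //; apply/measurable_EFinP/measurable_funTS.
  exact: (measurable_fun_pair2 w (mL k)).
- by move=> k s _; case: (J k); rewrite lee_fin.
Qed.

(** Monotone convergence in [K]: the clock is a.s. finite at t, so [H K (w, t)] is eventually 1. *)
Let mean_le i t : \int[P]_w (L i (w, t))%:E <= b i t + mconv (Kpsi kb) b i t.
Proof.
pose g K w := H K (w, t) * (L i (w, t))%:E.
have mg K : measurable_fun setT (g K) by exact: (measurable_fun_pair1 t (mHL K i)).
have g0 K w : setT w -> 0 <= g K w by move=> _; exact: HL0.
have nd_g w : setT w -> {homo g^~ w : K M / (K <= M)%N >-> K <= M}.
  move=> _ K M KM; rewrite /g lee_wpmul2r ?lee_fin// !indicE.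
  have [|_] := boolP ((w, t) \in cut K); last by rewrite ler_nat.
  rewrite inE/= => wK; rewrite mem_set//; apply: le_trans wK _.
  by rewrite lee_fin ler_nat.
have g_lim : {ae P, forall w, setT w -> (L i (w, t))%:E = limn (g^~ w)}.
  apply: filterS (ae_Lam t) => w Lw _; apply/esym/cvg_lim => //.
  apply: cvg_near_cst; exists (Num.truncn (fine (Lam (w, t)))).+1 => // K /= tK.
  rewrite /g /H indicE mem_set ?mul1e// /cut/=.
  have Lf : Lam (w, t) \is a fin_num by rewrite ge0_fin_numE// integral_ge0.
  rewrite -[leLHS]fineK// lee_fin; apply/ltW/(lt_le_trans (truncnS_gt _)).
  by rewrite ler_nat.
rewrite (ae_eq_integral (fun w => limn (g^~ w)))//; last 2 first.
- by apply/measurable_EFinP; exact: (measurable_fun_pair1 t (mL i)).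
- apply: (emeasurable_fun_cvg g _ mg) => w Tw.
  by apply: ereal_nondecreasing_is_cvgn; exact: nd_g.
rewrite (monotone_convergence _ measurableT mg g0 nd_g); apply: lime_le.
  apply: ereal_nondecreasing_is_cvgn => K M KM.
  by apply: ge0_le_integral => // w _; [exact: g0|exact: nd_g].
by apply: nearW => K; exact: h_bound.
Qed.

(** For the lower bound, the expectation of the equation shows that the mean solves the renewal
    equation, possibly with infinite values, and [renewal_ge] allows these. *)
Lemma mean_intensity i t :
  \int[P]_w (L i (w, t))%:E = b i t + mconv (Kpsi kb) b i t.
Proof.
apply/eqP; rewrite eq_le mean_le/=.
pose m k s := \int[P]_w (L k (w, s))%:E.
have mLE k : measurable_fun setT (fun z => (L k z)%:E) by exact/measurable_EFinP.
have LE0 k z : 0 <= (L k z)%:E by rewrite lee_fin.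
have mm k : measurable_fun setT (m k).
  exact: (measurable_fun_fubini_tonelli_G (m1 := P) _ (mLE k)).
have m0 k s : 0 <= m k s by exact: integral_ge0.
apply: (renewal_ge mkb kb0 mb b0 mm m0) => {}i {}t.
have [t0|t0] := ltP t 0%R.
  rewrite b_neg// add0e /mconv big1// => k _; apply: integral0_eq => s _.
  have [s0|s0] := ltP s 0%R.
    by rewrite /m integral0_eq ?mule0// => w _; rewrite L_neg.
  by rewrite kb_neg ?mul0e//; lra.
have mI : measurable_fun setT (fun w => \int[ckern w]_x
    (mark_at (a i) t x * (\1_(thin L) (w, x))%:E)).
  apply: (measurable_ckern_param (g := id)
    (F := fun z => mark_at (a i) t z.2 * (\1_(thin L) z)%:E)).
  - exact: measurable_id.
  - apply: emeasurable_funM; first exact: (measurableT_comp (measurable_mark_at (ma i) t)).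
    by apply/measurable_EFinP; exact: (measurable_indic (measurable_thin mL)).
  - by move=> z; rewrite mule_ge0 ?lee_fin// /mark_at a0.
have I0 w : 0 <= \int[ckern w]_x (mark_at (a i) t x * (\1_(thin L) (w, x))%:E).
  by apply: integral_ge0 => x _; rewrite mule_ge0 ?lee_fin// /mark_at a0.
rewrite [leRHS](ae_eq_integral (fun w => b i t +
  \int[ckern w]_x (mark_at (a i) t x * (\1_(thin L) (w, x))%:E)))//; last 3 first.
- exact: (measurable_fun_pair1 t (mLE i)).
- exact: emeasurable_funD.
- by apply: filterS (L_eq i t0) => w Lw _; exact: Lw.
rewrite integral_probability_cstD// leeD2l// le_eqVlt; apply/orP; left; apply/eqP.
have := E_thinned P_PRM mL L0 L_neg L_past (ma i) (a0 i) t (measurable_cst 1)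
  (fun z => lee01) (fun x w s _ _ _ => erefl).
under eq_integral do under eq_integral do rewrite mule1.
move=> ->; apply: eq_bigr => k _; apply: eq_integral => s _; congr (_ * _).
by apply: eq_integral => w _; rewrite mul1e.
Qed.

Lemma mean_thinned (z : 'I_n.+1 -> R -> R -> \bar R) T :
  (forall k, measurable_fun setT (fun u : R * R => z k u.1 u.2)) ->
  (forall k u y, 0 <= z k u y) ->
  \int[P]_w \int[ckern w]_x (mark_at z T x * (\1_(thin L) (w, x))%:E) =
  \sum_k conv (mark_mean nu z k) (fun t => b k t + mconv (Kpsi kb) b k t) T.
Proof.
move=> mz z0.
have := E_thinned P_PRM mL L0 L_neg L_past mz z0 T (measurable_cst 1)
  (fun z => lee01) (fun x w s _ _ _ => erefl).
under eq_integral do under eq_integral do rewrite mule1.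
move=> ->; apply: eq_bigr => k _; apply: eq_integral => s _; congr (_ * _).
by rewrite -mean_intensity; apply: eq_integral => w _; rewrite mul1e.
Qed.

End MeanIntensity.

(** * The mean of the process and its shift *)

(** The supports confine the convolution to [[t0, t]]; here t0 will be 0 or the time of an added
    point. *)
Lemma sum_conv_cc (R : realType) (I : finType) (f g : I -> R -> \bar R) (t0 t : R) :
  (forall l, measurable_fun setT (f l)) -> (forall l, measurable_fun setT (g l)) ->
  (forall l u, 0 <= f l u) -> (forall l u, 0 <= g l u) ->
  (forall l u, (u < 0)%R -> f l u = 0) -> (forall l u, (u < t0)%R -> g l u = 0) ->
  \sum_l conv (f l) (g l) t =
  \int[@lebesgue_measure R]_(s in `[t0, t]) \sum_l f l (t - s)%R * g l s.
Proof.
move=> mf mg f0 g0 f_neg g_neg.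
rewrite integral_lebR integral_mkcond /conv -ge0_integral_sum//; last 2 first.
- move=> l; apply: emeasurable_funM => //; apply: (measurableT_comp (mf l)).
  exact: measurable_funB.
- by move=> l s _; rewrite mule_ge0.
apply: eq_integral => s _; rewrite patchE; case: ifPn => //.
rewrite notin_setE/= in_itv/= => /negP; rewrite negb_and -!ltNge => sE.
apply: big1 => l _; case/orP: sE => sE; first by rewrite g_neg// mule0.
by rewrite f_neg ?mul0e//; lra.
Qed.

(** * Back to the kernels of the statement *)

Section Kernels.
Context {R : realType} {n : nat}.
Variable nu : 'I_n.+1 -> probability R R.
Local Notation leb := (@lebR R).

(** Values of a kernel off the quadrant are arbitrary; setting them to 0 gives a nonnegative
    measurable function on the plane and builds the restriction to times at most T into the
    integrand. *)
Definition ext_kernel (zeta : R -> R -> 'M[R]_n.+1) (i k : 'I_n.+1) (t y : R) : \bar R :=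
  if (0 <= t)%R && (0 <= y)%R then (zeta t y i k)%:E else 0.

Lemma ext_kernelE zeta i k t y : (0 <= t)%R -> (0 <= y)%R ->
  ext_kernel zeta i k t y = (zeta t y i k)%:E.
Proof. by rewrite /ext_kernel => -> ->. Qed.

Lemma ext_kernel_neg zeta i k t y : (t < 0)%R -> ext_kernel zeta i k t y = 0.
Proof. by rewrite /ext_kernel leNgt => ->. Qed.

Section Extension.
Variable zeta : R -> R -> 'M[R]_n.+1.
Hypothesis zeta_ker : is_kernel nu zeta.

Lemma ext_kernel_ge0 i k t y : 0 <= ext_kernel zeta i k t y.
Proof.
rewrite /ext_kernel; case: ifP => // /andP[t0 y0]; rewrite lee_fin.
by have [_ z0 _] := zeta_ker i k; exact: z0.
Qed.

Lemma measurable_ext_kernel i k :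
  measurable_fun setT (fun z : R * R => ext_kernel zeta i k z.1 z.2).
Proof.
have [mz _ _] := zeta_ker i k.
pose D := [set z : R * R | (0 <= z.1)%R /\ (0 <= z.2)%R].
have mD : measurable D.
  rewrite (_ : D = [set z : R * R | (0 <= z.1)%R] `&` [set z : R * R | (0 <= z.2)%R])//.
  by apply: measurableI; apply: measurable_le_fun.
rewrite (_ : (fun z => _) = (fun z : R * R => (zeta z.1 z.2 i k)%:E) \_ D).
  by apply/(measurable_restrictT _ mD)/measurable_EFinP.
apply/funext => z; rewrite patchE /ext_kernel; congr (if _ then _ else _).
by apply/idP/idP; rewrite inE; [move=> /andP|move=> [-> ->]].
Qed.

Lemma mark_mean_kbar i k t : (0 <= t)%R ->
  mark_mean nu (ext_kernel zeta i) k t = kbar nu zeta i k t.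
Proof.
move=> t0; apply: eq_integral => y; rewrite inE/= in_itv/= andbT => y0.
exact: ext_kernelE.
Qed.

Lemma mark_mean_neg i k t : (t < 0)%R -> mark_mean nu (ext_kernel zeta i) k t = 0.
Proof. by move=> t0; apply: integral0_eq => y _; exact: ext_kernel_neg. Qed.

End Extension.

Variables zeta phi : R -> R -> 'M[R]_n.+1.
Hypotheses (zeta_ker : is_kernel nu zeta) (phi_ker : is_kernel nu phi).

Let K i k := mark_mean nu (ext_kernel phi i) k.
Let Z i k := mark_mean nu (ext_kernel zeta i) k.

Let mK i k : measurable_fun setT (K i k).
Proof. by apply: measurable_mark_mean => ? *; [exact: measurable_ext_kernel|exact: ext_kernel_ge0]. Qed.

Let mZ i k : measurable_fun setT (Z i k).
Proof. by apply: measurable_mark_mean => ? *; [exact: measurable_ext_kernel|exact: ext_kernel_ge0]. Qed.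

Let K0 i k t : 0 <= K i k t.
Proof. by apply: mark_mean_ge0 => *; exact: ext_kernel_ge0. Qed.

Let Z0 i k t : 0 <= Z i k t.
Proof. by apply: mark_mean_ge0 => *; exact: ext_kernel_ge0. Qed.

Lemma mark_mean_integrable : non_explosive nu phi ->
  forall i k, \int[leb]_t mark_mean nu (ext_kernel phi i) k t < +oo.
Proof.
move=> [fin _] i k; have := fin i k; rewrite integral_lebR integral_mkcond.
congr (_ < _); apply: eq_integral => t _; rewrite patchE.
case: ifPn => [|]; first by rewrite inE/= in_itv/= andbT => t0; rewrite mark_mean_kbar.
rewrite notin_setE/= in_itv/= andbT => /negP; rewrite -ltNge => t0.
by rewrite mark_mean_neg.
Qed.

Lemma Kpow_neg m i k t : (t < 0)%R -> Kpow K m i k t = 0.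
Proof.
elim: m i k t => [|m IHm] i k t t0 /=; first exact: mark_mean_neg.
apply: big1 => l _; apply: integral0_eq => s _.
have [s0|s0] := ltP s 0%R; first by rewrite IHm ?mule0.
by rewrite /K mark_mean_neg ?mul0e//; lra.
Qed.

Lemma Kpow_phibar m i k t : (0 <= t)%R -> Kpow K m i k t = phibar nu phi m i k t.
Proof.
elim: m i k t => [|m IHm] i k t t0 /=; first exact: mark_mean_kbar.
rewrite (sum_conv_cc (f := K i) (g := fun l => Kpow K m l k) (t0 := 0%R) t)//.
- apply: eq_integral => s; rewrite inE/= in_itv/= => /andP[s0 st].
  by apply: eq_bigr => l _; rewrite IHm// /K mark_mean_kbar// subr_ge0.
- by move=> l; exact: measurable_Kpow.
- by move=> l u; exact: Kpow_ge0.
- by move=> l u; exact: mark_mean_neg.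
- by move=> l u; exact: Kpow_neg.
Qed.

Lemma Kpsi_neg i k t : (t < 0)%R -> Kpsi K i k t = 0.
Proof. by move=> t0; rewrite /Kpsi eseries0// => m _ _; exact: Kpow_neg. Qed.

Lemma Kpsi_Psibar i k t : (0 <= t)%R -> Kpsi K i k t = Psibar nu phi i k t.
Proof. by move=> t0; apply: eq_eseriesr => m _; exact: Kpow_phibar. Qed.

(* Mean of the [i]-th component at time [T] of the process with baseline [g]. *)
Definition response (g : 'I_n.+1 -> R -> \bar R) i T : \bar R :=
  \sum_k conv (Z i k) (fun v => g k v + mconv (Kpsi K) g k v) T.

Lemma responseE g (t0 : R) i T : (forall k, measurable_fun setT (g k)) ->
  (forall k v, 0 <= g k v) -> (forall k v, (v < t0)%R -> g k v = 0) ->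
  response g i T = \int[lebesgue_measure]_(v in `[t0, T]) \sum_(k < n.+1)
      kbar nu zeta i k (T - v)%R *
      (g k v + \int[lebesgue_measure]_(w in `[t0, v]) \sum_(l < n.+1)
         Psibar nu phi k l (v - w)%R * g l w).
Proof.
move=> mg g0 g_neg.
have mpsi k l : measurable_fun setT (Kpsi K k l) by exact: measurable_Kpsi.
have psi0 k l u : 0 <= Kpsi K k l u by exact: Kpsi_ge0.
have psi_neg k l u : (u < 0)%R -> Kpsi K k l u = 0 by exact: Kpsi_neg.
rewrite /response (sum_conv_cc (f := Z i)
  (g := fun k v => g k v + mconv (Kpsi K) g k v) (t0 := t0))//.
- apply: eq_integral => v; rewrite inE/= in_itv/= => /andP[v0 vT].
  apply: eq_bigr => k _; rewrite /Z mark_mean_kbar ?subr_ge0//.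
  congr (_ * (_ + _)); rewrite /mconv (sum_conv_cc (t0 := t0))//; last exact: psi_neg.
  apply: eq_integral => w; rewrite inE/= in_itv/= => /andP[w0 wv].
  by apply: eq_bigr => l _; rewrite Kpsi_Psibar// subr_ge0.
- by move=> k; apply: emeasurable_funD => //; exact: measurable_mconv.
- by move=> k v; rewrite adde_ge0// mconv_ge0.
- by move=> k u; exact: mark_mean_neg.
- move=> k u u0; rewrite g_neg// add0e /mconv big1// => l _.
  apply: integral0_eq => s _; have [s0|s0] := ltP s t0; first by rewrite g_neg ?mule0.
  by rewrite psi_neg ?mul0e//; lra.
Qed.

Lemma responseD g h i T : (forall k, measurable_fun setT (g k)) ->
  (forall k, measurable_fun setT (h k)) ->
  (forall k v, 0 <= g k v) -> (forall k v, 0 <= h k v) ->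
  response (fun k => g k \+ h k) i T = response g i T + response h i T.
Proof.
move=> mg mh g0 h0.
have mpsi k l : measurable_fun setT (Kpsi K k l) by exact: measurable_Kpsi.
have psi0 k l u : 0 <= Kpsi K k l u by exact: Kpsi_ge0.
rewrite /response -big_split/=; apply: eq_bigr => k _.
have mB u : (forall k, measurable_fun setT (u k)) -> (forall k v, 0 <= u k v) ->
    measurable_fun setT (u k \+ mconv (Kpsi K) u k).
  by move=> mu u0; apply: emeasurable_funD => //; exact: measurable_mconv.
have B0 u v : (forall k v, 0 <= u k v) -> 0 <= u k v + mconv (Kpsi K) u k v.
  by move=> u0; rewrite adde_ge0// mconv_ge0.
rewrite -convDr//; last 4 first.
- exact: mB.
- exact: mB.
- by move=> v; exact: B0.
- by move=> v; exact: B0.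
by apply: eq_integral => v _; congr (_ * _); rewrite /= mconvD// addeACA.
Qed.

Lemma response_sum (J : Type) (s : seq J) (g : J -> 'I_n.+1 -> R -> \bar R) i T :
  (forall j k, measurable_fun setT (g j k)) -> (forall j k v, 0 <= g j k v) ->
  response (fun k v => \sum_(j <- s) g j k v) i T = \sum_(j <- s) response (g j) i T.
Proof.
move=> mg g0; elim: s => [|j s IHs].
  rewrite big_nil /response big1// => k _; apply: integral0_eq => v _.
  rewrite big_nil add0e /mconv big1 ?mule0// => l _.
  by apply: integral0_eq => w _; rewrite big_nil mule0.
have mS k : measurable_fun setT (fun v => \sum_(j <- s) g j k v).
  by apply: emeasurable_sum => l; exact: mg.
have S0 k v : 0 <= \sum_(j <- s) g j k v by apply: sume_ge0 => l _; exact: g0.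
rewrite big_cons -IHs -(responseD i T (mg j) mS (g0 j) S0).
congr (response _ i T); apply/funext => k; apply/funext => v.
by rewrite big_cons.
Qed.

End Kernels.

(** * The process on the shifted configuration *)

Section ShiftedProcess.
Context {R : realType} {n : nat}.
Local Notation X := (Xset R n).
Local Notation Omega := (Omega R n).

Lemma ge0_integral_eps_plus p (x : 'I_p -> pt R n) (w : Omega) (F : pt R n -> \bar R) :
  (forall j, X (x j)) -> measurable_fun setT F -> (forall z, 0 <= F z) ->
  \int[N (eps_plus x w)]_z F z = \int[N w]_z F z + \sum_(j < p) F (x j).
Proof.
move=> Xx mF F0; rewrite /eps_plus -[in RHS]big_enum/=.
elim: (enum 'I_p) => [|j s IHs] /=; first by rewrite big_nil adde0.
set v := foldr _ _ _ in IHs *.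
rewrite (eq_measure_integral (measure_add (N v) (\d_(x j) : {measure set (pt R n) -> \bar R}))).
  rewrite ge0_integral_measure_add// integral_dirac// diracT mul1e IHs.
  by rewrite big_cons -addeA; congr (_ + _); rewrite addeC.
by move=> A mA _; rewrite N_add_point//; exact/esym/measure_addE.
Qed.

Lemma eps_plus0 (x : 'I_0 -> pt R n) (w : Omega) : eps_plus x w = w.
Proof. by rewrite /eps_plus; case: (enum 'I_0) => // -[]. Qed.

Lemma integral_N_Xset (w : Omega) (F : pt R n -> \bar R) D : measurable D ->
  measurable_fun setT F -> (forall z, 0 <= F z) -> (forall z, X z -> ~ D z -> F z = 0) ->
  \int[N w]_(z in D) F z = \int[N w]_z F z.
Proof.
move=> mD mF F0 FD; rewrite integral_mkcond.
apply: ge0_ae_eq_integral => //.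
- by apply/(measurable_restrictT _ mD); exact: measurable_funTS.
- by move=> z _; rewrite patchE; case: ifP.
exists (~` X); split.
- by apply: measurableC; exact: measurable_Xset.
- by rewrite N_Xset setICl measure0.
move=> z /=; apply: contra_notP => /contrapT Xz _.
rewrite patchE; case: ifPn => //; rewrite notin_setE => Dz.
by rewrite FD.
Qed.

Variables (nu : 'I_n.+1 -> probability R R) (P : probability Omega R).
Hypothesis P_PRM : is_PRM nu P.
Variables (zeta phi : R -> R -> 'M[R]_n.+1) (mu : R -> 'cV[R]_n.+1).
Hypotheses (zeta_ker : is_kernel nu zeta) (phi_self : is_self_excitation nu phi)
  (mu_base : is_baseline mu).
Variables (p : nat) (x : 'I_p -> pt R n).
Hypotheses (x_X : forall j, X (x j))
  (x_sorted : forall j m : 'I_p, (j <= m)%N -> (ptime (x j) <= ptime (x m))%R)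
  (x_compat : compatible mu phi x).
Variables (lam : Omega -> R -> 'cV[R]_n.+1) (Z : Omega -> R -> 'cV[R]_n.+1).
Hypothesis lam_pred : forall i, predictable (fun w t => lam w t i ord0).
Hypothesis mZ : forall T i, (0 <= T)%R -> measurable_fun setT (fun w => Z w T i ord0).
Hypothesis Z_eqs : {ae P, forall w, MSPD_eqs zeta mu phi lam Z (eps_plus x w)}.
Local Notation ckern := (@ckern R n).
Local Notation leb := (@lebR R).

Let phi_ker : is_kernel nu phi. Proof. by case: phi_self. Qed.

(** The intensity at the shifted configuration, as a function of the original one. The positive part
    makes it nonnegative everywhere; by [lam_ge0] it changes nothing where the equations hold. *)
Let L k (z : Omega * R) : R :=
  if (0 <= z.2)%R then Num.max (lam (eps_plus x z.1) z.2 k ord0) 0%R else 0%R.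

Let mL k : measurable_fun setT (L k).
Proof.
pose D := [set z : Omega * R | (0 <= z.2)%R].
have mD : measurable D by apply: measurable_le_fun => //; exact: measurable_snd.
pose l (z : Omega * R) := Num.max (lam z.1 z.2 k ord0) 0%R.
have ml : measurable_fun setT (l \_ D).
  apply/(measurable_restrictT _ mD); apply: measurable_maxr => //.
  exact: predictable_measurable (lam_pred k).
rewrite (_ : L k = (l \_ D) \o (fun z => (eps_plus x z.1, z.2))).
  apply: (measurableT_comp ml); apply: measurable_fun_pair => //.
  exact: (measurableT_comp (measurable_eps_plus x_X)).
apply/funext => z; rewrite /= patchE /L; congr (if _ then _ else _).
by apply/idP/idP; rewrite inE.
Qed.

Let L0 k z : (0 <= L k z)%R.
Proof. by rewrite /L; case: ifP => // _; rewrite le_max lexx orbT. Qed.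

Let L_neg k w t : (t < 0)%R -> L k (w, t) = 0%R.
Proof. by rewrite /L/= leNgt => ->. Qed.

Let L_past k : past_only (L k).
Proof.
move=> z w t Xz z0 tz; rewrite /L/=; case: ifP => // t0.
congr Num.max; apply: (predictable_same_past (lam_pred k) (tau := ptime z)) => //.
apply: same_past_eps_plus => //; exact: same_past_add_point.
Qed.

Let G (xi : R -> R -> 'M[R]_n.+1) i t w (z : pt R n) : \bar R :=
  mark_at (ext_kernel xi i) t z * (\1_(thin L) (w, z))%:E.

Let G0 xi i t w z : is_kernel nu xi -> 0 <= G xi i t w z.
Proof. by move=> xi_ker; rewrite mule_ge0 ?lee_fin//; exact: (ext_kernel_ge0 xi_ker). Qed.

Let mG xi i t w : is_kernel nu xi -> measurable_fun setT (G xi i t w).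
Proof.
move=> xi_ker; apply: emeasurable_funM.
  by apply: measurable_mark_at => k; exact: (measurable_ext_kernel xi_ker).
apply/measurable_EFinP.
exact: measurable_fun_pair2 w (measurable_indic (measurable_thin mL)).
Qed.

Let lam_ge0 w : MSPD_eqs zeta mu phi lam Z (eps_plus x w) ->
  forall t k, (0 <= t)%R -> (0 <= lam (eps_plus x w) t k ord0)%R.
Proof.
move=> eqs t k t0; have [_ lamE] := eqs t k t0.
rewrite -lee_fin lamE adde_ge0//; first by rewrite lee_fin; have [_] := mu_base k; exact.
apply: integral_ge0 => z [[[/= z0 _] zm] zt].
rewrite lee_fin mulr_ge0//; have [_ phi0 _] := phi_ker k (ptype z).
by apply: phi0 => //; rewrite subr_ge0.
Qed.

(** The added points split off as a finite sum. The restriction to [XT t] disappears because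
    [ext_kernel] vanishes at negative times. *)
Let thinned_intE xi i t w : is_kernel nu xi -> Good w -> (0 <= t)%R ->
  MSPD_eqs zeta mu phi lam Z (eps_plus x w) ->
  thinned_int xi lam (eps_plus x w) t i =
  \int[ckern w]_z G xi i t w z + \sum_(j < p) G xi i t w (x j).
Proof.
move=> xi_ker Gw t0 eqs.
have mXT : measurable (XT t : set (pt R n)).
  apply: measurableI; first exact: measurable_Xset.
  by apply: measurable_le_fun => //; exact: measurable_ptime.
rewrite integral_count_kernel// -ge0_integral_eps_plus//; last 2 first.
- exact: mG.
- by move=> z; exact: G0.
rewrite -(integral_N_Xset (eps_plus x w) mXT)//; last 3 first.
- exact: mG.
- by move=> z; exact: G0.
- move=> z Xz zt; rewrite /G /mark_at ext_kernel_neg ?mul0e//.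
  by rewrite subr_lt0 ltNge; apply/negP => h; apply: zt.
apply: eq_integral => z; rewrite inE => -[Xz /= zt]; case: (Xz) => -[/= z0 _] zm.
rewrite /G /mark_at ext_kernelE ?subr_ge0// -EFinM indicE; congr ((_ * (nat_of_bool _)%:R)%R%:E).
have lE : L (ptype z) (w, ptime z) = lam (eps_plus x w) (ptime z) (ptype z) ord0.
  by rewrite /L/= z0 max_l// lam_ge0.
by apply/idP/idP; rewrite inE /thin/= lE.
Qed.

(** Contribution of the j-th added point once it has survived the thinning. *)
Definition kick (xi : R -> R -> 'M[R]_n.+1) j (i : 'I_n.+1) (t : R) : \bar R :=
  ext_kernel xi i (ptype (x j)) (t - ptime (x j))%R (pmark (x j)).

(* Each added point survives the thinning: at its time the intensity dominates
   the baseline plus the contributions of the points added before it. *)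
Let thin_x w : Good w -> MSPD_eqs zeta mu phi lam Z (eps_plus x w) ->
  forall j, thin L (w, x j).
Proof.
move=> Gw eqs j.
move: {2}(nat_of_ord j) (leqnn j) => m; elim/ltn_ind: m j => m IHm j jm.
case: (x_X j) => -[/= j0 _] _.
rewrite /thin/= /L/= j0 max_l; last exact: lam_ge0.
apply: le_trans (x_compat j) _.
have [_] := eqs (ptime (x j)) (ptype (x j)) j0.
rewrite thinned_intE// => lamE.
rewrite -lee_fin lamE EFinD leeD2l// -sumEFin.
apply: (@le_trans _ _ (\sum_(j' < p) G phi (ptype (x j)) (ptime (x j)) w (x j'))); last first.
  by rewrite leeDr// integral_ge0// => z _; exact: G0.
rewrite big_mkcond/=; apply: lee_sum => l _; case: ifP => [lj|_]; last exact: G0.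
have lt_lm : (l < m)%N by exact: leq_trans jm.
rewrite /G indicE mem_set ?mule1; last by apply: (IHm l).
case: (x_X l) => -[_ _] /= ml.
by rewrite /mark_at ext_kernelE// subr_ge0 x_sorted// ltnW.
Qed.

Let G_x xi i t w j : Good w -> MSPD_eqs zeta mu phi lam Z (eps_plus x w) ->
  G xi i t w (x j) = kick xi j i t.
Proof. by move=> Gw eqs; rewrite /G indicE mem_set ?mule1//; exact: thin_x. Qed.

Definition mu_ext (i : 'I_n.+1) (t : R) : \bar R := if (0 <= t)%R then (mu t i ord0)%:E else 0.

(** The added points are never thinned, so their direct effect on the intensity is deterministic and
    joins the baseline. *)
Let b i t := mu_ext i t + \sum_(j < p) kick phi j i t.

Lemma measurable_mu_ext i : measurable_fun setT (mu_ext i).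
Proof.
have [mmu _] := mu_base i.
rewrite (_ : mu_ext i = (fun t => (mu t i ord0)%:E) \_ (`[0%R, +oo[%classic : set R)).
  by apply/(measurable_restrictT _ (measurable_itv _))/measurable_EFinP.
apply/funext => t; rewrite patchE /mu_ext; congr (if _ then _ else _).
by apply/idP/idP; rewrite inE/= in_itv/= andbT.
Qed.

Lemma mu_ext_ge0 i t : 0 <= mu_ext i t.
Proof.
by rewrite /mu_ext; case: ifP => // t0; rewrite lee_fin; have [_] := mu_base i; exact.
Qed.

Lemma measurable_kick j i : measurable_fun setT (kick phi j i).
Proof.
apply: (measurableT_comp (g := fun t : R => (t - ptime (x j), pmark (x j))%R)
  (measurable_ext_kernel phi_ker i (ptype (x j)))).
by apply: measurable_fun_pair => //; exact: measurable_funB.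
Qed.

Let kick0 j i t : 0 <= kick phi j i t.
Proof. exact: ext_kernel_ge0. Qed.

Let kick_neg j i t : (t < ptime (x j))%R -> kick phi j i t = 0.
Proof. by move=> tj; apply: ext_kernel_neg; rewrite subr_lt0. Qed.

Let x0 j : (0 <= ptime (x j))%R. Proof. by case: (x_X j) => -[]. Qed.

(** The process is the deterministic direct effect of the added points plus a thinned integral over
    the original configuration; the mean of the latter is the response to [b], which is additive in
    the baseline. *)
Lemma mean_shifted i T : (0 <= T)%R ->
  'E_P[fun w => Z (eps_plus x w) T i ord0] =
  \sum_(j < p) kick zeta j i T +
  (response nu zeta phi mu_ext i T + \sum_(j < p) response nu zeta phi (kick phi j) i T).
Proof.
move=> T0.
have good : {ae P, forall w, Good w /\ MSPD_eqs zeta mu phi lam Z (eps_plus x w)}.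
  by apply: filterS2 (ae_Good P_PRM) Z_eqs => w.
have mmu := measurable_mu_ext; have mu0 := mu_ext_ge0; have mk := measurable_kick.
have mb k : measurable_fun setT (b k).
  by apply: emeasurable_funD => //; exact: emeasurable_sum.
have b0 k t : 0 <= b k t by rewrite adde_ge0// sume_ge0.
have b_neg k t : (t < 0)%R -> b k t = 0.
  move=> t0; rewrite /b /mu_ext leNgt t0 add0e big1// => j _.
  exact/kick_neg/(lt_le_trans t0).
have L_eq k t : (0 <= t)%R -> {ae P, forall w, (L k (w, t))%:E =
    b k t + \int[ckern w]_z G phi k t w z}.
  move=> t0; apply: filterS good => w [Gw eqs].
  rewrite /L/= t0 max_l; last exact: lam_ge0.
  have [_ ->] := eqs t k t0; rewrite thinned_intE//.
  under eq_bigr do rewrite G_x//.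
  by rewrite /b /mu_ext t0 addeA addeAC.
have phi_int : forall k l, \int[leb]_t mark_mean nu (ext_kernel phi k) l t < +oo.
  by apply: mark_mean_integrable; case: phi_self.
have mIz : measurable_fun setT (fun w => \int[ckern w]_z G zeta i T w z).
  apply: (measurable_ckern_param (g := id)
    (F := fun z => mark_at (ext_kernel zeta i) T z.2 * (\1_(thin L) z)%:E)).
  - exact: measurable_id.
  - apply: emeasurable_funM.
      apply: (measurableT_comp (measurable_mark_at (measurable_ext_kernel zeta_ker i) T)).
      exact: measurable_snd.
    by apply/measurable_EFinP; exact: (measurable_indic (measurable_thin mL)).
  - by move=> z; rewrite mule_ge0 ?lee_fin//; exact: (ext_kernel_ge0 zeta_ker).
have kz0 : 0 <= \sum_(j < p) kick zeta j i T.
  by apply: sume_ge0 => j _; exact: (ext_kernel_ge0 zeta_ker).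
have Iz0 w : 0 <= \int[ckern w]_z G zeta i T w z.
  by apply: integral_ge0 => z _; exact: G0.
rewrite unlock (ae_eq_integral (fun w => \sum_(j < p) kick zeta j i T +
    \int[ckern w]_z G zeta i T w z))//; last 3 first.
- apply/measurable_EFinP.
  exact: (measurableT_comp (mZ i T0) (measurable_eps_plus x_X)).
- exact: emeasurable_funD.
- apply: filterS good => w [Gw eqs] _.
  have [-> _] := eqs T i T0; rewrite thinned_intE// addeC.
  by under eq_bigr do rewrite G_x//.
rewrite integral_probability_cstD//; congr (_ + _).
rewrite (mean_thinned P_PRM mL L0 L_neg L_past (measurable_ext_kernel phi_ker)
  (ext_kernel_ge0 phi_ker) (fun k l u y => @ext_kernel_neg _ _ phi k l u y)
  mb b0 b_neg phi_int L_eq T (measurable_ext_kernel zeta_ker i)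
  (ext_kernel_ge0 zeta_ker i)).
rewrite -(response_sum zeta_ker phi_ker) -?(responseD zeta_ker phi_ker)//.
- by move=> k; exact: emeasurable_sum.
- by move=> k v; exact: sume_ge0.
Qed.

End ShiftedProcess.

Theorem proposition5p1 (R : realType) (n : nat)
    (nu : 'I_n.+1 -> probability R R)
    (nu_ge0 : forall k, nu k `[0%R, +oo[%classic = 1)
    (P : probability (Omega R n) R) (P_PRM : is_PRM nu P)
    (zeta phi : R -> R -> 'M[R]_n.+1) (mu : R -> 'cV[R]_n.+1)
    (zeta_ker : is_kernel nu zeta)
    (phi_self : is_self_excitation nu phi)
    (mu_base : is_baseline mu)
    (T : R) (T_ge0 : (0 <= T)%R)
    (p : nat) (p_gt0 : (0 < p)%N) (x : 'I_p -> pt R n)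
    (x_XT : forall j, XT T (x j))
    (x_inj : injective x)
    (x_sorted : forall j m : 'I_p, (j <= m)%N -> (ptime (x j) <= ptime (x m))%R)
    (x_compat : compatible mu phi x)
    (Z : Omega R n -> R -> 'cV[R]_n.+1)
    (Z_MSPD : is_MSPD P zeta mu phi x Z) :
  (forall i, 'E_P[fun w => Z w T i ord0] =
    \int[lebesgue_measure]_(v in `[0%R, T]) \sum_(k < n.+1)
      kbar nu zeta i k (T - v)%R *
      ((mu v k ord0)%:E +
       \int[lebesgue_measure]_(w in `[0%R, v]) \sum_(l < n.+1)
         Psibar nu phi k l (v - w)%R * (mu w l ord0)%:E))
  /\
  (forall i, 'E_P[fun w => Z (eps_plus x w) T i ord0] =
    'E_P[fun w => Z w T i ord0] +
    \sum_(j < p) (zeta (T - ptime (x j))%R (pmark (x j)) i (ptype (x j)))%:E +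
    \sum_(j < p) \int[lebesgue_measure]_(v in `[ptime (x j), T])
      \sum_(k < n.+1) kbar nu zeta i k (T - v)%R *
      ((phi (v - ptime (x j))%R (pmark (x j)) k (ptype (x j)))%:E +
       \int[lebesgue_measure]_(w in `[ptime (x j), v]) \sum_(l < n.+1)
         Psibar nu phi k l (v - w)%R *
         (phi (w - ptime (x j))%R (pmark (x j)) l (ptype (x j)))%:E)).
Proof.
have phi_ker : is_kernel nu phi by case: phi_self.
have x_X j : Xset R n (x j) by case: (x_XT j).
have [lam [lam_pred mZ Z_ae Z_ae_shift]] := Z_MSPD.
have mean_Z i : 'E_P[fun w => Z w T i ord0] = response nu zeta phi (mu_ext mu) i T.
  (* With an empty family of added points the shift is the identity, and [mean_shifted] gives the
     unshifted mean. *)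
  pose x0 (j : 'I_0) : pt R n := point.
  rewrite (_ : (fun w => _) = fun w => Z (eps_plus x0 w) T i ord0); last first.
    by apply/funext => w; rewrite eps_plus0.
  rewrite (mean_shifted P_PRM zeta_ker phi_self mu_base (x := x0) _ _ _ lam_pred mZ _ i T_ge0).
  - by rewrite !big_ord0 add0e adde0.
  - by case.
  - by case.
  - by case.
  - by apply: filterS Z_ae => w; rewrite eps_plus0.
split=> i.
  rewrite mean_Z (responseE zeta_ker phi_ker (t0 := 0%R)); last 3 first.
  - by move=> k; exact: (measurable_mu_ext mu_base).
  - by move=> k v; exact: (mu_ext_ge0 mu_base).
  - by move=> k v v0; rewrite /mu_ext leNgt v0.
  apply: eq_integral => v; rewrite inE/= in_itv/= => /andP[v0 _].
  apply: eq_bigr => k _; rewrite {1}/mu_ext v0; congr (_ * (_ + _)).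
  apply: eq_integral => w; rewrite inE/= in_itv/= => /andP[w0 _].
  by apply: eq_bigr => l _; rewrite /mu_ext w0.
rewrite (mean_shifted P_PRM zeta_ker phi_self mu_base x_X x_sorted x_compat lam_pred mZ
  Z_ae_shift i T_ge0) -mean_Z addeCA addeA.
have y0 j : (0 <= pmark (x j))%R by case: (x_X j).
have tT j : (ptime (x j) <= T)%R by case: (x_XT j).
congr (_ + _ + _).
  by apply: eq_bigr => j _; rewrite /kick ext_kernelE// subr_ge0.
apply: eq_bigr => j _.
rewrite (responseE zeta_ker phi_ker (t0 := ptime (x j))); last 3 first.
- by move=> k; exact: (measurable_kick phi_self).
- by move=> k v; exact: (ext_kernel_ge0 phi_ker).
- by move=> k v v0; rewrite /kick ext_kernel_neg// subr_lt0.
apply: eq_integral => v; rewrite inE/= in_itv/= => /andP[v0 _].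
apply: eq_bigr => k _; rewrite {1}/kick ext_kernelE ?subr_ge0//; congr (_ * (_ + _)).
apply: eq_integral => w; rewrite inE/= in_itv/= => /andP[w0 _].
by apply: eq_bigr => l _; rewrite /kick ext_kernelE// subr_ge0.
Qed.
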